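(* Consider the algebraic structure consisting of a vector space with a single endomorphism (type $((1,1))$). Then $K[X]$ is the extension of scalars from $\mathbb{Z}$ to $K$ of the universal PSH-algebra of Zelevinsky. More precisely, let $A\subseteq K[X]$ be the $\mathbb{Z}$-lattice spanned by the elements $\{\lambda\}$, for all partitions $\lambda$ of all $n\in\mathbb{N}$. The elements $\{\lambda\}$ form an orthonormal $K$-basis of $K[X]$, and the map $A\to\bigoplus_{n\ge0}\mathrm{R}(S_n)$, $\{\lambda\}\mapsto[\mathbb{S}_\lambda]$, identifies the multiplication, comultiplication and inner product of $A$ (restricted from those of $K[X]$) with those of $\bigoplus_{n\geq 0}\mathrm{R}(S_n)$.
   Context: $K$ is an algebraically closed field of characteristic zero. **The algebra $K[X]$ for a single endomorphism.** $K[X]=\bigoplus_{n\ge0}K[X]_n$, where $K[X]_n=(KS_n)_{S_n}$ is the space of coinvariants of the conjugation action of $S_n$ on $KS_n$ (so it has a basis indexed by conjugacy classes); the class of $\sigma\in S_n$ is denoted $\overline\sigma$ and corresponds to the invariant $T\mapsto\mathrm{Tr}(L^{(n)}_\sigma T^{\otimes n})=\mathrm{Tr}(T^{\lambda_1})\cdots\mathrm{Tr}(T^{\lambda_t})$, where $\lambda_1,\ldots,\lambda_t$ are the cycle lengths of $\sigma$. Multiplication: $\overline\sigma\cdot\overline\tau=\overline{(\sigma,\tau)}$, with $(\sigma,\tau)\in S_n\times S_m\subseteq S_{n+m}$. Thus $K[X]=K[\mathrm{Tr}(T),\mathrm{Tr}(T^2),\ldots]$ is a polynomial algebra on the classes of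 $n$-cycles, $n\ge1$, and the comultiplication $\Delta$ is the algebra map for which these classes are primitive. The inner product makes different degrees orthogonal, and on $K[X]_n$ is $\langle\overline\sigma,\overline\tau\rangle=|C_{S_n}(\sigma)|$ if $\sigma,\tau$ are conjugate and $0$ otherwise. **The elements $\{\lambda\}$.** For $\lambda\vdash n$ let $\mathbb{S}_\lambda$ be the Specht module, $d_\lambda=\dim\mathbb{S}_\lambda$, and $e_\lambda\in KS_n$ the corresponding central idempotent. Let $\phi:(KS_n)^{S_n}\to(KS_n)_{S_n}$ be $z\mapsto\overline z$. Then $\{\lambda\}=\frac1{d_\lambda}\phi(e_\lambda)$. **The universal PSH-algebra.** $\bigoplus_{n\ge0}\mathrm{R}(S_n)$, the direct sum of the Grothendieck groups of representations (over $K$) of the symmetric groups, with $[V]\cdot[W]=[\mathrm{Ind}_{S_n\times S_m}^{S_{n+m}}V\otimes W]$ for $[V]\in\mathrm{R}(S_n)$, $[W]\in\mathrm{R}(S_m)$; $\Delta([V])=\sum_{a+b=n}[\mathrm{Res}^{S_n}_{S_a\times S_b}V]\in\bigoplus_{a+b=n}\mathrm{R}(S_a)\otimes\mathrm{R}(S_b)$; and the inner product for which the classes of irreducible representations are orthonormal. *)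

(* Defs.v *)
From HB Require Import structures.
From mathcomp Require Import all_boot all_order all_algebra all_fingroup.
From mathcomp Require Import generic_quotient ring_quotient mxrepresentation.
From mathcomp Require character.
From mathcomp Require Import finmap.
From mathcomp Require Import boolp.
From mathcomp.multinomials Require Import monalg.

Set Implicit Arguments.
Unset Strict Implicit.
Unset Printing Implicit Defensive.

Import GroupScope GRing.Theory.
Local Open Scope quotient_scope.
Local Open Scope ring_scope.

Section Presented.
Variables (R : nzRingType) (T : choiceType) (S : {malg R[T]} -> Prop).

Definition rspan : {pred {malg R[T]}} := fun x =>
  `[< exists s : seq (R * {malg R[T]}),
        (forall p, p \in s -> S p.2) /\ x = \sum_(p <- s) p.1 *: p.2 >].

Fact rspan_submod : submod_closed rspan.
Proof.
split=> [|a x y /asboolP[s [sS ->]] /asboolP[t [tS ->]]]; apply/asboolP.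
  by exists [::]; split=> //; rewrite big_nil.
exists ([seq (a * p.1, p.2) | p <- s] ++ t); split=> [p|].
  by rewrite mem_cat => /orP[/mapP[q /sS Sq ->] //|/tS].
rewrite big_cat big_map scaler_sumr; congr (_ + _).
by apply: eq_bigr => p _; rewrite scalerA.
Qed.
HB.instance Definition _ :=
  GRing.isSubmodClosed.Build R {malg R[T]} rspan rspan_submod.

(* The R-module with generators T and relations r = 0 for r satisfying S,     *)
(* i.e., the quotient of the free module by the submodule spanned by S.       *)
Definition pmod := {ideal_quot rspan}.
HB.instance Definition _ := GRing.Zmodule.on pmod.

Definition pmod_scale (a : R) (x : pmod) : pmod := \pi_pmod (a *: repr x).

Fact pmod_scale_pi a x : pmod_scale a (\pi_pmod x) = \pi_pmod (a *: x).
Proof.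
apply/eqP; rewrite -Quotient.idealrBE -scalerBr rpredZ //.
by rewrite Quotient.idealrBE reprK.
Qed.

Fact pmod_piD x y : \pi_pmod (x + y) = \pi_pmod x + \pi_pmod y.
Proof. exact: (@Quotient.pi_add _ rspan). Qed.

Fact pmod_scaleA a b x : pmod_scale a (pmod_scale b x) = pmod_scale (a * b) x.
Proof.
by elim/quotW: x => x; rewrite (pmod_scale_pi b) !pmod_scale_pi scalerA.
Qed.
Fact pmod_scale1 : left_id 1 pmod_scale.
Proof. by elim/quotW => x; rewrite pmod_scale_pi scale1r. Qed.
Fact pmod_scaleDr : right_distributive pmod_scale +%R.
Proof.
move=> a; elim/quotW => x; elim/quotW => y.
by rewrite -pmod_piD !pmod_scale_pi scalerDr pmod_piD.
Qed.
Fact pmod_scaleDl x : {morph pmod_scale^~ x : a b / a + b}.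
Proof.
by elim/quotW: x => x a b; rewrite !pmod_scale_pi scalerDl pmod_piD.
Qed.
HB.instance Definition _ := GRing.Zmodule_isLmodule.Build R pmod
  pmod_scaleA pmod_scale1 pmod_scaleDr pmod_scaleDl.

Definition pclass (x : {malg R[T]}) : pmod := \pi_pmod x.
Definition pgen (t : T) : pmod := pclass << t >>.

Fact pclass_linear : linear pclass.
Proof.
move=> a x y; rewrite /pclass pmod_piD; congr (_ + _); exact/esym/pmod_scale_pi.
Qed.
HB.instance Definition _ :=
  GRing.isLinear.Build R {malg R[T]} pmod _ pclass pclass_linear.

Section Lift.
Variables (P : lmodType R) (f : T -> P).

(* The linear map out of the free module with value f t on the generator t.   *)
Definition plin (x : {malg R[T]}) : P := \sum_(t <- msupp x) x@_t *: f t.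

Lemma plinW (x : {malg R[T]}) (d : {fset T}) :
  (msupp x `<=` d)%fset -> plin x = \sum_(t <- d) x@_t *: f t.
Proof.
move=> sd; rewrite /plin; apply: big_fset_incl => // t _ /mcoeff_outdom ->.
by rewrite scale0r.
Qed.
Lemma plin_linear : linear plin.
Proof.
move=> a x y; set d := (msupp x `|` msupp y `|` msupp (a *: x + y))%fset.
rewrite !(@plinW _ d) ?fsubsetUr //; try by
  apply: fsubset_trans (fsubsetUl _ _); rewrite ?fsubsetUl ?fsubsetUr.
rewrite scaler_sumr -big_split; apply: eq_bigr => t _ /=.
by rewrite mcoeffD mcoeffZ scalerDl scalerA.
Qed.
HB.instance Definition _ :=
  GRing.isLinear.Build R {malg R[T]} P _ plin plin_linear.
Lemma plinU t : plin << t >> = f t.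
Proof.
rewrite (@plinW _ [fset t]%fset) ?msuppU_le // big_seq_fset1.
by rewrite mcoeffUU scale1r.
Qed.

(* The linear map induced by plin on pmod. It is evaluated on a               *)
(* representative, so it is meaningful when plin kills the relations.         *)
Definition plift (x : pmod) : P := plin (repr x).

Hypothesis fS : forall r, S r -> plin r = 0.
Lemma plift_class x : plift (pclass x) = plin x.
Proof.
rewrite /plift -/(plin _); apply/eqP; rewrite -subr_eq0 -raddfB; apply/eqP.
have : repr (pclass x) - x \in rspan.
  have := @Quotient.idealrBE _ (rspan) (repr (pclass x)) x.
  by move=> ->; rewrite reprK.
case/asboolP => s [sS ->] /=; rewrite linear_sum big_seq big1 // => p /sS/fS.
by rewrite linearZ /= => ->; rewrite scaler0.
Qed.
Lemma plift_gen t : plift (pgen t) = f t.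
Proof. by rewrite plift_class plinU. Qed.
Lemma plift_lin : linear (plift : pmod -> P).
Proof.
move=> a; elim/quotW => x; elim/quotW => y.
rewrite -[\pi x]/(pclass x) -[\pi y]/(pclass y) -pclass_linear.
rewrite !plift_class; exact: plin_linear.
Qed.
Lemma plift0 : plift (0 : pmod) = 0.
Proof. by rewrite -(raddf0 (pclass)) plift_class raddf0. Qed.

End Lift.

End Presented.

Section Tensor.
Variables (R : comNzRingType) (M N : lmodType R).

Variant tens_rel : {malg R[(M * N)%type]} -> Prop :=
| TensDl x x' y : tens_rel (<< (x + x', y) >> - << (x, y) >> - << (x', y) >>)
| TensDr x y y' : tens_rel (<< (x, y + y') >> - << (x, y) >> - << (x, y') >>)
| TensZl a x y : tens_rel (<< (a *: x, y) >> - a *: << (x, y) >>)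
| TensZr a x y : tens_rel (<< (x, a *: y) >> - a *: << (x, y) >>).

Definition tens := pmod tens_rel.
HB.instance Definition _ := GRing.Lmodule.on tens.

Definition tmul (x : M) (y : N) : tens := pgen tens_rel (x, y).

(* The linear map M (x) N -> P induced by a bilinear f.                       *)
Definition tlift (P : lmodType R) (f : M -> N -> P) : tens -> P :=
  plift (fun p => f p.1 p.2).

End Tensor.
Notation "x '⊗' y" := (tmul x y) (at level 40, left associativity).

Section DirectSum.
Variables (R : nzRingType) (V : nat -> lmodType R).

Record dsum := DSum {
  dval :> forall n, V n;
  dval_fin : exists N, forall n, (N <= n)%N -> dval n = 0 }.
HB.instance Definition _ := gen_eqMixin dsum.
HB.instance Definition _ := gen_choiceMixin dsum.

Lemma dsumP (x y : dsum) : (forall n, x n = y n) -> x = y.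
Proof.
case: x y => [x xf] [y yf] /= xy.
have {xy} exy : x = y by apply/functional_extensionality_dep.
by case: _ / exy in yf *; congr DSum; apply: Prop_irrelevance.
Qed.

Fact dsum0_subproof : exists N, forall n, (N <= n)%N -> (0 : V n) = 0.
Proof. by exists 0%N. Qed.
Fact dsumD_subproof (x y : dsum) :
  exists N, forall n, (N <= n)%N -> x n + y n = 0.
Proof.
have [[N xN] [M yM]] := (dval_fin x, dval_fin y); exists (maxn N M) => n.
by rewrite geq_max => /andP[/xN-> /yM->]; rewrite addr0.
Qed.
Fact dsumZ_subproof a (x : dsum) :
  exists N, forall n, (N <= n)%N -> a *: x n = 0.
Proof. by have [N xN] := dval_fin x; exists N => n /xN->; rewrite scaler0. Qed.
Fact dsumN_subproof (x : dsum) : exists N, forall n, (N <= n)%N -> - x n = 0.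
Proof. by have [N xN] := dval_fin x; exists N => n /xN->; rewrite oppr0. Qed.

Definition dsum_zero := DSum dsum0_subproof.
Definition dsum_add x y := DSum (dsumD_subproof x y).
Definition dsum_opp x := DSum (dsumN_subproof x).
Definition dsum_scale a x := DSum (dsumZ_subproof a x).

Fact dsum_addA : associative dsum_add.
Proof. by move=> x y z; apply: dsumP => n /=; rewrite addrA. Qed.
Fact dsum_addC : commutative dsum_add.
Proof. by move=> x y; apply: dsumP => n /=; rewrite addrC. Qed.
Fact dsum_add0 : left_id dsum_zero dsum_add.
Proof. by move=> x; apply: dsumP => n /=; rewrite add0r. Qed.
Fact dsum_addN : left_inverse dsum_zero dsum_opp dsum_add.
Proof. by move=> x; apply: dsumP => n /=; rewrite addNr. Qed.
HB.instance Definition _ :=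
  GRing.isZmodule.Build dsum dsum_addA dsum_addC dsum_add0 dsum_addN.

Fact dsum_scaleA a b x : dsum_scale a (dsum_scale b x) = dsum_scale (a * b) x.
Proof. by apply: dsumP => n /=; rewrite scalerA. Qed.
Fact dsum_scale1 : left_id 1 dsum_scale.
Proof. by move=> x; apply: dsumP => n /=; rewrite scale1r. Qed.
Fact dsum_scaleDr : right_distributive dsum_scale +%R.
Proof. by move=> a x y; apply: dsumP => n /=; rewrite scalerDr. Qed.
Fact dsum_scaleDl x : {morph dsum_scale^~ x : a b / a + b}.
Proof. by move=> a b; apply: dsumP => n /=; rewrite scalerDl. Qed.
HB.instance Definition _ := GRing.Zmodule_isLmodule.Build R dsum
  dsum_scaleA dsum_scale1 dsum_scaleDr dsum_scaleDl.

Definition din_val n (v : V n) m : V m :=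
  if n =P m is ReflectT e then ecast k (V k) e v else 0.
Fact din_subproof n (v : V n) :
  exists N, forall m, (N <= m)%N -> din_val v m = 0.
Proof.
exists n.+1 => m; rewrite /din_val; case: eqP => // e.
by rewrite [in X in (X <= _)%N]e ltnn.
Qed.
Definition din n (v : V n) : dsum := DSum (din_subproof v).

(* The linear map out of the direct sum with components f n; the bound is     *)
(* any N beyond which x vanishes.                                             *)
Definition dlift (P : lmodType R) (f : forall n, V n -> P) (x : dsum) : P :=
  \sum_(n < sval (cid (dval_fin x))) f n (x n).

Lemma dlift_din (P : lmodType R) (f : forall n, V n -> P) n (v : V n) :
  (forall m, f m 0 = 0) -> dlift f (din v) = f n v.
Proof.
move=> f0; rewrite /dlift; case: cid => N /= HN.
have vn : din_val v n = v by rewrite /din_val; case: eqP => // e; rewrite eq_axiomK.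
have [ltnN|leNn] := ltnP n N.
  rewrite (bigD1 (Ordinal ltnN)) //= vn big1 ?addr0 // => m ne.
  rewrite /din_val; case: eqP => [e|]; last by rewrite f0.
  by case/eqP: ne; apply: val_inj.
have v0 : v = 0 by rewrite -vn HN.
rewrite v0 f0 big1 // => m _; rewrite /din_val; case: eqP => [e|]; last by rewrite f0.
by case: _ / e; rewrite f0.
Qed.

End DirectSum.

Definition bilin (R : nzRingType) (M N P : lmodType R) (f : M -> N -> P) :=
  (forall y, linear (f^~ y)) /\ (forall x, linear (f x)).

(* Hamel basis of a possibly infinite-dimensional space.                      *)
Definition is_basis (R : nzRingType) (V : lmodType R) (I : eqType)
    (b : I -> V) : Prop :=
  (forall (s : seq I) (c : I -> R), uniq s ->
     \sum_(i <- s) c i *: b i = 0 -> forall i, i \in s -> c i = 0) /\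
  (forall x, exists (s : seq I) (c : I -> R), x = \sum_(i <- s) c i *: b i).

Section Join.
Variables a b : nat.

Definition join_fun (p : 'S_a * 'S_b) (i : 'I_(a + b)) : 'I_(a + b) :=
  unsplit (match split i with inl j => inl (p.1 j) | inr k => inr (p.2 k) end).

Fact join_fun_inj p : injective (join_fun p).
Proof.
move=> i j /(can_inj (@unsplitK _ _)) eq_ij; apply: (can_inj (@splitK _ _)).
by case: (split i) (split j) eq_ij => [i'|i'] [j'|j'] //= [/perm_inj->].
Qed.

Definition join (p : 'S_a * 'S_b) : 'S_(a + b) := perm (@join_fun_inj p).

Lemma joinM : {morph join : p q / (p * q)%g}.
Proof.
move=> p q; apply/permP=> i; rewrite permM !permE /join_fun unsplitK.
by case: (split i) => j; rewrite /= permM.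
Qed.

Lemma join_inj : injective join.
Proof.
move=> p q /permP pq; apply/eqP/andP; split; apply/eqP/permP=> i.
  have := pq (unsplit (inl i)); rewrite !permE /join_fun unsplitK.
  by move/(can_inj (@unsplitK _ _)) => [].
have := pq (unsplit (inr i)); rewrite !permE /join_fun unsplitK.
by move/(can_inj (@unsplitK _ _)) => [].
Qed.

Lemma joinJ (p q : 'S_a * 'S_b) : join (p ^ q)%g = (join p ^ join q)%g.
Proof.
have hV r : join r^-1%g = (join r)^-1%g.
  apply: (mulgI (join r)); rewrite -joinM !mulgV; apply: (mulgI (join 1%g)).
  by rewrite -joinM !mulg1.
by rewrite !conjgE !joinM hV.
Qed.

Variables (n : nat) (eab : (a + b)%N = n).
Definition join_in (p : 'S_a * 'S_b) : 'S_n := cast_perm eab (join p).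

Lemma join_inM : {morph join_in : p q / (p * q)%g}.
Proof. by move=> p q; rewrite /join_in joinM; case: _ / eab. Qed.

End Join.

Section KX.
Variable K : fieldType.

(* KS_n is the free module {malg K['S_n]}, and K[X]_n its coinvariants.       *)
Variant coinv_rel n : {malg K['S_n]} -> Prop :=
| CoinvRel (s t : 'S_n) : coinv_rel (<< (s ^ t)%g >> - << s >>).

Definition KXn n : lmodType K := pmod (@coinv_rel n).
Definition KX := dsum KXn.
HB.instance Definition _ := GRing.Lmodule.on KX.

Definition cls n (s : 'S_n) : KX := din (pgen (@coinv_rel n) s).

Definition oneX : KX := cls (1%g : 'S_0).

Definition mulX (x y : KX) : KX :=
  dlift (fun a u => dlift (fun b v =>
    plift (fun s => plift (fun t => cls (join (s, t))) v) u) y) x.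

Definition tmulX (x y : tens KX KX) : tens KX KX :=
  tlift (fun x1 x2 =>
    tlift (fun y1 y2 => mulX x1 y1 ⊗ mulX x2 y2) y) x.

Definition is_comulX (D : KX -> tens KX KX) : Prop :=
  [/\ linear D,
      D oneX = oneX ⊗ oneX,
      forall x y, D (mulX x y) = tmulX (D x) (D y)
    & (* n-cycles of S_n, n >= 1: exactly one orbit *)
      forall n (s : 'S_n), #|porbits s| = 1%N ->
        D (cls s) = cls s ⊗ oneX + oneX ⊗ cls s].

Definition formX (x y : KX) : K :=
  dlift (fun n (u : KXn n) => plift (fun s => plift (fun t =>
    (if t \in s ^: [set: 'S_n] then #|'C[s]|%:R else 0) : K^o) (y n)) u) x.

Lemma clsJ n (s t : 'S_n) : cls (s ^ t)%g = cls s.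
Proof.
rewrite /cls; congr din; apply/eqP; rewrite /pgen -subr_eq0 -raddfB /=.
rewrite -(raddf0 (pclass (@coinv_rel n))) /= -Quotient.idealrBE subr0; apply/asboolP.
exists [:: (1, << (s ^ t)%g >> - << s >>)]; rewrite big_seq1 scale1r; split=> // p.
by rewrite inE => /eqP -> /=; constructor.
Qed.

Lemma join_conj1 a b (u w : 'S_a) (s t : 'S_b) :
  join ((u, s) ^ (w, t))%g = join ((u ^ w)%g, (s ^ t)%g).
Proof. by []. Qed.
Lemma clsJr a b (s' : 'S_a) (u w : 'S_b) : cls (join (s', (u ^ w)%g)) = cls (join (s', u)).
Proof. by rewrite -(clsJ (join (s', u)) (join (1%g, w))) -joinJ join_conj1 conjg1. Qed.
Lemma clsJl a b (s' : 'S_b) (u w : 'S_a) : cls (join ((u ^ w)%g, s')) = cls (join (u, s')).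
Proof. by rewrite -(clsJ (join (u, s')) (join (w, 1%g))) -joinJ join_conj1 conjg1. Qed.

Lemma mulX_cls a b (s : 'S_a) (t : 'S_b) : mulX (cls s) (cls t) = cls (join (s, t)).
Proof.
pose g a b (s : 'S_a) (t : 'S_b) : KX := cls (join (s, t)).
have gl a' b' (s' : 'S_a') r : coinv_rel r -> plin (g a' b' s') r = 0.
  case=> u w; rewrite raddfB /= !plinU /g.
  by rewrite clsJr subrr.
pose F a' b' (v : KXn b') (s' : 'S_a') := plift (g a' b' s') v.
have Fl a' b' (v : KXn b') r : coinv_rel r -> plin (F a' b' v) r = 0.
  case=> u w; rewrite raddfB /= !plinU /F /plift /plin -sumrB big1 // => z _.
  by rewrite -scalerBr /g clsJl subrr scaler0.
have z1 a' b' (u : KXn a') : plift (F a' b' 0) u = 0.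
  rewrite /plift /plin big1 // => s' _; rewrite /F.
  have -> : plift (g a' b' s') (0 : KXn b') = 0.
    exact: (plift0 (@gl a' b' s')).
  by rewrite scaler0.
rewrite /mulX /cls dlift_din.
  rewrite dlift_din //; last by move=> n; apply: (z1 a n).
  rewrite (plift_gen (@Fl a b _)) /F; exact: (plift_gen (@gl a b s)).
move=> n; rewrite /dlift big1 // => m _.
exact: (plift0 (@Fl n m _)).
Qed.

Lemma formX_cls n (s t : 'S_n) : formX (cls s) (cls t) =
  if t \in s ^: [set: 'S_n] then #|'C[s]|%:R else 0.
Proof.
pose W n (s' t' : 'S_n) : K^o := if t' \in s' ^: [set: 'S_n] then #|'C[s']|%:R else 0.
have Wr n' (s' t' u : 'S_n') : W n' s' (t' ^ u)%g = W n' s' t'.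
  congr (if _ then _ else _); apply/idP/idP=> /imsetP[v _ e].
    by rewrite -(conjgK u t') e -conjgM imset_f ?inE.
  by rewrite e -conjgM imset_f ?inE.
have Wl n' (s' t' u : 'S_n') : W n' (s' ^ u)%g t' = W n' s' t'.
  rewrite /W classGidl ?inE //; congr (if _ then _%:R else _).
  by rewrite cent1J cardJg.
have gl n' (s' : 'S_n') r : coinv_rel r -> plin (W n' s') r = 0.
  by case=> u w; rewrite raddfB /= !plinU Wr subrr.
pose F n' (v : KXn n') (s' : 'S_n') := plift (W n' s') v.
have Fl n' (v : KXn n') r : coinv_rel r -> plin (F n' v) r = 0.
  case=> u w; rewrite raddfB /= !plinU /F /plift /plin -sumrB big1 // => z _.
  by rewrite -scalerBr Wl subrr scaler0.
rewrite /formX /cls dlift_din.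
  have -> : (din (pgen (@coinv_rel n) t) : KX) n = pgen (@coinv_rel n) t.
    by rewrite /= /din_val; case: eqP => // e; rewrite eq_axiomK.
  by rewrite (plift_gen (@Fl n _)) /F (plift_gen (@gl n s)).
move=> m.
exact: (plift0 (@Fl m _)).
Qed.

End KX.

Section Groth.
Variable K : fieldType.

Section Group.
Variable gT : finGroupType.

Record rep := Rep { rdim : nat; rrep :> mx_representation K [set: gT] rdim }.
HB.instance Definition _ := gen_eqMixin rep.
HB.instance Definition _ := gen_choiceMixin rep.

Variant groth_rel : {malg int[rep]} -> Prop :=
| GrothIso (V W : rep) of mx_rsim V W : groth_rel (<< V >> - << W >>)
| GrothExact (V : rep) (U : 'M_(rdim V)) (modU : mxmodule V U) :
    groth_rel (<< V >> - << Rep (submod_repr modU) >>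
                       - << Rep (factmod_repr modU) >>).

Definition groth : lmodType int := pmod groth_rel.
Definition gcls (V : rep) : groth := pgen groth_rel V.

End Group.

(* Restriction along a homomorphism h. *)
Section Pullback.
Variables (hT gT : finGroupType) (h : hT -> gT).
Hypothesis hM : {morph h : x y / (x * y)%g}.

Fact pull_mx_repr (V : rep gT) : mx_repr [set: hT] (fun x => V (h x)).
Proof.
split=> [|x y _ _]; last by rewrite hM repr_mxM ?inE.
have h1 : h 1%g = 1%g.
  by apply: (mulgI (h 1%g)); rewrite -hM !mulg1.
by rewrite h1 repr_mx1.
Qed.
Definition pull (V : rep gT) : rep hT := Rep (MxRepresentation (pull_mx_repr V)).

End Pullback.

Fact fst_morph (gT hT : finGroupType) :
  {morph @fst gT hT : x y / (x * y)%g}.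
Proof. by []. Qed.
Fact snd_morph (gT hT : finGroupType) :
  {morph @snd gT hT : x y / (x * y)%g}.
Proof. by []. Qed.
(* The external tensor product of V and W, by Kronecker products.             *)
Definition extprod (gT hT : finGroupType) (V : rep gT) (W : rep hT) :
    rep (gT * hT)%type :=
  Rep (character.prod_repr (pull (@fst_morph gT hT) V)
                           (pull (@snd_morph gT hT) W)).

(* Induction along an injective homomorphism h : H -> G. With representatives *)
(* r_C of the right cosets C of h(H), the right module V (x)_KH KG is the sum *)
(* of the V (x) r_C, and v (x) r_C is mapped by g to v.x (x) r_D when         *)
(* r_C g = h(x) r_D. For given C and g there is just one such pair (D, x).    *)
Section Induction.
Variables (hT gT : finGroupType) (h : hT -> gT).
Hypothesis hM : {morph h : x y / (x * y)%g}.
Hypothesis h_inj : injective h.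
Variable V : rep hT.

Definition hcoset := {C : {set gT} | C \in rcosets (h @: [set: hT]) [set: gT]}.
Definition ind_index := (hcoset * 'I_(rdim V))%type.

Definition ind_mx (g : gT) : 'M[K]_#|{: ind_index}| :=
  \matrix_(i, j)
    let p : ind_index := enum_val i in let q : ind_index := enum_val j in
    \sum_(x | (h x * fingroup.repr (val q.1))%g ==
              (fingroup.repr (val p.1) * g)%g) V x p.2 q.2.

Fact hom1 : h 1%g = 1%g.
Proof. by apply: (mulgI (h 1%g)); rewrite -hM !mulg1. Qed.

Fact himage_group : group_set (h @: [set: hT]).
Proof.
apply/group_setP; split=> [|_ _ /imsetP[x _ ->] /imsetP[y _ ->]].
  by rewrite -hom1 imset_f.
by rewrite -hM imset_f.
Qed.
Let H := Group himage_group.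

Fact hcosetE (C : hcoset) x : (H :* (h x * fingroup.repr (val C)))%g = val C.
Proof.
have Hx : h x \in H by rewrite imset_f.
have /rcosetsP[g _ ->] : val C \in rcosets H [set: gT] := valP C.
by rewrite rcosetM rcoset_id // rcoset_repr.
Qed.

Fact hcoset_uniq (C D : hcoset) x y :
  (h x * fingroup.repr (val C) = h y * fingroup.repr (val D))%g -> C = D.
Proof. by move=> e; apply/val_inj; rewrite -(hcosetE C x) e hcosetE. Qed.

Fact hcoset_ex g : exists p : hcoset * hT, (h p.2 * fingroup.repr (val p.1))%g = g.
Proof.
have CP : (H :* g)%g \in rcosets (h @: [set: hT]) [set: gT].
  by apply/rcosetsP; exists g; rewrite ?inE.
have /rcosetP[_ /imsetP[x _ ->] gE] : g \in (H :* fingroup.repr (H :* g))%g.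
  by rewrite rcoset_repr rcoset_refl.
by exists (exist (fun C => C \in rcosets _ _) _ CP : hcoset, x).
Qed.

Fact ind_mx_repr : mx_repr [set: gT] ind_mx.
Proof.
split=> [|g g' _ _]; apply/matrixP=> i j; rewrite !mxE.
  rewrite -[i == j](inj_eq enum_val_inj).
  case: (enum_val i) (enum_val j) => [C k] [D l] /=.
  rewrite mulg1 xpair_eqE; have [<-|neCD] /= := eqVneq C D.
    rewrite (big_pred1 1%g) ?repr_mx1 ?mxE // => x.
    by rewrite -{2}[fingroup.repr _]mul1g (inj_eq (mulIg _)) -hom1 (inj_eq h_inj).
  apply: big1 => x /eqP e; case/eqP: neCD; apply: esym.
  by apply: (@hcoset_uniq _ _ x 1%g); rewrite hom1 mul1g.
under eq_bigr => m _ do rewrite !mxE.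
case: (enum_val i) (enum_val j) => [C k] [E l] /=.
have [[D x0] /= x0P] := hcoset_ex (fingroup.repr (val C) * g)%g.
pose F (q : ind_index) := (\sum_(x | (h x * fingroup.repr (val q.1))%g ==
    (fingroup.repr (val C) * g)%g) V x k q.2) *
  (\sum_(y | (h y * fingroup.repr (val E))%g ==
             (fingroup.repr (val q.1) * g')%g) V y q.2 l).
transitivity (\sum_q F q); last first.
  rewrite (reindex (@enum_val _ {: ind_index})) //=.
  by apply: onW_bij; apply: enum_val_bij.
have -> : \sum_q F q = \sum_m F (D, m).
  rewrite -(pair_bigA _ (fun C' m => F (C', m))) (bigD1 D) //=.
  rewrite [X in _ + X]big1 ?addr0 //.
  move=> C' neC'; apply: big1 => m _; rewrite /F big1 ?mul0r //= => x /eqP e.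
  by case/eqP: neC'; apply: (@hcoset_uniq _ _ x x0); rewrite e x0P.
have FE m : F (D, m) = \sum_(y | (h y * fingroup.repr (val E))%g ==
    (fingroup.repr (val D) * g')%g) V x0 k m * V y m l.
  rewrite /F /= (big_pred1 x0) ?mulr_sumr // => x.
  by rewrite -[X in _ == X]x0P (inj_eq (mulIg _)) (inj_eq h_inj).
under [RHS]eq_bigr => m _ do rewrite FE.
rewrite exchange_big /= (reindex_inj (mulgI x0)) /=; apply: eq_big => [y|y _].
  rewrite hM -!mulgA [X in _ == X]mulgA.
  by rewrite -[X in _ == (X * _)%g]x0P -mulgA (inj_eq (mulgI _)).
by rewrite repr_mxM ?inE // mxE.
Qed.

Definition induced : rep gT := Rep (MxRepresentation ind_mx_repr).
End Induction.

End Groth.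

Section RS.
Variable K : fieldType.

Definition RSn n : lmodType int := groth K 'S_n.
Definition RS := dsum RSn.
HB.instance Definition _ := GRing.Lmodule.on RS.

Definition rcls n (V : rep K 'S_n) : RS := @din _ RSn n (gcls V).

Definition mulR (x y : RS) : RS :=
  dlift (fun a u => dlift (fun b v =>
    plift (fun V => plift (fun W =>
      rcls (induced (@joinM a b) (@join_inj a b) (extprod V W))) v) u) y) x.

(* The canonical map R(G) (x) R(H) -> R(G x H), through which the restriction *)
(* of a representation of S_n to S_a x S_b is read in R(S_a) (x) R(S_b).      *)
Definition extmap (gT hT : finGroupType) :
    tens (groth K gT) (groth K hT) -> groth K (gT * hT)%type :=
  tlift (fun u v => plift (fun V => plift (fun W => gcls (extprod V W)) v) u).

Definition is_comulR (D : RS -> tens RS RS) : Prop :=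
  linear D /\
  forall n (V : rep K 'S_n),
    exists t : forall a : 'I_n.+1, tens (RSn a) (RSn (n - a)),
      (forall a, extmap (t a) =
                 gcls (pull (join_inM (subnKC (leq_ord a))) V)) /\
      D (rcls V) =
        \sum_a tlift (fun u v => (din u : RS) ⊗ (din v : RS)) (t a).

Definition is_formR (f : RS -> RS -> int) : Prop :=
  [/\ bilin (f : RS -> RS -> int^o),
      forall n (V W : rep K 'S_n), mx_irreducible V -> mx_irreducible W ->
        (mx_rsim V W -> f (rcls V) (rcls W) = 1) /\
        (~ mx_rsim V W -> f (rcls V) (rcls W) = 0)
    & forall m n (V : rep K 'S_m) (W : rep K 'S_n), m != n ->
        f (rcls V) (rcls W) = 0].

End RS.

Record part := Part {
  pval :> seq nat;
  _ : sorted geq pval && (0%N \notin pval) }.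
HB.instance Definition _ := [isSub for pval].
HB.instance Definition _ := [Choice of part by <:].

Notation psize l := (sumn (pval l)).

Section Specht.
Variables (K : fieldType) (l : part).
Notation Sl := [set: 'S_(psize l)].

(* Row and column stabilisers of the tableau of shape l whose rows, read from *)
(* top to bottom, are 0, 1, 2, ...                                            *)
Definition row_stab : {set 'S_(psize l)} :=
  [set s : 'S_(psize l) |
    [forall i : 'I_(psize l), reshape_index l (s i) == reshape_index l i]].
Definition col_stab : {set 'S_(psize l)} :=
  [set s : 'S_(psize l) |
    [forall i : 'I_(psize l), reshape_offset l (s i) == reshape_offset l i]].

(* Permutations act on the right, so the sum a over row_stab, as an element   *)
(* of a.KS_n, is the tabloid of that tableau inside the permutation module on *)
(* tabloids, and a.b, with b the signed sum over col_stab, is its polytabloid.*)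
(* The Specht module is generated by this polytabloid.                        *)
Definition polytabloid : 'rV[K]_#|Sl| :=
  gring_row (\sum_(p in row_stab) \sum_(q in col_stab)
               (-1) ^+ q *: regular_repr K Sl (p * q)%g).

Definition specht : rep K 'S_(psize l) :=
  Rep (submod_repr (cyclic_mx_module (regular_repr K Sl) polytabloid)).

End Specht.

Section Brace.
Variable K : closedFieldType.

(* The matrix, in the regular representation, of the central idempotent of    *)
(* KS_n attached to the irreducible representation specht l.                  *)
Definition central_idem (l : part) : 'M[K]_#|[set: 'S_(psize l)]| :=
  Wedderburn_id
    (irr_comp (DecSocleType (regular_repr K [set: 'S_(psize l)])) (specht K l)).

Definition central_idem_elt (l : part) : {malg K['S_(psize l)]} :=
  \sum_s gring_row (central_idem l) 0 (gring_index [set: 'S_(psize l)] s)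
           *: << s >>.

Definition brace (l : part) : KX K :=
  (rdim (specht K l))%:R^-1 *: din (pclass (@coinv_rel K _) (central_idem_elt l)).

Definition lattice : {pred KX K} := fun x =>
  `[< exists s : seq (int * part), x = \sum_(p <- s) brace p.2 *~ p.1 >].

Fact lattice_zmod : zmod_closed lattice.
Proof.
split=> [|x y /asboolP[s ->] /asboolP[t ->]]; apply/asboolP.
  by exists [::]; rewrite big_nil.
exists (s ++ [seq (- p.1, p.2) | p <- t]); rewrite big_cat big_map; congr (_ + _).
by rewrite -sumrN; apply: eq_bigr => p _; rewrite mulrNz.
Qed.
HB.instance Definition _ :=
  GRing.isZmodClosed.Build (KX K) lattice lattice_zmod.

Record latA := LatA { latval :> KX K; _ : latval \in lattice }.
HB.instance Definition _ := [isSub for latval].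
HB.instance Definition _ := [Choice of latA by <:].
HB.instance Definition _ := [SubChoice_isSubZmodule of latA by <:].

Fact brace_lattice l : brace l \in lattice.
Proof. by apply/asboolP; exists [:: (1, l)]; rewrite big_seq1 mulr1z. Qed.
Definition braceA l : latA := LatA (brace_lattice l).

End Brace.

(* Main.v *)
(* The Frobenius characteristic ch : R(S_n) -> K[X]_n, [V] |-> 1/n! sum_s
   chi_V(s^-1) [s], identifies the two structures. The coefficients of the
   central idempotent e_l are d_l/n! chi_l(s^-1), so ch [S_l] = {l}. By the
   formula for induced characters ch is multiplicative. It is isometric because
   every permutation is conjugate to its inverse. Since [s] is the product of
   the classes of its cycles, Delta [s] is the sum of [s|A] (x) [s|~A] over the
   s-stable sets A, and counting the pairs (s, A) by the size of A turns Delta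
   into the restriction to the subgroups S_a x S_b.
   In characteristic zero characters separate the classes of representations,
   so ch and ch (x) ch are injective, and the well-definedness and uniqueness of
   the operations on R(S_n) are inherited from K[X].
   Specht modules are the right ideals generated by Young symmetrizers z_l:
   z_l KS_n z_l is a line, and z_l KS_n z_m = 0 for l <> m whenever
   sum_i C(m_i,2) <= sum_i C(l_i,2). They exhaust the irreducible
   representations because cycle types separate the conjugacy classes. *)

Require Import Defs.
From HB Require Import structures.
From mathcomp Require Import all_boot all_order all_algebra all_fingroup.
From mathcomp Require Import generic_quotient mxrepresentation.
From mathcomp Require Import pgroup.
From mathcomp Require character.
From mathcomp Require Import finmap.
From mathcomp Require Import boolp.
From mathcomp.multinomials Require Import monalg.

Set Implicit Arguments.
Unset Strict Implicit.
Unset Printing Implicit Defensive.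

Import GRing.Theory.
Local Open Scope ring_scope.

(** * Presented modules, tensor products and direct sums *)

(** Both algebras are given by generators and relations, and [plift] evaluates on a chosen
    representative, so a formula becomes usable only once it is known to kill the relations. For
    R(S_n) these include short exact sequences. Instead of proving induction and tensor products
    exact, the proof compares images by their characters; as these take values in K while R(S_n) is
    a Z-module, targets are read through [ssrint.zmodule]. Injectivity of ch and ch (x) ch gives
    uniqueness. Existence of the comultiplication and of the form on R(S_n) is a question of
    integrality: the comultiplication of K[X] has to lift through ch (x) ch. This rests on the
    surjectivity of R(G) (x) R(H) -> R(G x H), so splitting is assumed for all finite groups and not
    only for the S_n. Equalities such as a + (n - a) = n are only propositional. Classes are
    therefore compared by cycle lengths, and Specht modules are built in ['S_n] for every [n] with
    [sumn l = n]. *)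

Lemma linP (R : nzRingType) (U V : lmodType R) (f : U -> V) :
  linear f -> exists g : {linear U -> V}, f = g.
Proof.
move=> fl; pose g : {linear U -> V} :=
  HB.pack f (GRing.isLinear.Build R U V *:%R f fl).
by exists g.
Qed.

Section LinearMaps.
Variables (R : nzRingType) (U V W : lmodType R).

Lemma lin_sum (f : U -> V) I (s : seq I) (F : I -> U) :
  linear f -> f (\sum_(i <- s) F i) = \sum_(i <- s) f (F i).
Proof. by move=> /linP[g ->]; rewrite linear_sum. Qed.

Lemma lin0 (f : U -> V) : linear f -> f 0 = 0.
Proof. by move=> /linP[g ->]; rewrite linear0. Qed.

Lemma linD (f : U -> V) x y : linear f -> f (x + y) = f x + f y.
Proof. by move=> /linP[g ->]; rewrite linearD. Qed.

Lemma linB (f : U -> V) x y : linear f -> f (x - y) = f x - f y.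
Proof. by move=> /linP[g ->]; rewrite linearB. Qed.

Lemma linZ (f : U -> V) a x : linear f -> f (a *: x) = a *: f x.
Proof. by move=> /linP[g ->]; rewrite linearZ. Qed.

Lemma lin_comp (g : V -> W) (f : U -> V) :
  linear g -> linear f -> linear (g \o f).
Proof. by move=> gl fl a x y /=; rewrite fl gl. Qed.

End LinearMaps.

Lemma additive_linear_int (V W : lmodType int) (f : V -> W) :
  (forall x y, f (x + y) = f x + f y) -> linear f.
Proof.
move=> fD.
have f0 : f 0 = 0 by apply: (addrI (f 0)); rewrite -fD !addr0.
have fN x : f (- x) = - f x.
  by apply: (addrI (f x)); rewrite -fD !subrr.
have fn n x : f (x *+ n) = f x *+ n.
  by elim: n => [|n IHn]; rewrite ?mulr0n // !mulrS fD IHn.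
move=> a x y; rewrite fD; congr (_ + _).
have scE (M : lmodType int) n (z : M) : n%:Z *: z = z *+ n.
  by rewrite -[n%:Z]intz scaler_int pmulrn.
case: a => n; first by rewrite !scE fn.
by rewrite NegzE !scaleNr fN !scE fn.
Qed.

Section Presented.
Variables (R : nzRingType) (T : choiceType) (S : {malg R[T]} -> Prop).

Lemma pclassE (x : {malg R[T]}) :
  pclass S x = \sum_(t <- msupp x) x@_t *: pgen S t.
Proof.
rewrite {1}[x]monalgE linear_sum; apply: eq_bigr => t _.
rewrite -linearZ; congr pclass; apply/malgP=> k.
by rewrite mcoeffZ !mcoeffU mulr_natr.
Qed.

Lemma pmod_span (x : pmod S) :
  exists s : seq (R * T), x = \sum_(p <- s) p.1 *: pgen S p.2.
Proof.
elim/quotW: x => x; exists [seq (x@_t, t) | t <- msupp x].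
by rewrite -[LHS]/(pclass S x) pclassE big_map.
Qed.

Lemma pmod_ext (P : lmodType R) (f g : pmod S -> P) :
  linear f -> linear g -> (forall t, f (pgen S t) = g (pgen S t)) -> f =1 g.
Proof.
move=> fl gl fg x; have [s ->] := pmod_span x.
rewrite (lin_sum _ _ fl) (lin_sum _ _ gl); apply: eq_bigr => p _.
by rewrite (linZ _ _ fl) (linZ _ _ gl) fg.
Qed.

Lemma pclass_rel r : S r -> pclass S r = 0.
Proof.
move=> Sr; rewrite -(raddf0 (pclass S)); apply/eqP.
rewrite -Quotient.idealrBE subr0; apply/asboolP.
exists [:: (1, r)]; rewrite big_seq1 scale1r; split=> // p.
by rewrite inE => /eqP ->.
Qed.

End Presented.

Section Tensor.
Variables (R : comNzRingType) (M N : lmodType R).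

Lemma tmulDl (x x' : M) (y : N) : (x + x') ⊗ y = x ⊗ y + x' ⊗ y.
Proof.
have /eqP := pclass_rel (TensDl x x' y).
by rewrite !raddfB /= -addrA -opprD subr_eq0 => /eqP.
Qed.

Lemma tmulDr (x : M) (y y' : N) : x ⊗ (y + y') = x ⊗ y + x ⊗ y'.
Proof.
have /eqP := pclass_rel (TensDr x y y').
by rewrite !raddfB /= -addrA -opprD subr_eq0 => /eqP.
Qed.

Lemma tmulZl a (x : M) (y : N) : (a *: x) ⊗ y = a *: (x ⊗ y).
Proof.
have /eqP := pclass_rel (TensZl a x y).
by rewrite raddfB /= linearZ subr_eq0 => /eqP.
Qed.

Lemma tmulZr a (x : M) (y : N) : x ⊗ (a *: y) = a *: (x ⊗ y).
Proof.
have /eqP := pclass_rel (TensZr a x y).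
by rewrite raddfB /= linearZ subr_eq0 => /eqP.
Qed.

Lemma tmul_bilin : bilin (@tmul R M N).
Proof.
split=> z a x y; first by rewrite tmulDl tmulZl.
by rewrite tmulDr tmulZr.
Qed.

Lemma tens_span (t : tens M N) :
  exists s : seq (M * N), t = \sum_(p <- s) p.1 ⊗ p.2.
Proof.
have [s ->] := pmod_span t; exists [seq (p.1 *: p.2.1, p.2.2) | p <- s].
by rewrite big_map; apply: eq_bigr => -[a [x y]] _ /=; rewrite tmulZl.
Qed.

Lemma tens_ext (P : lmodType R) (f g : tens M N -> P) :
  linear f -> linear g -> (forall x y, f (x ⊗ y) = g (x ⊗ y)) -> f =1 g.
Proof. by move=> fl gl fg; apply: pmod_ext => // -[x y]; apply: fg. Qed.

Section Lift.
Variables (P : lmodType R) (f : M -> N -> P).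
Hypothesis fb : bilin f.

Lemma tlift_rel r : tens_rel r -> plin (fun p : M * N => f p.1 p.2) r = 0.
Proof.
have [fl fr] := fb.
case=> [x x' y|x y y'|a x y|a x y]; rewrite ?linearB ?linearZ /= !plinU /=.
- by rewrite (linD _ _ (fl y)) -addrA -opprD subrr.
- by rewrite (linD _ _ (fr x)) -addrA -opprD subrr.
- by rewrite (linZ _ _ (fl y)) scalerN subrr.
- by rewrite (linZ _ _ (fr x)) scalerN subrr.
Qed.

Lemma tlift_tmul x y : tlift f (x ⊗ y) = f x y.
Proof. exact: (plift_gen tlift_rel). Qed.

Lemma tlift_lin : linear (tlift f).
Proof. exact: (plift_lin tlift_rel). Qed.

End Lift.

End Tensor.

Section DirectSum.
Variables (R : nzRingType) (V : nat -> lmodType R).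

Lemma din_id n (v : V n) : din v n = v.
Proof. by rewrite /= /din_val; case: eqP => // e; rewrite eq_axiomK. Qed.

Lemma din_neq n (v : V n) m : n != m -> din v m = 0.
Proof. by rewrite /= /din_val; case: eqP. Qed.

Lemma din_lin n : linear (@din R V n).
Proof.
move=> a x y; apply: dsumP => m /=.
rewrite /din_val; case: eqP => [e|_]; last by rewrite scaler0 addr0.
by case: _ / e.
Qed.

Lemma dsum_sum (x : dsum V) N : (forall n, (N <= n)%N -> x n = 0) ->
  x = \sum_(n < N) din (x n).
Proof.
move=> xN; apply: dsumP => m.
have -> : (\sum_(n < N) din (x n)) m = \sum_(n < N) (din (x n)) m.
  elim/big_rec2: _ => // i y z _ <-; by [].
have [ltmN|leNm] := ltnP m N.
  rewrite (bigD1 (Ordinal ltmN) isT) din_id big1; first exact/esym/addr0.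
  by move=> i /andP[_ ne]; apply: din_neq.
by rewrite xN // big1 // => i _; apply: din_neq; rewrite neq_ltn (leq_trans _ leNm).
Qed.

Lemma dsum_span (x : dsum V) : exists s : seq {n : nat & V n},
  x = \sum_(p <- s) din (tagged p).
Proof.
have [N xN] := dval_fin x; exists [seq Tagged V (x (i : 'I_N)) | i <- enum 'I_N].
by rewrite big_map big_enum /=; apply: dsum_sum.
Qed.

Lemma dsum_ext (P : lmodType R) (f g : dsum V -> P) :
  linear f -> linear g -> (forall n (v : V n), f (din v) = g (din v)) ->
  f =1 g.
Proof.
move=> fl gl fg x; have [s ->] := dsum_span x.
rewrite (lin_sum _ _ fl) (lin_sum _ _ gl); apply: eq_bigr => p _; exact: fg.
Qed.

(** [dlift] sums up to a bound obtained by choice from [x]; freeing the value from that bound allows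
    different arguments to be added. *)
Lemma dliftE (P : lmodType R) (f : forall n, V n -> P) (x : dsum V) N : (forall m, f m 0 = 0) ->
  (forall n, (N <= n)%N -> x n = 0) -> dlift f x = \sum_(n < N) f n (x n).
Proof.
move=> f0 xN; rewrite /dlift; case: cid => M /= xM.
have h a b : (forall n, (a <= n)%N -> x n = 0) -> (a <= b)%N ->
    \sum_(n < a) f n (x n) = \sum_(n < b) f n (x n).
  move=> xa ab; rewrite (big_ord_widen b (fun n => f n (x n)) ab) big_mkcond.
  by apply: eq_bigr => n _; case: ltnP => // /xa ->.
have [MN|NM] := leqP M N; first exact: h.
by rewrite -(h N M) // ltnW.
Qed.

Lemma dlift_lin (P : lmodType R) (f : forall n, V n -> P) :
  (forall n, linear (f n)) -> linear (dlift f).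
Proof.
move=> fl a x y; have [N xN] := dval_fin x; have [M yM] := dval_fin y.
have f0 m : f m 0 = 0 by apply: lin0.
have xB n : (maxn N M <= n)%N -> x n = 0 by rewrite geq_max => /andP[/xN].
have yB n : (maxn N M <= n)%N -> y n = 0 by rewrite geq_max => /andP[_ /yM].
rewrite !(@dliftE _ _ _ (maxn N M)) //=; last first.
  by move=> n le; rewrite xB // yB // scaler0 addr0.
by rewrite scaler_sumr -big_split; apply: eq_bigr => n _; rewrite fl.
Qed.

Lemma dlift_linl (Q P : lmodType R) (f : Q -> forall n, V n -> P) x :
  (forall n v, linear (fun q => f q n v)) -> linear (fun q => dlift (f q) x).
Proof.
move=> fl a q q'; rewrite /dlift scaler_sumr -big_split.
by apply: eq_bigr => n _; rewrite fl.
Qed.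

End DirectSum.

(** The representative chosen by [plift] depends on [x] alone, so linearity in the parameter [q]
    holds term by term. This settles the inner variable of nested lifts. *)
Lemma plift_linl (R : comNzRingType) (T : choiceType) S (Q P : lmodType R)
    (f : Q -> T -> P) (x : @pmod R T S) :
  (forall t, linear (f^~ t)) -> linear (fun q => plift (f q) x).
Proof.
move=> fl a q q'; rewrite /plift /plin scaler_sumr -big_split.
apply: eq_bigr => t _; rewrite (linD _ _ (fl t)) (linZ _ _ (fl t)) /=.
by rewrite scalerDr !scalerA mulrC.
Qed.

(** * Cycle types *)

Section CycleType.
Variable T : finType.
Implicit Types s : {perm T}.

Definition cycle_lengths s : seq nat := [seq #|pred_of_set C| | C <- enum (porbits s)].

Lemma porbits_partition s : partition (porbits s) [set: T].
Proof.
apply/and3P; split.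
- rewrite eqEsubset subsetT; apply/subsetP=> x _.
  by apply/bigcupP; exists (porbit s x); rewrite ?imset_f ?porbit_id.
- apply/trivIsetP=> _ _ /imsetP[x _ ->] /imsetP[y _ ->] ne.
  rewrite -setI_eq0; apply: contraR ne => /set0Pn[z /setIP[zx zy]].
  by move: zx zy; rewrite -!eq_porbit_mem => /eqP <- /eqP ->.
- apply/imsetP=> -[x _ /setP/(_ x)]; by rewrite inE porbit_id.
Qed.

Lemma sumn_cycle_lengths s : sumn (cycle_lengths s) = #|T|.
Proof.
rewrite sumnE big_map big_enum /= -(card_partition (porbits_partition s)).
by rewrite cardsT.
Qed.

(** The iterates of [x] with exponent below the orbit size are distinct, so a remainder modulo that
    size which fixes [x] must be 0. *)
Lemma porbit_dvd s x m : ((s ^+ m)%g x == x) = (#|porbit s x| %| m)%N.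
Proof.
set N := #|_|; have N0 : (0 < N)%N by rewrite lt0n card_porbit_neq0.
have sN q : (s ^+ (q * N))%g x = x.
  elim: q => [|q IHq]; first by rewrite mul0n expg0 perm1.
  by rewrite mulSn expgD permM [(s ^+ N)%g x]permX iter_porbit.
rewrite /dvdn {1}(divn_eq m N) addnC expgD permM.
have [->|ne] := eqVneq (m %% N)%N 0%N; first by rewrite expg0 perm1 sN !eqxx.
apply/eqP=> /(congr1 (s ^+ (m %/ N * N))^-1%g); rewrite permK.
rewrite -{2}(sN (m %/ N)%N) permK => e.
have lt : (m %% N < N)%N by rewrite ltn_mod.
have := uniq_traject_porbit s x; rewrite -/N => u.
have := nth_uniq x _ _ u; move=> /(_ (m %% N)%N 0%N).
rewrite !size_traject => /(_ lt N0); rewrite !nth_traject // -permX e eqxx.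
by rewrite (negPf ne).
Qed.

End CycleType.

Lemma porbit_imset (T U : finType) (f : T -> U) (s : {perm T}) (t : {perm U}) x :
  (forall x, f (s x) = t (f x)) -> porbit t (f x) = f @: porbit s x.
Proof.
move=> st; have stn n y : f ((s ^+ n)%g y) = (t ^+ n)%g (f y).
  elim: n => [|n IHn] in y *; first by rewrite !expg0 !perm1.
  by rewrite !expgS !permM IHn st.
apply/setP=> y; apply/porbitP/imsetP=> [[i ->]|[z /porbitP[i ->] ->]].
  by exists ((s ^+ i)%g x); rewrite ?mem_porbit.
by exists i.
Qed.

Lemma porbits_conj (T : finType) (s w : {perm T}) :
  porbits (s ^ w)%g = [set w @: (C : {set T}) | C in porbits s].
Proof.
have sw x : w (s x) = (s ^ w)%g (w x) by rewrite permJ.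
apply/setP=> A; apply/imsetP/imsetP=> [[x _ ->]|[_ /imsetP[x _ ->] ->]].
  exists (porbit s (w^-1%g x)); first by rewrite imset_f.
  by rewrite -(porbit_imset _ sw) permKV.
by exists (w x) => //; rewrite (porbit_imset _ sw).
Qed.

Lemma cycle_lengthsJ (T : finType) (s w : {perm T}) : perm_eq (cycle_lengths (s ^ w)%g) (cycle_lengths s).
Proof.
have winj : injective (fun C : {set T} => w @: C) by exact/imset_inj/perm_inj.
rewrite /cycle_lengths; have e : perm_eq (enum (porbits (s ^ w)%g))
    [seq w @: (C : {set T}) | C <- enum (porbits s)].
  apply: uniq_perm; rewrite ?(map_inj_uniq winj) ?enum_uniq // => A.
  rewrite mem_enum porbits_conj; apply/imsetP/mapP=> -[C].
    by move=> Cs ->; exists C; rewrite ?mem_enum.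
  by rewrite mem_enum => Cs ->; exists C.
rewrite (permPl (perm_map _ e)) -map_comp; apply/seq.permP => a.
by congr count; apply: eq_map => C /=; rewrite card_imset //; apply: perm_inj.
Qed.

Lemma cycle_lengthsV (T : finType) (s : {perm T}) : cycle_lengths s^-1%g = cycle_lengths s.
Proof. by rewrite /cycle_lengths porbitsV. Qed.

(** Match the orbits of [s] with orbits of [t] of the same size, choose a base point in each, and
    send the k-th iterate of a base point under [s] to the k-th iterate of the matching base point
    under [t]. Equal sizes make this well defined and injective. *)
Lemma cycle_lengths_conj n (s t : 'S_n) : perm_eq (cycle_lengths s) (cycle_lengths t) ->
  exists w : 'S_n, t = (s ^ w)%g.
Proof.
(* Degree 0 is split off because the base points need the default [ord0]. *)
case: n s t => [|n] s t st.
  by exists 1%g; apply/permP=> -[].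
pose P := enum (porbits s); pose Q := enum (porbits t).
have szst : size P = size Q by have := perm_size st; rewrite !size_map.
(* [Is] rearranges the positions in [Q] so that the orbit sizes agree with those in [P]; [phi] is
   the resulting size-preserving injection of orbits. *)
have [Is pIs eIs] := perm_iotaP 0%N st.
rewrite size_map -/Q in pIs.
have szI : size Is = size Q by rewrite (perm_size pIs) size_iota.
pose phi (C : {set 'I_n.+1}) := nth set0 Q (nth 0%N Is (index C P)).
have uI : uniq Is by rewrite (perm_uniq pIs) iota_uniq.
have idx (C : {set 'I_n.+1}) : C \in porbits s -> (index C P < size Q)%N.
  by move=> Cs; rewrite -szst index_mem mem_enum.
have nI i : (i < size Q)%N -> (nth 0 Is i < size Q)%N.
  by rewrite -{1}szI => /(mem_nth 0%N); rewrite (perm_mem pIs) mem_iota.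
have phiQ C : C \in porbits s -> phi C \in porbits t.
  by move=> Cs; rewrite -mem_enum mem_nth // nI // idx.
have phi_card C : C \in porbits s -> #|phi C| = #|C|.
  move=> Cs; have iC := idx _ Cs.
  have := congr1 (fun l => nth 0%N l (index C P)) eIs.
  rewrite (nth_map 0%N) ?szI // (nth_map set0) ?szst //.
  rewrite (nth_map set0) -/Q ?nI // => <-.
  by rewrite nth_index ?mem_enum.
have phi_inj C D : C \in porbits s -> D \in porbits s -> phi C = phi D -> C = D.
  move=> Cs Ds /eqP; rewrite nth_uniq ?nI ?idx ?enum_uniq //.
  rewrite nth_uniq ?szI ?idx // => /eqP /(congr1 (nth set0 P)).
  by rewrite !nth_index ?mem_enum.
pose r (C : {set 'I_n.+1}) := odflt ord0 [pick y in C].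
have rP u (C : {set 'I_n.+1}) : C \in porbits u -> r C \in C.
  case/imsetP=> x _ ->; rewrite /r; case: pickP => [y //|/(_ x)].
  by rewrite porbit_id.
have rO (u : 'S_n.+1) (C : {set 'I_n.+1}) : C \in porbits u -> porbit u (r C) = C.
  move=> Cu; have := rP _ _ Cu; case/imsetP: Cu => x _ ->.
  by rewrite -eq_porbit_mem => /eqP.
have xP x : exists k, x = (s ^+ k)%g (r (porbit s x)).
  apply/porbitP; rewrite porbit_sym; apply: (rP s).
  by rewrite imset_f.
have [k kP] := choice xP.
pose f x := (t ^+ k x)%g (r (phi (porbit s x))).
have ps x : porbit s x \in porbits s by rewrite imset_f.
(* Equality of two iterates of a base point is a divisibility by the orbit size, and [C] and [phi C]
   have the same size. *)
have key C a b : C \in porbits s ->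
  ((s ^+ a)%g (r C) == (s ^+ b)%g (r C)) =
  ((t ^+ a)%g (r (phi C)) == (t ^+ b)%g (r (phi C))).
  move=> Cs; wlog ab : a b / (a <= b)%N.
    by move=> W; case: (leqP a b) => [/W //|/ltnW/W]; rewrite eq_sym => ->; rewrite eq_sym.
  have ex (u : 'S_n.+1) x : ((u ^+ a)%g x == (u ^+ b)%g x) = ((u ^+ (b - a))%g x == x).
    by rewrite -{1}(subnK ab) expgD permM (inj_eq perm_inj) eq_sym.
  by rewrite !ex !porbit_dvd (rO s) // (rO t) ?phiQ // phi_card.
have fE C a : C \in porbits s -> f ((s ^+ a)%g (r C)) = (t ^+ a)%g (r (phi C)).
  move=> Cs; rewrite /f porbit_perm (rO s) //; apply/eqP; rewrite -key //.
  by rewrite -{2}(rO s C Cs) -(porbit_perm s a) -kP.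
have fs x : f (s x) = t (f x).
  rewrite {1}(kP x) -permM -expgSr fE //.
  by rewrite /f expgSr permM.
have finj : injective f.
  move=> x y; rewrite (kP x) (kP y) !fE // => e.
  have e2 : porbit s x = porbit s y.
    apply: phi_inj => //; move/(congr1 (porbit t)): e.
    by rewrite !porbit_perm !(rO t) ?phiQ.
  by move: e; rewrite -e2 => /eqP; rewrite -key // => /eqP.
exists (perm finj); apply/permP=> y.
have [x ->] : exists x, y = perm finj x by exists ((perm finj)^-1%g y); rewrite permKV.
by rewrite permJ !permE fs.
Qed.

Lemma conjgV n (s : 'S_n) : exists w : 'S_n, s^-1%g = (s ^ w)%g.
Proof. by apply: cycle_lengths_conj; rewrite cycle_lengthsV. Qed.

Section Join.
Variables a b : nat.
Implicit Types (u : 'S_a) (v : 'S_b).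

Lemma join_lshift p (i : 'I_a) : join p (lshift b i) = lshift b (p.1 i).
Proof.
by rewrite permE /join_fun -[lshift b i]/(unsplit (inl i)) unsplitK.
Qed.

Lemma join_rshift p (i : 'I_b) : join p (rshift a i) = rshift a (p.2 i).
Proof.
by rewrite permE /join_fun -[rshift a i]/(unsplit (inr i)) unsplitK.
Qed.

Lemma porbit_join_l (p : 'S_a * 'S_b) (i : 'I_a) :
  porbit (join p) (lshift b i) = lshift b @: porbit p.1 i.
Proof. by apply: porbit_imset => j; rewrite join_lshift. Qed.

Lemma porbit_join_r (p : 'S_a * 'S_b) (i : 'I_b) :
  porbit (join p) (rshift a i) = @rshift a b @: porbit p.2 i.
Proof. by apply: porbit_imset => j; rewrite join_rshift. Qed.

Lemma porbits_join u v : perm_eq (enum (porbits (join (u, v))))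
  ([seq lshift b @: (C : {set _}) | C <- enum (porbits u)] ++
   [seq @rshift a b @: (C : {set _}) | C <- enum (porbits v)]).
Proof.
apply: uniq_perm; first exact: enum_uniq.
  rewrite cat_uniq !map_inj_uniq ?enum_uniq //; first last.
  - exact/imset_inj/lshift_inj.
  - exact/imset_inj/rshift_inj.
  rewrite andbT; apply/hasPn=> _ /mapP[C + ->]; rewrite mem_enum.
  case/imsetP=> x _ ->; apply/mapP=> -[D _ /setP/(_ (rshift a x))].
  rewrite imset_f ?porbit_id // => /esym /imsetP[y _ /eqP].
  by rewrite eq_sym eq_lrshift.
move=> A; rewrite mem_enum mem_cat; apply/imsetP/orP.
  case=> i _ ->; case: (split_ordP i) => j ->; [left|right].
    by rewrite porbit_join_l; apply: map_f; rewrite mem_enum imset_f.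
  by rewrite porbit_join_r; apply: map_f; rewrite mem_enum imset_f.
case=> /mapP[C]; rewrite mem_enum => /imsetP[x _ ->] ->.
  by exists (lshift b x); rewrite ?porbit_join_l.
by exists (rshift a x); rewrite ?porbit_join_r.
Qed.

Lemma cycle_lengths_join u v : perm_eq (cycle_lengths (join (u, v))) (cycle_lengths u ++ cycle_lengths v).
Proof.
rewrite /cycle_lengths (permPl (perm_map _ (porbits_join u v))) map_cat -!map_comp.
apply/seq.permP => x; congr (count x (_ ++ _)); apply: eq_map => C /=.
  by rewrite card_imset //; apply: lshift_inj.
by rewrite card_imset //; apply: rshift_inj.
Qed.

End Join.

Definition cyc k : 'S_k := perm (@ordS_inj k).

Lemma porbits_cyc k : porbits (cyc k.+1) = [set [set: 'I_k.+1]].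
Proof.
have e (i : 'I_k.+1) : porbit (cyc k.+1) i = [set: 'I_k.+1].
  suff h : porbit (cyc k.+1) ord0 = [set: 'I_k.+1].
    by rewrite -h; apply/eqP; rewrite eq_porbit_mem h inE.
  apply/setP=> j; rewrite inE; apply/porbitP; exists j.
  suff h m : (m < k.+1)%N -> val ((cyc k.+1 ^+ m)%g ord0) = m.
    by apply: val_inj; rewrite /= h.
  elim: m => [|m IHm] lt; first by rewrite expg0 perm1.
  by rewrite expgSr permM permE /= IHm ?modn_small // ltnW.
apply/setP=> A; rewrite inE; apply/imsetP/eqP=> [[x _ ->]|->]; first exact: e.
by exists ord0.
Qed.

Lemma cycle_lengths_cyc k : cycle_lengths (cyc k.+1) = [:: k.+1].
Proof. by rewrite /cycle_lengths porbits_cyc enum_set1 /= cardsT card_ord. Qed.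

Lemma cycle_lengths_one_orbit n (s : 'S_n) : #|porbits s| = 1%N -> (0 < n)%N /\ cycle_lengths s = [:: n].
Proof.
move=> /eqP/cards1P[C sC]; have := sumn_cycle_lengths s; rewrite /cycle_lengths sC enum_set1 /=.
rewrite addn0 card_ord => ->; split=> //.
have : C \in porbits s by rewrite sC set11.
by case/imsetP=> -[m lt] _ _; apply: leq_ltn_trans lt.
Qed.

(** Rotations placed side by side: a representative for given positive cycle lengths, through which
    classes factor into classes of single cycles. *)
Fixpoint list_perm (l : seq nat) : 'S_(sumn l) :=
  if l is k :: l' then join (cyc k, list_perm l') else 1%g.

Lemma cycle_lengths_S0 (s : 'S_0) : cycle_lengths s = [::].
Proof.
apply/nilP; rewrite /nilp size_map -cardE cards_eq0 -subset0.
by apply/subsetP=> A /imsetP[[]].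
Qed.

Lemma cycle_lengths_list_perm l : 0%N \notin l -> perm_eq (cycle_lengths (list_perm l)) l.
Proof.
elim: l => [_|k l IHl] /=; first by rewrite cycle_lengths_S0.
rewrite inE negb_or eq_sym => /andP[k0 /IHl e].
rewrite (permPl (cycle_lengths_join _ _)); case: k k0 => // k _.
by rewrite cycle_lengths_cyc /= perm_cons.
Qed.

Lemma cycle_lengths_pos (T : finType) (s : {perm T}) : 0%N \notin cycle_lengths s.
Proof.
apply/mapP=> -[C]; rewrite mem_enum => /imsetP[x _ ->] /eqP.
by rewrite eq_sym (negPf (card_porbit_neq0 s x)).
Qed.

Fact cycle_type_subproof (T : finType) (s : {perm T}) :
  sorted geq (sort geq (cycle_lengths s)) && (0%N \notin sort geq (cycle_lengths s)).
Proof.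
rewrite mem_sort cycle_lengths_pos andbT; apply: sort_sorted => m n.
by rewrite /geq /= leq_total.
Qed.
Definition cycle_type (T : finType) (s : {perm T}) : part := Part (cycle_type_subproof s).

Lemma sumn_cycle_type (T : finType) (s : {perm T}) : sumn (cycle_type s) = #|T|.
Proof. by rewrite -(sumn_cycle_lengths s) /=; apply: perm_sumn; rewrite perm_sort. Qed.

Lemma cycle_type_conj n (s t : 'S_n) : cycle_type s = cycle_type t ->
  exists w : 'S_n, t = (s ^ w)%g.
Proof.
move=> /(congr1 Defs.pval) /= e; apply: cycle_lengths_conj.
by rewrite -(perm_sort geq) e perm_sort.
Qed.

(** * The Hopf algebra K[X] *)

Section KXring.
Variable K : fieldType.
Local Notation KX := (KX K).
Local Notation clsK := (@cls K).

Lemma KX_ext (P : lmodType K) (f g : KX -> P) : linear f -> linear g ->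
  (forall n (s : 'S_n), f (clsK s) = g (clsK s)) -> f =1 g.
Proof.
move=> fl gl fg; apply: dsum_ext => // n v.
by apply: (@pmod_ext _ _ _ _ (f \o @din _ _ n) (g \o @din _ _ n));
  first exact: lin_comp fl (@din_lin _ _ n);
  first exact: lin_comp gl (@din_lin _ _ n); move=> s; apply: fg.
Qed.

Lemma mulX_bilin : bilin (@mulX K).
Proof.
pose g a b (s : 'S_a) (t : 'S_b) : KX := clsK (join (s, t)).
have gl a' b' (s' : 'S_a') r : coinv_rel r -> plin (g a' b' s') r = 0.
  by case=> u w; rewrite raddfB /= !plinU /g clsJr subrr.
pose F a' b' (v : KXn K b') (s' : 'S_a') := plift (g a' b' s') v.
have Fl a' b' (v : KXn K b') r : coinv_rel r -> plin (F a' b' v) r = 0.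
  case=> u w; rewrite raddfB /= !plinU /F /plift /plin -sumrB big1 // => z _.
  by rewrite -scalerBr /g clsJl subrr scaler0.
split=> [y|x].
- apply: dlift_lin => a; apply: dlift_linl => b v.
  exact: (plift_lin (@Fl a b v)).
- apply: (@dlift_linl _ _ KX _ (fun y a u => dlift (fun b v => plift (F a b v) u) y)).
  move=> a u; apply: dlift_lin => b; apply: plift_linl => s.
  exact: (plift_lin (@gl a b s)).
Qed.

Let mll y := mulX_bilin.1 y.
Let mlr x := mulX_bilin.2 x.

(** Cycle lengths determine the degree as their sum, so classes in types such as ['S_(a + b)] and
    ['S_(b + a)] can be compared without a cast. *)
Lemma eq_cls n m (s : 'S_n) (t : 'S_m) :
  perm_eq (cycle_lengths s) (cycle_lengths t) -> clsK s = clsK t.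
Proof.
move=> st; have := sumn_cycle_lengths s; rewrite (perm_sumn st) sumn_cycle_lengths !card_ord => mn.
by case: n / mn in s st *; have [w ->] := cycle_lengths_conj st; rewrite clsJ.
Qed.

Lemma mulXC : commutative (@mulX K).
Proof.
move=> x y; move: x; apply: KX_ext => [||n s]; [exact: mll|exact: mlr|].
move: y; apply: KX_ext => [||m t]; [exact: mlr|exact: mll|].
rewrite !mulX_cls; apply: eq_cls.
by rewrite (permPl (cycle_lengths_join _ _)) perm_catC perm_sym cycle_lengths_join.
Qed.

Lemma mulXA : associative (@mulX K).
Proof.
move=> x y z; move: x; apply: KX_ext => [||n s]; first exact: mll.
  by apply: (@lin_comp _ _ _ _ (fun u => mulX u z) (fun u => mulX u y)).
move: y; apply: KX_ext => [||m t].
- by apply: (@lin_comp _ _ _ _ (fun u => mulX _ u) (fun u => mulX u z)).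
- by apply: (@lin_comp _ _ _ _ (fun u => mulX u z) (fun u => mulX _ u)).
move: z; apply: KX_ext => [||p u].
- by apply: (@lin_comp _ _ _ _ (fun u => mulX _ u) (fun u => mulX _ u)).
- exact: mlr.
rewrite !mulX_cls; apply: eq_cls; rewrite (permPl (cycle_lengths_join _ _)).
rewrite (perm_trans (perm_cat (perm_refl _) (cycle_lengths_join _ _))) // catA perm_sym.
by rewrite (permPl (cycle_lengths_join _ _)) perm_cat // cycle_lengths_join.
Qed.

Lemma mul1X : left_id (oneX K) (@mulX K).
Proof.
apply: KX_ext => [||n s]; [exact: mlr|by move=> a x y|].
rewrite mulX_cls; apply: eq_cls.
by rewrite (permPl (cycle_lengths_join _ _)) cycle_lengths_S0.
Qed.

Lemma mulXDl : left_distributive (@mulX K) +%R.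
Proof. by move=> x y z; apply: linD (mll z). Qed.

HB.instance Definition _ :=
  GRing.Zmodule_isComPzRing.Build (Defs.KX K) mulXA mulXC mul1X mulXDl.

Lemma mulXZl a (x y : KX) : (a *: x) * y = a *: (x * y).
Proof. exact: linZ (mll y). Qed.
Lemma mulXZr a (x y : KX) : x * (a *: y) = a *: (x * y).
Proof. exact: linZ (mlr x). Qed.

Lemma cls_prod n (s : 'S_n) : clsK s = \prod_(k <- cycle_lengths s) clsK (cyc k).
Proof.
transitivity (clsK (list_perm (cycle_lengths s))).
  by apply: eq_cls; rewrite perm_sym cycle_lengths_list_perm // cycle_lengths_pos.
elim: (cycle_lengths s) => [|k l IHl] /=; first by rewrite big_nil.
by rewrite big_cons -IHl -[LHS]mulX_cls.
Qed.

Definition TX := tens KX KX.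
HB.instance Definition _ := GRing.Lmodule.on TX.

Lemma mulX_tmul_bilinl y1 y2 : bilin (fun x1 x2 : KX => (x1 * y1) ⊗ (x2 * y2)).
Proof.
split=> z a x x'; first by rewrite mulrDl mulXZl tmulDl tmulZl.
by rewrite mulrDl mulXZl tmulDr tmulZr.
Qed.
Lemma mulX_tmul_bilinr x1 x2 : bilin (fun y1 y2 : KX => (x1 * y1) ⊗ (x2 * y2)).
Proof.
split=> z a x x'; first by rewrite mulrDr mulXZr tmulDl tmulZl.
by rewrite mulrDr mulXZr tmulDr tmulZr.
Qed.

Lemma tmulX_inner_bilin (y : TX) : bilin (fun x1 x2 : KX =>
  tlift (fun y1 y2 : KX => (mulX x1 y1) ⊗ (mulX x2 y2)) y).
Proof.
split=> z; apply: plift_linl => -[y1 y2] /=.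
  exact: (mulX_tmul_bilinl y1 y2).1.
exact: (mulX_tmul_bilinl y1 y2).2.
Qed.

Lemma tmulX_bilin : bilin (@tmulX K).
Proof.
split=> [y|x]; first exact: tlift_lin (tmulX_inner_bilin y).
apply: plift_linl => -[x1 x2]; exact: tlift_lin (mulX_tmul_bilinr x1 x2).
Qed.

Lemma tmulX_tmul (x1 x2 y1 y2 : KX) :
  tmulX (x1 ⊗ x2) (y1 ⊗ y2) = (x1 * y1) ⊗ (x2 * y2).
Proof.
rewrite /tmulX (tlift_tmul (tmulX_inner_bilin _)).
exact: tlift_tmul (mulX_tmul_bilinr x1 x2) _ _.
Qed.

Let tll y := tmulX_bilin.1 y.
Let tlr x := tmulX_bilin.2 x.

Lemma tmulXC : commutative (@tmulX K).
Proof.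
move=> x y; move: x; apply: tens_ext => [||x1 x2]; [exact: tll|exact: tlr|].
move: y; apply: tens_ext => [||y1 y2]; [exact: tlr|exact: tll|].
by rewrite !tmulX_tmul mulrC [x2 * _]mulrC.
Qed.

Lemma tmulXA : associative (@tmulX K).
Proof.
move=> x y z; move: x; apply: tens_ext => [||x1 x2]; first exact: tll.
  by apply: (@lin_comp _ _ _ _ (fun u => tmulX u z) (fun u => tmulX u y)).
move: y; apply: tens_ext => [||y1 y2].
- by apply: (@lin_comp _ _ _ _ (fun u => tmulX _ u) (fun u => tmulX u z)).
- by apply: (@lin_comp _ _ _ _ (fun u => tmulX u z) (fun u => tmulX _ u)).
move: z; apply: tens_ext => [||z1 z2].
- by apply: (@lin_comp _ _ _ _ (fun u => tmulX _ u) (fun u => tmulX _ u)).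
- exact: tlr.
by rewrite !tmulX_tmul !mulrA.
Qed.

Lemma tmul1X : left_id (oneX K ⊗ oneX K) (@tmulX K).
Proof.
apply: tens_ext => [||x1 x2]; [exact: tlr|by move=> a x y|].
by rewrite tmulX_tmul !mul1r.
Qed.

Lemma tmulXDl : left_distributive (@tmulX K) +%R.
Proof. by move=> x y z; apply: linD (tll z). Qed.

HB.instance Definition _ :=
  GRing.Zmodule_isComPzRing.Build TX tmulXA tmulXC tmul1X tmulXDl.

Definition primX (k : nat) : TX :=
  clsK (cyc k) ⊗ oneX K + oneX K ⊗ clsK (cyc k).

Lemma comulX_rel n r : coinv_rel r ->
  plin (fun s : 'S_n => \prod_(k <- cycle_lengths s) primX k) r = 0.
Proof.
case=> s t; rewrite raddfB /= !plinU.
by rewrite (perm_big _ (cycle_lengthsJ s t)) subrr.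
Qed.

(** The multiplicative extension of primitivity, written down directly on classes. It is compatible
    with conjugation because the multiset of cycle lengths is invariant and [TX] is commutative. *)
Definition comulX : KX -> TX :=
  dlift (fun n => plift (fun s : 'S_n => \prod_(k <- cycle_lengths s) primX k)).

Lemma comulX_lin : linear comulX.
Proof. by apply: dlift_lin => n; apply: plift_lin (@comulX_rel n). Qed.

Lemma comulX_cls n (s : 'S_n) : comulX (clsK s) = \prod_(k <- cycle_lengths s) primX k.
Proof.
rewrite /comulX /cls dlift_din; last first.
  by move=> m; apply: plift0 (@comulX_rel m).
exact: plift_gen (@comulX_rel n) _.
Qed.

Lemma comulXM x y : comulX (x * y) = comulX x * comulX y.
Proof.
move: x; apply: KX_ext => [||n s].
- by apply: (@lin_comp _ _ _ _ comulX (fun u => mulX u y)) => //; apply: comulX_lin.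
- by apply: (@lin_comp _ _ _ _ (fun u => tmulX u _) comulX) => //; apply: comulX_lin.
move: y; apply: KX_ext => [||m t].
- by apply: (@lin_comp _ _ _ _ comulX (fun u => mulX _ u)) => //; apply: comulX_lin.
- by apply: (@lin_comp _ _ _ _ (fun u => tmulX _ u) comulX) => //; apply: comulX_lin.
rewrite -[clsK s * _]/(mulX _ _) mulX_cls !comulX_cls -big_cat.
exact/perm_big/cycle_lengths_join.
Qed.

Lemma comulXP : is_comulX comulX.
Proof.
split; first exact: comulX_lin.
- by rewrite /oneX comulX_cls cycle_lengths_S0 big_nil.
- exact: comulXM.
move=> n s /cycle_lengths_one_orbit[n0 sn]; rewrite comulX_cls sn big_seq1 /primX.
suff -> : clsK (cyc n) = clsK s by [].
by apply: eq_cls; rewrite sn -(prednK n0) cycle_lengths_cyc.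
Qed.

Lemma is_comulX_uniq (D D' : KX -> tens KX KX) :
  is_comulX D -> is_comulX D' -> D = D'.
Proof.
move=> [Dl D1 DM Dc] [El E1 EM Ec]; apply/functional_extensionality_dep.
apply: KX_ext => // n s; rewrite cls_prod.
elim: (cycle_lengths s) (cycle_lengths_pos s) => [|k l IHl]; first by rewrite big_nil [LHS]D1 -E1.
rewrite inE negb_or big_cons => /andP[k0 /IHl e].
rewrite [LHS]DM e [RHS]EM; congr (tmulX _ _).
case: k k0 => // k _; rewrite Dc ?Ec //; by rewrite porbits_cyc cards1.
Qed.

Lemma exists_uniq_comulX : exists! DX, @is_comulX K DX.
Proof.
exists comulX; split; first exact: comulXP.
by move=> D DP; apply: is_comulX_uniq comulXP DP.
Qed.

End KXring.

(** * Subsets stable under a permutation *)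

Section StableSets.
Variable n : nat.
Implicit Types (s w : 'S_n) (A : {set 'I_n}).

Definition stable s A := [forall x, (x \in A) ==> (s x \in A)].

Lemma stableP s A : reflect (forall x, x \in A -> s x \in A) (stable s A).
Proof. by apply: (iffP forallP) => h x; [apply/implyP|apply/implyP/h]. Qed.

Lemma stable_porbit s A x : stable s A -> (porbit s x \subset A) = (x \in A).
Proof.
move/stableP=> sA; apply/subsetP/idP=> [|Ax y /porbitP[i ->]].
  by apply; apply: porbit_id.
by elim: i => [|i IHi]; rewrite ?perm1 // expgSr permM sA.
Qed.

(** Being the union of the orbits it contains, a stable set corresponds to a set of cycles; such
    sets index the expansion of the comultiplication. *)
Lemma stableE s A :
  stable s A = (cover [set C in porbits s | C \subset A] == A).
Proof.
apply/idP/eqP=> [sA|<-].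
  apply/setP=> x; apply/bigcupP/idP=> [[C]|Ax].
    by rewrite inE => /andP[_ /subsetP]; apply.
  exists (porbit s x); last exact: porbit_id.
  by rewrite inE imset_f // stable_porbit.
apply/stableP=> x /bigcupP[C]; rewrite inE => /andP[/imsetP[y _ ->] sA] xy.
apply/bigcupP; exists (porbit s y); first by rewrite inE imset_f.
by move: xy; rewrite -!eq_porbit_mem -[s x]/((s ^+ 1)%g x) porbit_perm.
Qed.

(** By finiteness a permutation that maps [B] into itself maps it onto itself, so no point outside
    [B] is sent into [B]. *)
Lemma stableC s A : stable s (~: A) = stable s A.
Proof.
suff h B : stable s B -> stable s (~: B).
  by apply/idP/idP => /h //; rewrite setCK.
move=> /stableP sB; apply/stableP=> x; rewrite !inE; apply: contra => sx.
have sBB : s @: B = B.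
  apply/eqP; rewrite eqEcard card_imset ?leqnn ?andbT; last exact: perm_inj.
  by apply/subsetP=> _ /imsetP[y /sB ? ->].
by rewrite -sBB in sx; case/imsetP: sx => y By /perm_inj ->.
Qed.

Lemma stableJ s w A : stable (s ^ w)%g (w @: A) = stable s A.
Proof.
apply/stableP/stableP=> h x xA.
  have := h (w x); rewrite permJ !mem_imset; by [exact|exact: perm_inj|apply].
by case/imsetP: xA => y yA ->; rewrite permJ imset_f // h.
Qed.

End StableSets.

Lemma setC_imset_perm (T : finType) (w : {perm T}) (A : {set T}) :
  ~: (w @: A) = w @: (~: A).
Proof.
apply/setP=> x; rewrite -(permKV w x) inE !mem_imset ?inE //; exact: perm_inj.
Qed.

(** Enumerate [T] once with [A] first and once with [B] first, and send each entry of the first list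
    to the entry of the second at the same position. *)
Lemma perm_of_sets (T : finType) (A B : {set T}) : #|A| = #|B| ->
  exists w : {perm T}, w @: A = B.
Proof.
move=> AB; case: (pickP [pred x : T | true]) => [x0 _|T0]; last first.
  have e (C : {set T}) : C = set0 by apply/setP=> x; have := T0 x.
  by exists 1%g; rewrite (e A) (e B) imset0.
pose sA := enum A ++ enum (~: A); pose sB := enum B ++ enum (~: B).
have sz (C : {set T}) : size (enum C ++ enum (~: C)) = #|T|.
  by rewrite size_cat -!cardE cardsC.
have un (C : {set T}) : uniq (enum C ++ enum (~: C)).
  rewrite cat_uniq !enum_uniq andbT; apply/hasPn=> x.
  by rewrite !mem_enum inE.
have me (C : {set T}) x : x \in enum C ++ enum (~: C).
  by rewrite mem_cat !mem_enum inE orbN.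
pose f x := nth x0 sB (index x sA).
have finj : injective f.
  move=> x y /eqP; rewrite nth_uniq ?un ?sz -?(sz A) ?index_mem ?me //.
  by move=> /eqP /(congr1 (nth x0 sA)); rewrite !nth_index ?me.
exists (perm finj); apply/eqP; rewrite eqEcard card_imset ?AB ?leqnn ?andbT.
  apply/subsetP=> _ /imsetP[x xA ->]; rewrite permE /f.
  have lt : (index x sA < size (enum B))%N.
    by rewrite -cardE -AB cardE index_cat mem_enum xA index_mem mem_enum.
  by rewrite nth_cat lt -mem_enum mem_nth.
exact: perm_inj.
Qed.

(** * Expansion of the comultiplication over stable sets *)

Section Expand.
Variable K : fieldType.
Local Notation KX := (KX K).
Local Notation TX := (TX K).
Local Notation clsK := (@cls K).

Lemma tmul_mul (x y : KX) : x ⊗ y = (x ⊗ oneX K : TX) * (oneX K ⊗ y : TX) :> TX.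
Proof. by rewrite [RHS]tmulX_tmul mulr1 mul1r. Qed.

Lemma tmul_prodl I (r : seq I) P (F : I -> KX) :
  ((\prod_(i <- r | P i) F i) ⊗ oneX K : TX) =
  \prod_(i <- r | P i) (F i ⊗ oneX K : TX).
Proof.
elim/big_rec2: _ => // i y z _ <-; by rewrite [RHS]tmulX_tmul mulr1.
Qed.
Lemma tmul_prodr I (r : seq I) P (F : I -> KX) :
  (oneX K ⊗ (\prod_(i <- r | P i) F i) : TX) =
  \prod_(i <- r | P i) (oneX K ⊗ F i : TX).
Proof.
elim/big_rec2: _ => // i y z _ <-; by rewrite [RHS]tmulX_tmul mulr1.
Qed.

(** For stable [A] this is the class of the restriction of [s] to [A]; the product over cycles
    spares the choice of a numbering of [A]. *)
Definition clsin n (s : 'S_n) (A : {set 'I_n}) : KX :=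
  \prod_(C in porbits s | C \subset A) clsK (cyc #|C|).

(** Expanding the product of the sums C (x) 1 + 1 (x) C over the cycles sorts the cycles into left
    and right ones; the union of the left ones is the stable set. *)
Lemma comulX_stable n (s : 'S_n) : comulX (clsK s) =
  \sum_(A : {set 'I_n} | stable s A) clsin s A ⊗ clsin s (~: A).
Proof.
rewrite comulX_cls big_map big_enum /=.
(* For [C] not an orbit of [s] the factor is 0 + 1, so the product may run over all subsets, and
   only families of orbits survive the expansion. *)
pose F (C : {set 'I_n}) : TX :=
  if C \in porbits s then (clsK (cyc #|C|) ⊗ oneX K : TX) else 0.
pose G (C : {set 'I_n}) : TX :=
  if C \in porbits s then (oneX K ⊗ clsK (cyc #|C|) : TX) else 1.
transitivity (\prod_C (F C + G C)).
  rewrite big_mkcond; apply: eq_bigr => C _; rewrite /F /G.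
  by case: ifP => // _; rewrite add0r.
rewrite bigA_distr (bigID (fun J : {set {set 'I_n}} => J \subset porbits s)) /=.
rewrite [X in _ + X]big1 ?addr0; last first.
  move=> J /subsetPn[C CJ Cs]; rewrite (bigD1 C) //= CJ /F (negPf Cs).
  exact: mul0r.
pose h (A : {set 'I_n}) := [set C in porbits s | C \subset A].
rewrite (reindex_onto h (@cover 'I_n)) /=; last first.
  move=> J /subsetP Js; apply/setP=> C; rewrite inE.
  apply/andP/idP=> [[Cs /subsetP CJ]|CJ].
    case/imsetP: Cs CJ => x _ -> CJ.
    have /bigcupP[D DJ xD] := CJ _ (porbit_id s x).
    have /imsetP[y _ Dy] := Js D DJ; rewrite Dy in DJ xD.
    by rewrite -eq_porbit_mem in xD; rewrite (eqP xD).
  by rewrite Js //; split=> //; apply: bigcup_sup.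
apply: eq_big => A.
  by rewrite stableE; apply/andb_idl => _; apply/subsetP=> C; rewrite inE => /andP[].
move=> /andP[_]; rewrite -stableE => sA.
rewrite tmul_mul tmul_prodl tmul_prodr (bigID (fun C => C \in h A)) /=.
congr (_ * _).
  rewrite [LHS](eq_bigr F); last by move=> C ->.
  rewrite (eq_bigl (fun C => (C \in porbits s) && (C \subset A))).
    by apply: eq_bigr => C /andP[Cs _]; rewrite /F Cs.
  by move=> C; rewrite inE.
rewrite [LHS](eq_bigr G); last by move=> C /negPf ->.
rewrite (bigID (fun C => C \in porbits s)) /=.
rewrite [X in _ * X]big1 ?mulr1; last by move=> C /andP[_ /negPf Cs]; rewrite /G Cs.
apply: eq_big => C; last by move=> /andP[_ Cs]; rewrite /G Cs.
rewrite inE andbC; apply: andb_id2l => Cs; rewrite Cs /=.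
case/imsetP: Cs => x _ ->; rewrite !stable_porbit ?stableC //.
by rewrite inE.
Qed.

Lemma clsinJ n (s w : 'S_n) (A : {set 'I_n}) : clsin (s ^ w)%g (w @: A) = clsin s A.
Proof.
rewrite /clsin porbits_conj.
have winj : injective (fun C : {set 'I_n} => w @: C) by exact/imset_inj/perm_inj.
rewrite big_mkcondr big_imset /=; last by move=> C D _ _ /winj.
rewrite [RHS]big_mkcondr; apply: eq_bigr => C _.
rewrite card_imset; last exact: perm_inj.
congr (if _ then _ else _); apply/subsetP/subsetP=> h x.
  by move=> xC; have := h (w x); rewrite !mem_imset; [apply|exact: perm_inj|exact: perm_inj].
by case/imsetP=> y /h yA ->; rewrite imset_f.
Qed.

Section JoinSets.
Variables a b : nat.
Definition lset : {set 'I_(a + b)} := [set lshift b i | i : 'I_a].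

Lemma lsetC : ~: lset = [set rshift a i | i : 'I_b].
Proof.
apply/setP=> x; rewrite inE; case: (split_ordP x) => j ->.
  rewrite imset_f //=; apply/esym/imsetP=> -[y _ /eqP].
  by rewrite eq_lrshift.
rewrite [RHS]imset_f //; apply/imsetP=> -[y _ /eqP]; by rewrite eq_rlshift.
Qed.

Lemma join_stable p : stable (join p) lset.
Proof. by apply/stableP=> _ /imsetP[i _ ->]; rewrite join_lshift imset_f. Qed.

(** A permutation preserving the first block preserves its complement as well, hence restricts to
    both blocks. *)
Lemma stable_join (s : 'S_(a + b)) : stable s lset -> exists p, s = join p.
Proof.
move=> sA; have sB := sA; rewrite -stableC lsetC in sB.
have lP i : exists j, s (lshift b i) = lshift b j.
  have /imsetP[j _ ->] := stableP _ _ sA (lshift b i) (imset_f _ isT).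
  by exists j.
have rP i : exists j, s (rshift a i) = rshift a j.
  have /imsetP[j _ ->] := stableP _ _ sB (rshift a i) (imset_f _ isT).
  by exists j.
have [[l lE] [r rE]] := (choice lP, choice rP).
have linj : injective l.
  by move=> i j e; apply/(@lshift_inj a b)/(@perm_inj _ s); rewrite !lE e.
have rinj : injective r.
  by move=> i j e; apply/(@rshift_inj a b)/(@perm_inj _ s); rewrite !rE e.
exists (perm linj, perm rinj); apply/permP=> x.
case: (split_ordP x) => i ->; first by rewrite join_lshift lE permE.
by rewrite join_rshift rE permE.
Qed.

Lemma clsin_join (p : 'S_a * 'S_b) :
  clsin (join p) lset = clsK p.1 /\ clsin (join p) (~: lset) = clsK p.2.
Proof.
case: p => u v; rewrite /clsin !cls_prod !big_map !big_enum_cond /=.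
have e A : \prod_(C in porbits (join (u, v)) | C \subset A) clsK (cyc #|C|) =
    \prod_(C <- enum (porbits (join (u, v))) | C \subset A) clsK (cyc #|C|).
  by rewrite big_enum_cond.
have lsub (C : {set 'I_a}) : lshift b @: C \subset lset by apply/subsetP=> _ /imsetP[i _ ->]; apply: imset_f.
have rsub (C : {set 'I_b}) : @rshift a b @: C \subset ~: lset.
  by rewrite lsetC; apply/subsetP=> _ /imsetP[i _ ->]; apply: imset_f.
have dis (C A : {set 'I_(a + b)}) : C != set0 -> C \subset A -> (C \subset ~: A) = false.
  move=> /set0Pn[x xC] /subsetP CA; apply/negP=> /subsetP/(_ x xC).
  by rewrite inE CA.
have ne m (s : 'S_m) C : C \in porbits s -> C != set0.
  by case/imsetP=> x _ ->; apply/set0Pn; exists x; apply: porbit_id.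
rewrite !e !(perm_big _ (porbits_join u v)) !big_cat !big_map /=.
split.
- rewrite [X in _ * X]big_seq_cond [X in _ * X]big1 ?mulr1; last first.
    move=> C /andP[]; rewrite mem_enum => Cv; rewrite -{1}[lset]setCK dis ?rsub //.
    by rewrite imset_eq0 (ne _ v).
  rewrite big_enum_cond; apply: eq_big => C; first by rewrite lsub andbT.
  by rewrite card_imset //; apply: lshift_inj.
- rewrite [X in X * _]big_seq_cond [X in X * _]big1 ?mul1r; last first.
    move=> C /andP[]; rewrite mem_enum => Cv; rewrite dis ?lsub //.
    by rewrite imset_eq0 (ne _ u).
  rewrite big_enum_cond; apply: eq_big => C; first by rewrite rsub andbT.
  by rewrite card_imset //; apply: rshift_inj.
Qed.

End JoinSets.

(** The first block inside ['I_n], for use when n = a + b is only a provable equality. *)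
Definition lset_in a n : {set 'I_n} := [set i : 'I_n | (i < a)%N].

Lemma stable_sum n a b (e : (a + b)%N = n) (f : 'S_n -> K) :
  \sum_(s : 'S_n | stable s (lset_in a n))
     f s *: (clsin s (lset_in a n) ⊗ clsin s (~: lset_in a n) : TX) =
  \sum_(p : 'S_a * 'S_b) f (join_in e p) *: (clsK p.1 ⊗ clsK p.2 : TX).
Proof.
case: n / e f => f.
have -> : lset_in a (a + b) = lset a b.
  apply/setP=> x; rewrite inE; case: (split_ordP x) => j -> /=.
    by rewrite imset_f // ltn_ord.
  have : rshift a j \in ~: lset a b by rewrite lsetC imset_f.
  by rewrite inE => /negPf nj; rewrite nj.
have -> : \sum_(p : 'S_a * 'S_b) f (join_in (erefl (a + b)%N) p) *: (clsK p.1 ⊗ clsK p.2 : TX)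
   = \sum_(p : 'S_a * 'S_b) f (join p) *: (clsin (join p) (lset a b) ⊗ clsin (join p) (~: lset a b) : TX).
  apply: eq_bigr => p _; have [-> ->] := clsin_join p.
  by rewrite /join_in cast_perm_id.
pose g s := f s *: (clsin s (lset a b) ⊗ clsin s (~: lset a b) : TX).
transitivity (\sum_(s in @join a b @: [set: 'S_a * 'S_b]) g s).
  apply: eq_bigl => s; apply/idP/imsetP=> [/stable_join[p ->]|[p _ ->]].
    by exists p.
  exact: join_stable.
rewrite big_imset /=; last by move=> p q _ _; apply: join_inj.
by apply: eq_bigl => p; rewrite inE.
Qed.

(* Counts the pairs (s, A) with A an s-stable set: by conjugation the
   contribution of A depends only on #|A|. *)
Lemma comulX_sum n (f : 'S_n -> K) : [pchar K] =i pred0 ->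
  (forall s w, f (s ^ w)%g = f s) ->
  n`!%:R^-1 *: \sum_s f s *: comulX (clsK s) =
  \sum_(a < n.+1) (a`! * (n - a)`!)%:R^-1 *:
    \sum_(p : 'S_a * 'S_(n - a))
      f (join_in (subnKC (leq_ord a)) p) *: (clsK p.1 ⊗ clsK p.2 : TX).
Proof.
move=> charK fJ.
pose G A := \sum_(s : 'S_n | stable s A) f s *: (clsin s A ⊗ clsin s (~: A) : TX).
have -> : \sum_s f s *: comulX (clsK s) = \sum_A G A.
  rewrite [RHS](exchange_big_dep xpredT) //=; apply: eq_bigr => s _.
  by rewrite comulX_stable scaler_sumr.
have GJ (w : 'S_n) (A : {set 'I_n}) : G (w @: A) = G A.
  apply: etrans (reindex_inj (@conjg_inj _ w)) _ => /=.
  apply: eq_big => s; first exact: stableJ.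
  by rewrite fJ setC_imset_perm !clsinJ.
pose cc (A : {set 'I_n}) : 'I_n.+1 := inord #|A|.
rewrite (partition_big cc xpredT) //= scaler_sumr; apply: eq_bigr => a _.
have an : (a <= n)%N := leq_ord a.
have cardL : #|lset_in a n| = a.
  have -> : lset_in a n = [set widen_ord an i | i : 'I_a].
    apply/setP=> x; rewrite inE; apply/idP/imsetP=> [xa|[i _ ->]]; last by rewrite /= ltn_ord.
    by exists (Ordinal xa) => //; apply: val_inj.
  rewrite card_imset ?card_ord //.
  by move=> i j /(congr1 val) /= e; apply: val_inj.
have ccE A : (cc A == a) = (#|A| == a).
  rewrite -val_eqE /= inordK // ltnS -[X in (_ <= X)%N]card_ord; exact: max_card.
rewrite (eq_bigr (fun _ => G (lset_in a n))); last first.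
  move=> A; rewrite ccE => /eqP Aa.
  by have [w <-] := perm_of_sets (etrans cardL (esym Aa)); apply: GJ.
rewrite sumr_const -(stable_sum (subnKC (leq_ord a)) f) -/(G _).
have -> : #|[pred A | cc A == a]| = 'C(n, a).
  have := card_draws 'I_n a; rewrite card_ord => <-.
  by apply: eq_card => A; rewrite !inE ccE.
(* There are C(n, a) sets of size a, and C(n, a) / n! = 1 / (a! (n - a)!). *)
rewrite -scaler_nat scalerA; congr (_ *: _).
have nz : 'C(n, a)%:R != 0 :> K.
  by rewrite ((pcharf0P _).1 charK) -lt0n bin_gt0.
by rewrite -(bin_fact an) natrM invfM mulrAC mulVf ?mul1r.
Qed.

End Expand.

(** * Characters of finite groups in characteristic zero *)

Section Characters.
Variable K : fieldType.
Hypothesis charK : [pchar K] =i pred0.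

Lemma natK_eq0 n : (n%:R == 0 :> K) = (n == 0)%N.
Proof. exact: (pcharf0P K).1. Qed.

Lemma natK_inj : injective (fun n => n%:R : K).
Proof.
move=> m n /= e; wlog mn : m n e / (m <= n)%N.
  by move=> W; case: (leqP m n) => [|/ltnW] /W h; [|symmetry]; apply: h.
move/eqP: e; rewrite eq_sym -subr_eq0 -natrB // natK_eq0 subn_eq0 => nm.
by apply/eqP; rewrite eqn_leq mn.
Qed.

Lemma intK_inj : injective (fun z => z%:~R : K).
Proof.
move=> x y /= /eqP; rewrite -subr_eq0 -rmorphB /= => e.
apply/eqP; rewrite -subr_eq0; move: e; set z := x - y.
case: (intP z) => // n; rewrite ?mulrNz -?pmulrn ?oppr_eq0 natK_eq0; by case: n.
Qed.

Section Group.
Variable gT : finGroupType.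
Local Notation G := [set: gT]%G.
Local Notation rep := (rep K gT).
Local Notation groth := (groth K gT).
Local Notation aG := (regular_repr K G).
Local Notation R_G := (group_ring K G).

Lemma char'G : ([pchar K]^'.-group G)%g.
Proof. by apply/pgroupP=> p pr_p _; rewrite inE /= charK. Qed.

Hypothesis splitG : group_splitting_field K G.
Variable sG : irrType K G.

Definition irr (i : sG) : rep := Rep (irr_repr i).

Definition chi (V : rep) (x : gT) : K := \tr (V x).

Lemma chi1 V : chi V 1%g = (rdim V)%:R.
Proof. by rewrite /chi repr_mx1 mxtrace1. Qed.

Lemma chiJ V x y : chi V (x ^ y)%g = chi V x.
Proof.
rewrite /chi conjgE !repr_mxM ?inE // mxtrace_mulC -mulmxA.
by rewrite -repr_mxM ?inE // mulgV repr_mx1 mulmx1.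
Qed.

Lemma chi_rsim (V W : rep) : mx_rsim V W -> chi V =1 chi W.
Proof. by move=> VW x; apply: (mxtrace_rsim VW); rewrite inE. Qed.

Lemma irr_degree_neq0 i : (rdim (irr i))%:R != 0 :> K.
Proof. by rewrite natK_eq0 -lt0n; apply: irr_degree_gt0. Qed.

Lemma rep_dim_gt0 (V : rep) : mx_irreducible V -> (0 < rdim V)%N.
Proof. by case/mx_irrP. Qed.

Lemma cardG_neq0 : #|G|%:R != 0 :> K.
Proof. by rewrite natK_eq0 -lt0n cardG_gt0. Qed.

Lemma mxtrace_regular_one x : \tr (aG x) = (#|G| * (x == 1%g))%:R.
Proof.
rewrite /mxtrace; have [->|nx1] := eqVneq x 1%g.
  rewrite repr_mx1; under eq_bigr => i _ do rewrite mxE eqxx.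
  by rewrite sumr_const card_ord muln1.
rewrite muln0 big1 // => i _; rewrite !mxE eqxx /=.
case: eqP => // /(congr1 enum_val); rewrite gring_indexK ?inE //.
by move/esym/eqP; rewrite -[X in _ == X]mulg1 (inj_eq (mulgI _)) (negPf nx1).
Qed.

Lemma mxtrace_gring A : (A \in R_G)%MS ->
  \tr A = \sum_(i : sG) \tr (gring_op (irr i) A) *+ rdim (irr i).
Proof.
case/envelop_mxP=> a ->; rewrite linear_sum /=.
under [RHS]eq_bigr => i _ do rewrite linear_sum /= linear_sum /= -sumrMnl.
rewrite [RHS]exchange_big; apply: eq_bigr => x _.
rewrite linearZ /= (mxtrace_regular_pchar sG char'G splitG) ?inE //.
rewrite mulr_sumr; apply: eq_bigr => i _.
rewrite !linearZ /= gring_opG ?inE // mulrnAr //.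
Qed.

Lemma Wedderburn_id_gring (i : sG) : (Wedderburn_id i \in R_G)%MS.
Proof.
have := Wedderburn_id_mem i; rewrite genmxE => h.
by apply: submx_trans h _; rewrite submxMl.
Qed.

Lemma op_Wedderburn i j :
  gring_op (irr i) (Wedderburn_id (j : sG)) = (i == j)%:R *: 1%:M.
Proof.
have [<-|ne] := eqVneq i j.
  by rewrite scale1r; apply: (@op_Wedderburn_id_pchar _ _ _ sG char'G i).
rewrite scale0r; apply: (@irr_repr'_op0_pchar _ _ _ sG char'G i j) => //.
  by rewrite eq_sym.
exact: Wedderburn_id_mem.
Qed.

Lemma gring_row_aG x y :
  gring_row (aG y) 0 (gring_index G x) = (x == y)%:R :> K.
Proof.
rewrite /gring_row !mxE gring_indexK ?inE // mul1g eqxx /= -[x == y]/(x == y).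
have inj : {in G &, injective (gring_index G)}.
  exact: can_in_inj (@gring_indexK _ _).
by rewrite (inj_in_eq inj) ?inE.
Qed.

(** The regular character is the group order at 1 and vanishes elsewhere, so the trace of A x^-1
    isolates the coefficient at [x]. *)
Lemma gring_coef A x : (A \in R_G)%MS ->
  gring_row A 0 (gring_index G x) =
  #|G|%:R^-1 * \tr (A *m aG x^-1%g).
Proof.
case/envelop_mxP=> a ->; rewrite linear_sum /= summxE mulmx_suml linear_sum /=.
rewrite mulr_sumr; apply: eq_bigr => y _.
rewrite linearZ mxE gring_row_aG -scalemxAl linearZ /=.
rewrite -[regular_mx _ _ y]/(aG y) -[regular_mx _ _ x^-1%g]/(aG x^-1%g).
rewrite -repr_mxM ?inE // mxtrace_regular_one -eq_mulgV1 eq_sym natrM mulrCA.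
by rewrite mulKf ?cardG_neq0.
Qed.

(** The idempotent acts as 1 on its own irreducible and as 0 on the others, so a single term is left
    when the regular trace is decomposed. *)
Lemma Wedderburn_coef (i : sG) x :
  gring_row (Wedderburn_id i) 0 (gring_index G x) =
  #|G|%:R^-1 * ((rdim (irr i))%:R * chi (irr i) x^-1%g).
Proof.
rewrite gring_coef ?Wedderburn_id_gring //; congr (_ * _).
have aR y : (aG y \in R_G)%MS by rewrite envelop_mx_id ?inE.
rewrite mxtrace_gring ?envelop_mxM ?Wedderburn_id_gring //.
have opW j : gring_op (irr_repr j) (Wedderburn_id i) = (j == i)%:R *: 1%:M.
  exact: op_Wedderburn.
rewrite (bigD1 i) //= big1 ?addr0 => [|j ne].
  rewrite gring_opM; last exact: aR.
  rewrite opW eqxx scale1r mul1mx.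
  by rewrite gring_opG ?inE // mulr_natl.
rewrite gring_opM; last exact: aR.
rewrite opW (negPf ne) scale0r.
by rewrite mul0mx mxtrace0 mul0rn.
Qed.

(** The inner product of class functions; inversion takes the place of complex conjugation. *)
Definition cdot (f g : gT -> K) : K :=
  #|G|%:R^-1 * \sum_x f x^-1%g * g x.

Lemma gring_sum A : (A \in R_G)%MS ->
  A = \sum_x gring_row A 0 (gring_index G x) *: aG x.
Proof.
case/envelop_mxP=> a ->; rewrite [LHS](eq_bigl predT); last by move=> x; rewrite inE.
apply: eq_bigr => x _; rewrite linear_sum /= summxE (bigD1 x) ?inE //=.
rewrite linearZ mxE gring_row_aG eqxx mulr1 big1 ?addr0 // => y /andP[_ ne].
by rewrite linearZ mxE gring_row_aG eq_sym (negPf ne) mulr0.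
Qed.

(** Expand the idempotent of [i] by its character coefficients, let it act on the irreducible [j]
    and take the trace; the degree then cancels. *)
Lemma irr_orthonormal i j : cdot (chi (irr i)) (chi (irr j)) = (i == j)%:R.
Proof.
apply: (mulfI (irr_degree_neq0 i)).
have := congr1 mxtrace (op_Wedderburn j i).
rewrite {1}[Wedderburn_id i]gring_sum ?Wedderburn_id_gring //.
rewrite !linear_sum /= linearZ /= mxtrace1 eq_sym => e.
transitivity ((j == i)%:R * (irr_degree j)%:R : K); last first.
  by rewrite eq_sym; case: eqVneq => [->|_]; rewrite ?mul0r ?mulr0 // mulr1 mul1r.
rewrite eq_sym -e /cdot mulrA mulr_sumr; apply: eq_bigr => x _.
rewrite !linearZ /= gring_opG ?inE // Wedderburn_coef.
by rewrite [_ * #|_|%:R^-1]mulrC -!mulrA.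
Qed.

Lemma cdotDl f f' g : cdot (fun x => f x + f' x) g = cdot f g + cdot f' g.
Proof.
rewrite /cdot -mulrDr -big_split; congr (_ * _).
by apply: eq_bigr => x _; rewrite mulrDl.
Qed.

Lemma cdot_suml I (s : seq I) (c : I -> K) (F : I -> gT -> K) g :
  cdot (fun x => \sum_(i <- s) c i * F i x) g = \sum_(i <- s) c i * cdot (F i) g.
Proof.
rewrite /cdot; under [RHS]eq_bigr => i _ do rewrite mulrCA mulr_sumr.
rewrite -mulr_sumr exchange_big /=; congr (_ * _); apply: eq_bigr => x _.
by rewrite mulr_suml; apply: eq_bigr => i _; rewrite mulrA.
Qed.

Lemma cdot_sumr I (s : seq I) (c : I -> K) (F : I -> gT -> K) g :
  cdot g (fun x => \sum_(i <- s) c i * F i x) = \sum_(i <- s) c i * cdot g (F i).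
Proof.
rewrite /cdot; under [RHS]eq_bigr => i _ do rewrite mulrCA mulr_sumr.
rewrite -mulr_sumr exchange_big /=; congr (_ * _); apply: eq_bigr => x _.
by rewrite mulr_sumr; apply: eq_bigr => i _; rewrite mulrCA.
Qed.

Lemma eq_cdot f f' g g' : f =1 f' -> g =1 g' -> cdot f g = cdot f' g'.
Proof.
by move=> ef eg; congr (_ * _); apply: eq_bigr => x _; rewrite ef eg.
Qed.

Definition irr_of (V : rep) : sG := irr_comp sG V.

Lemma irr_ofP (V : rep) : mx_irreducible V -> mx_rsim V (irr (irr_of V)).
Proof. exact: (rsim_irr_comp_pchar sG char'G). Qed.

Lemma irr_irr (i : sG) : mx_irreducible (irr i).
Proof. exact: socle_irr. Qed.

Lemma irr_of_rsim (V W : rep) : mx_rsim V W -> irr_of V = irr_of W.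
Proof. exact: (irr_comp_rsim_pchar sG char'G). Qed.

Lemma rsim_irr_of (V W : rep) : mx_irreducible V -> mx_irreducible W ->
  irr_of V = irr_of W -> mx_rsim V W.
Proof.
move=> iV iW e; apply: mx_rsim_trans (irr_ofP iV) _.
by rewrite e; apply: mx_rsim_sym; apply: irr_ofP.
Qed.

Lemma irr_cdot (V W : rep) : mx_irreducible V -> mx_irreducible W ->
  cdot (chi V) (chi W) = (irr_of V == irr_of W)%:R.
Proof.
move=> /irr_ofP/chi_rsim iV /irr_ofP/chi_rsim iW.
by rewrite (eq_cdot iV iW) irr_orthonormal.
Qed.

Lemma gcls_rsim (V W : rep) : mx_rsim V W -> gcls V = gcls W.
Proof.
move=> VW; have /eqP := pclass_rel (GrothIso VW).
by rewrite raddfB subr_eq0 => /eqP.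
Qed.

Lemma gcls_exact (V : rep) (U : 'M_(rdim V)) (modU : mxmodule V U) :
  gcls V = gcls (Rep (submod_repr modU)) + gcls (Rep (factmod_repr modU)).
Proof.
have /eqP := pclass_rel (GrothExact modU).
by rewrite !raddfB -addrA -opprD subr_eq0 => /eqP.
Qed.

Lemma rsim_dim0 m n (r1 : mx_representation K G m)
  (r2 : mx_representation K G n) : m = 0%N -> n = 0%N -> mx_rsim r1 r2.
Proof.
move=> m0; move: r1; rewrite m0 => r1 n0; move: r2; rewrite n0 => r2.
exists 0 => //; first by rewrite /row_free mxrank0.
by move=> x _; rewrite mulmx0 mul0mx.
Qed.

(** For the zero submodule exactness reads [V] = [V] + [V], since all representations of dimension 0
    are isomorphic. *)
Lemma gcls0 (V : rep) : rdim V = 0%N -> gcls V = 0.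
Proof.
move=> V0; have mod0 : mxmodule V (0 : 'M_(rdim V)) by apply: mxmodule0.
have rs (W : rep) : rdim W = 0%N -> mx_rsim W V.
  move=> W0; exact: rsim_dim0.
have s0 : rdim (Rep (submod_repr mod0)) = 0%N by rewrite /= mxrank0.
have f0 : rdim (Rep (factmod_repr mod0)) = 0%N.
  by rewrite /= mxrank_coker mxrank0 subn0.
have := gcls_exact mod0; rewrite (gcls_rsim (rs _ s0)) (gcls_rsim (rs _ f0)).
by move/eqP; rewrite -[X in X == _]addr0 (inj_eq (addrI _)) eq_sym => /eqP.
Qed.

(** [ssrint.zmodule K] is [K] as a module over the integers, the scalars of [groth]. *)
Definition gchar (u : groth) (x : gT) : K :=
  plift (fun V => chi V x : ssrint.zmodule K) u.

Lemma gchar_rel x r : groth_rel r ->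
  plin (fun V : rep => chi V x : ssrint.zmodule K) r = 0.
Proof.
case=> [V W VW|V U modU]; rewrite !raddfB /= !plinU.
  by rewrite (chi_rsim VW) subrr.
by rewrite /chi /= -(mxtrace_sub_fact_mod modU) -addrA -opprD subrr.
Qed.

Lemma gchar_lin x : linear (fun u : groth => gchar u x : ssrint.zmodule K).
Proof. exact: plift_lin (@gchar_rel x). Qed.

Lemma gchar_gcls V : gchar (gcls V) =1 chi V.
Proof. by move=> x; apply: plift_gen (@gchar_rel x) V. Qed.

Lemma gcharD u v x : gchar (u + v) x = gchar u x + gchar v x.
Proof. exact: linD (gchar_lin x). Qed.

Lemma gcharB u v x : gchar (u - v) x = gchar u x - gchar v x.
Proof. exact: linB (gchar_lin x). Qed.

Lemma gcharZ c u x : gchar (c *: u) x = c%:~R * gchar u x.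
Proof. by rewrite [LHS](linZ _ _ (gchar_lin x)) mulrzl. Qed.

Lemma gchar_sum I (s : seq I) (F : I -> groth) x :
  gchar (\sum_(i <- s) F i) x = \sum_(i <- s) gchar (F i) x.
Proof. exact: lin_sum (gchar_lin x). Qed.

(** Split along a proper nonzero submodule as long as there is one. The bounds on the number of
    factors serve [norm1_irreducible]. *)
Lemma gcls_decomp V : exists2 s : seq sG, gcls V = \sum_(i <- s) gcls (irr i) &
  ((0 < rdim V)%N -> (0 < size s)%N) /\
  ((0 < rdim V)%N -> ~ mx_irreducible V -> (1 < size s)%N).
Proof.
elim: {V}_.+1 {-2}V (ltnSn (rdim V)) => // m IHm V; rewrite ltnS => Vm.
have [V0|V0] := posnP (rdim V).
  by exists [::]; rewrite ?big_nil ?gcls0.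
have [irrV|nirrV] := pselect (mx_irreducible V).
  by exists [:: irr_of V] => //; rewrite big_seq1; apply/gcls_rsim/irr_ofP.
have [U /and4P[modU _ nzU ltU]] : mxnonsimple V 1%:M.
  have [//|h] := pselect (mxnonsimple V 1%:M).
  case: nirrV; apply/mxsimpleP; split=> //; first exact: mxmodule1.
  by rewrite -mxrank_eq0 mxrank1 -lt0n.
rewrite mxrank1 in ltU; have U0 : (0 < \rank U)%N by rewrite lt0n mxrank_eq0.
have fU : \rank (cokermx U) = (rdim V - \rank U)%N by rewrite mxrank_coker.
have fU0 : (0 < \rank (cokermx U))%N by rewrite fU subn_gt0.
have [|s1 e1 [p1 _]] := IHm (Rep (submod_repr modU)); first exact: leq_trans ltU Vm.
have [|s2 e2 [p2 _]] := IHm (Rep (factmod_repr modU)).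
  by rewrite /= fU; apply: leq_trans Vm; rewrite ltn_subrL U0.
exists (s1 ++ s2); first by rewrite big_cat -e1 -e2; apply: gcls_exact.
rewrite size_cat; have := p1 U0; have := p2 fU0 => /= a b.
by split=> _; [rewrite addn_gt0 b|move=> _; apply: (@leq_add 1 1)].
Qed.

Lemma groth_span (u : groth) :
  exists c : sG -> int, u = \sum_i c i *: gcls (irr i).
Proof.
have [s ->] := pmod_span u; elim: s => [|p s [c IHs]].
  exists (fun _ => 0); rewrite big_nil big1 // => i _; exact: scale0r.
have [t e _] := gcls_decomp p.2.
exists (fun i => p.1 * (count_mem i t)%:Z + c i).
rewrite big_cons IHs -/(gcls p.2) e; under [RHS]eq_bigr do rewrite scalerDl.
rewrite big_split; congr (_ + _).
rewrite scaler_sumr [RHS](eq_bigr (fun i => p.1 *: ((count_mem i t)%:Z *: gcls (irr i)))); last first.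
  by move=> i _; rewrite scalerA.
rewrite -!scaler_sumr; congr (_ *: _); elim: t {e} => [|j t IHt].
  by rewrite big_nil big1 // => i _; apply: scale0r.
rewrite big_cons IHt (bigD1 j) //= [RHS](bigD1 j) //= eqxx.
rewrite PoszD scalerDl scale1r addrA; congr (_ + _).
by apply: eq_bigr => i ne; rewrite eq_sym (negPf ne).
Qed.

(** Pairing with an irreducible character reads off one integer coefficient, and the integers embed
    in [K]. *)
Lemma gchar_eq0 (u : groth) : (forall x, gchar u x = 0) -> u = 0.
Proof.
have [c ->] := groth_span u => u0; rewrite big1 // => i _.
suff -> : c i = 0 by apply: scale0r.
apply: intK_inj; rewrite mulr0z.
have : cdot (chi (irr i)) (gchar (\sum_i c i *: gcls (irr i))) = 0.
  by rewrite /cdot big1 ?mulr0 // => x _; rewrite u0 mulr0.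
rewrite (@eq_cdot _ (chi (irr i)) _ (fun x => \sum_j (c j)%:~R * chi (irr j) x)) //; last first.
  by move=> x; rewrite gchar_sum; apply: eq_bigr => j _; rewrite gcharZ gchar_gcls.
rewrite cdot_sumr (bigD1 i) //= irr_orthonormal eqxx mulr1 big1 ?addr0 // => j ne.
by rewrite irr_orthonormal eq_sym (negPf ne) mulr0.
Qed.

(** The norm counts the pairs of equal composition factors, diagonal pairs included, so it is at
    least the number of factors; a reducible nonzero representation has two or more. *)
Lemma norm1_irreducible (V : rep) : cdot (chi V) (chi V) = 1 -> mx_irreducible V.
Proof.
have [V0|V0] := posnP (rdim V).
  rewrite /cdot big1 ?mulr0; first by move/esym/eqP; rewrite oner_eq0.
  move=> x _; rewrite -[chi V x]gchar_gcls gcls0 // [gchar 0 x](lin0 (gchar_lin x)).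
  exact: mulr0.
have [s e [s0 s1]] := gcls_decomp V.
have eV : chi V =1 (fun x => \sum_(i <- s) 1 * chi (irr i) x).
  move=> x; rewrite -gchar_gcls e gchar_sum.
  by apply: eq_bigr => i _; rewrite gchar_gcls mul1r.
have -> : cdot (chi V) (chi V) = (\sum_(i <- s) \sum_(j <- s) (i == j))%:R.
  rewrite (eq_cdot eV eV) cdot_suml natr_sum; apply: eq_bigr => i _.
  rewrite mul1r cdot_sumr natr_sum; apply: eq_bigr => j _.
  by rewrite mul1r irr_orthonormal.
have ge : (size s <= \sum_(i <- s) \sum_(j <- s) (i == j))%N.
  rewrite -sum1_size big_seq [X in (_ <= X)%N]big_seq; apply: leq_sum => i si.
  by rewrite (big_rem i) //= eqxx.
move=> e1; have {}e1 := @natK_inj _ 1%N e1; rewrite e1 in ge.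
by have [//|/(s1 V0)] := pselect (mx_irreducible V); rewrite ltnNge ge.
Qed.

(** The group ring element with coefficients f(x^-1) is central, so by Schur's lemma it acts on each
    irreducible as a scalar. The trace is 0 and the degree invertible, so it acts as 0 on all of
    them and vanishes. *)
Lemma class_fun_eq0 (f : gT -> K) : (forall x y, f (x ^ y)%g = f x) ->
  (forall i, \sum_x f x^-1%g * chi (irr i) x = 0) -> forall x, f x = 0.
Proof.
move=> fJ f0; pose A := \sum_x f x^-1%g *: aG x.
have RA : (A \in R_G)%MS.
  rewrite /A linear_sum; apply: summx_sub => x _ /=.
  by rewrite linearZ scalemx_sub // envelop_mx_id ?inE.
have op0 i : gring_op (irr i) A = 0.
  have opA : gring_op (irr i) A = \sum_x f x^-1%g *: irr i x.
    rewrite /A linear_sum; apply: eq_bigr => x _.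
    by rewrite linearZ /= gring_opG ?inE.
  have : is_scalar_mx (gring_op (irr i) A).
    apply: (mx_abs_irr_cent_scalar (splitG (irr_irr i))).
    apply/centgmxP=> y _; rewrite opA mulmx_suml mulmx_sumr.
    rewrite [RHS](reindex_inj (conjg_inj y)) /=; apply: eq_bigr => x _.
    rewrite -scalemxAl -scalemxAr -conjVg fJ -!repr_mxM ?inE //.
    by rewrite conjgE !mulgA mulgV mul1g.
  case/is_scalar_mxP=> a ea; have := f0 i.
  have <- : \tr (gring_op (irr i) A) = \sum_x f x^-1%g * chi (irr i) x.
    by rewrite opA linear_sum; apply: eq_bigr => x _; rewrite linearZ.
  rewrite ea mxtrace_scalar -mulr_natr => /eqP.
  by rewrite mulf_eq0 (negPf (irr_degree_neq0 i)) orbF => /eqP ->; rewrite raddf0.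
have A0 : forall x, gring_row A 0 (gring_index G x) = 0.
  move=> x; rewrite gring_coef // mxtrace_gring; last first.
    by rewrite envelop_mxM // envelop_mx_id ?inE.
  rewrite big1 ?mulr0 // => i _.
  by rewrite gring_opM ?envelop_mx_id ?inE // op0 mul0mx mxtrace0 mul0rn.
move=> x; have := A0 x^-1%g; rewrite /A linear_sum /= summxE (bigD1 x^-1%g) //=.
rewrite linearZ mxE gring_row_aG eqxx mulr1 invgK big1 ?addr0 // => y ne.
by rewrite linearZ mxE gring_row_aG eq_sym (negPf ne) mulr0.
Qed.

Lemma card_sG : #|sG| = #|classes G|.
Proof. exact: (card_irr_pchar sG char'G splitG). Qed.

End Group.
End Characters.

(** * Specht modules *)

Section GroupRingCriteria.
Variables (F : fieldType) (gT : finGroupType) (G : {group gT}).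
Hypothesis F'G : ([pchar F]^'.-group G)%g.
Local Notation aG := (regular_repr F G).
Local Notation R_G := (group_ring F G).

(* If 1 = e + e' along a complement W of N, then v = e v + e' v = e' v lies in
   N and W for every v in N. *)
Lemma nil_module_eq0 (N : 'M[F]_(gcard G)) : mxmodule aG N ->
    (forall u v : 'rV_(gcard G), (u <= N)%MS -> (v <= N)%MS ->
      u *m gring_mx aG v = 0) ->
  N = 0.
Proof.
move=> modN NN0; have [W modW NW dNW] := mx_Maschke_pchar aG F'G modN (submx1 N).
apply/eqP/rowV0P => v vN.
have v1 : v = gring_row 1%:M *m gring_mx aG v.
  by rewrite -gring_row_mul mul1mx gring_mxK.
have /sub_addsmxP[[e e'] /= ee'] : (gring_row (1%:M : 'M[F]_(gcard G)) <= N + W)%MS.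
  by rewrite NW submx1.
rewrite ee' mulmxDl NN0 ?submxMl // add0r in v1.
have : (v <= N :&: W)%MS.
  rewrite sub_capmx vN v1 /=; apply: submx_trans (mxmodule_envelop modW (gring_mxP _ v) (submxMl e' W)).
  exact: submx_refl.
by rewrite (mxdirect_addsP dNW) submx0 => /eqP.
Qed.

Lemma sub_cyclic (z : 'M[F]_(gcard G)) (u : 'rV_(gcard G)) :
  (u <= cyclic_mx aG (gring_row z))%MS ->
  exists2 A, (A \in R_G)%MS & u = gring_row (z *m A).
Proof.
by move=> /cyclic_mxP[A RA ->]; exists A => //; rewrite gring_row_mul.
Qed.

(** Members of [N] have the form z B, so u (z B) = (u z) B = 0 and [N] has zero multiplication. *)
Lemma cyclic_nil (z : 'M[F]_(gcard G)) (N : 'M[F]_(gcard G)) :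
    (z \in R_G)%MS -> mxmodule aG N -> (N <= cyclic_mx aG (gring_row z))%MS ->
    (forall u : 'rV_(gcard G), (u <= N)%MS -> u *m z = 0) -> N = 0.
Proof.
move=> Rz modN sN Nz; apply: nil_module_eq0 => // u v uN vN.
have [B RB ->] := sub_cyclic (submx_trans vN sN).
by rewrite gring_rowK ?envelop_mxM // mulmxA Nz ?mul0mx.
Qed.

(** If [N] contains u = z A with u z nonzero, then u z = k z with k invertible and [z] lies in [N].
    Otherwise [N] is killed by [z] on the right, which forces N = 0. *)
Lemma mxsimple_cyclic_crit (z : 'M[F]_(gcard G)) :
    (z \in R_G)%MS -> z != 0 ->
    (forall X, (X \in R_G)%MS -> exists k, z *m X *m z = k *: z) ->
  mxsimple aG (cyclic_mx aG (gring_row z)).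
Proof.
move=> Rz nz zXz; split; first exact: cyclic_mx_module.
  rewrite cyclic_mx_eq0; apply: contra nz => /eqP z0.
  by rewrite -(gring_rowK Rz) z0 linear0.
move=> N modN sN nzN; apply: cyclic_mx_sub => //.
have [[u uN uz]|nou] := pselect (exists2 u : 'rV_(gcard G), (u <= N)%MS & u *m z != 0).
  have [A RA eu] := sub_cyclic (submx_trans uN sN).
  have [k ek] := zXz A RA; rewrite eu -gring_row_mul ek linearZ /= in uz.
  have k0 : k != 0 by apply: contraNneq uz => ->; rewrite scale0r.
  have -> : gring_row z = k^-1 *: (u *m z).
    by rewrite eu -gring_row_mul ek linearZ scalerA mulVf ?scale1r.
  by rewrite scalemx_sub // (mxmodule_envelop modN).
case/eqP: nzN; apply: (cyclic_nil Rz) => // u uN; apply/eqP; apply/negPn/negP => uz.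
by apply: nou; exists u.
Qed.

(** An isomorphism f would write each u in the ideal of [z'] as f(z A), so that u z' = f(z A z') =
    0; the ideal of [z'] would then be zero by [cyclic_nil]. *)
Lemma cyclic_not_iso (z z' : 'M[F]_(gcard G)) :
    (z \in R_G)%MS -> (z' \in R_G)%MS -> z' != 0 ->
    (forall X, (X \in R_G)%MS -> z *m X *m z' = 0) ->
  ~ mx_iso aG (cyclic_mx aG (gring_row z)) (cyclic_mx aG (gring_row z')).
Proof.
move=> Rz Rz' nz' zz' [f _ homf /eqmxP /andP[_ sM]].
case/eqP: nz'; rewrite -(gring_rowK Rz').
suff : cyclic_mx aG (gring_row z') = 0.
  by move/eqP; rewrite cyclic_mx_eq0 => /eqP ->; rewrite linear0.
apply: (cyclic_nil Rz') (cyclic_mx_module _ _) (submx_refl _) _ => u uM.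
have /submxP[w ew] := submx_trans uM sM; rewrite mulmxA in ew.
have wM : (w *m cyclic_mx aG (gring_row z) <= cyclic_mx aG (gring_row z))%MS.
  exact: submxMl.
rewrite ew -(hom_envelop_mxC (submx_trans wM homf) Rz').
by have [A RA ->] := sub_cyclic wM; rewrite -gring_row_mul zz' // linear0 mul0mx.
Qed.

End GroupRingCriteria.

(** * Sums of distinct natural numbers *)

Section InjSum.
Variables (T : finType) (f : T -> nat).

Lemma inj_card_le (A : {set T}) x : {in A &, injective f} ->
  (forall y, y \in A -> f y <= f x)%N -> (#|A| <= (f x).+1)%N.
Proof.
move=> fi fx; rewrite -(size_iota 0 (f x).+1) cardE -(size_map f).
apply: uniq_leq_size.
  rewrite map_inj_in_uniq ?enum_uniq // => a b.
  by rewrite !mem_enum; apply: fi.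
by move=> _ /mapP[y + ->]; rewrite mem_enum mem_iota ltnS => /fx.
Qed.

(** Remove the largest value: it is at least #|A| - 1, and by induction the rest sums to at least
    C(#|A| - 1, 2). If the whole sum is minimal, the largest value is also at most #|A| - 1. *)
Lemma inj_sum_ge (A : {set T}) : {in A &, injective f} ->
  ('C(#|A|, 2) <= \sum_(i in A) f i)%N /\
  ((\sum_(i in A) f i <= 'C(#|A|, 2))%N -> forall i, i \in A -> (f i < #|A|)%N).
Proof.
move: {2}#|A| (erefl #|A|) => m; elim: m A => [|m IHm] A cA fi.
  have A0 := cards0_eq cA; rewrite cA; split=> // _ i.
  by rewrite A0 inE.
have [x0 x0A] : exists x, x \in A by apply/card_gt0P; rewrite cA.
case: (arg_maxnP f x0A) => x /= xA' fx; have {xA'}xA : x \in A by [].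
have cA' : #|A :\ x| = m.
  by apply/eqP; rewrite -eqSS -cA (cardsD1 x A) xA.
have [] := IHm (A :\ x) cA'.
  by move=> a b /setD1P[_ aA] /setD1P[_ bA]; apply: fi.
rewrite cA' => ge _; have mx := inj_card_le fi fx; rewrite cA ltnS in mx.
have -> : \sum_(i in A) f i = (f x + \sum_(i in A :\ x) f i)%N.
  by rewrite (big_setD1 x).
rewrite cA binS bin1; split; first by rewrite addnC leq_add.
move=> le i iA; rewrite ltnS; apply: leq_trans (fx i iA) _.
by rewrite -(leq_add2l 'C(m, 2)); apply: leq_trans le; rewrite addnC leq_add2l.
Qed.

End InjSum.

(** * Rows and columns of a Young diagram *)

Section Rows.
Variables (n : nat) (l : seq nat).
Hypothesis ln : sumn l = n.
Local Notation row i := (reshape_index l i).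
Local Notation col i := (reshape_offset l i).

Lemma row_lt (i : 'I_n) : (row i < size l)%N.
Proof. by apply: reshape_indexP; rewrite ln. Qed.

Lemma col_lt (i : 'I_n) : (col i < nth 0 l (row i))%N.
Proof. by apply: reshape_offsetP; rewrite ln. Qed.

Lemma rowcol_inj (i j : 'I_n) : row i = row j -> col i = col j -> i = j.
Proof.
move=> rij cij; apply: val_inj => /=.
by rewrite -(reshape_indexK l i) -(reshape_indexK l j) rij cij.
Qed.

Fact cell_subproof k c : (c < nth 0 l k)%N -> (flatten_index l k c < n)%N.
Proof.
by move=> ck; rewrite -ln; apply: flatten_indexP.
Qed.

Lemma cellP k c : (c < nth 0 l k)%N ->
  exists i : 'I_n, row i = k /\ col i = c.
Proof.
move=> ck; exists (Ordinal (cell_subproof ck)); split=> /=.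
  exact: flatten_indexKl.
exact: flatten_indexKr.
Qed.

Lemma row_sum k (f : nat -> nat) :
  \sum_(i : 'I_n | row i == k) f (col i) = \sum_(c < nth 0 l k) f c.
Proof.
pose cell (c : 'I_(nth 0 l k)) : 'I_n := Ordinal (cell_subproof (ltn_ord c)).
have rc c : row (cell c) = k by apply: flatten_indexKl.
have cc c : col (cell c) = c by apply: flatten_indexKr.
transitivity (\sum_(i in cell @: setT) f (col i)).
  apply: eq_bigl => i; apply/eqP/imsetP=> [ri|[c _ ->] //].
  have lt := col_lt i; rewrite ri in lt.
  exists (Ordinal lt) => //; apply: rowcol_inj; rewrite ?rc ?cc //.
rewrite big_imset /=; first by apply: eq_big => [c|c _]; rewrite ?inE ?cc.
by move=> c d _ _ /(congr1 (fun i : 'I_n => col i)); rewrite !cc => /val_inj.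
Qed.

Lemma card_row k : #|[set i : 'I_n | row i == k]| = nth 0 l k.
Proof.
rewrite -sum1_card (eq_bigl (fun i : 'I_n => row i == k)); last by move=> i; rewrite inE.
by rewrite (row_sum k (fun=> 1%N)) sum1_card card_ord.
Qed.

Lemma sum_rows (f : 'I_n -> nat) :
  \sum_i f i = \sum_(k < size l) \sum_(i : 'I_n | row i == k) f i.
Proof.
pose r (i : 'I_n) : 'I_(size l) := Ordinal (row_lt i).
exact: (partition_big r predT).
Qed.

(* The sum of the column indices of the cells of the diagram s; comparing it
   replaces the dominance order on partitions. *)
Definition potential (s : seq nat) := \sum_(k < size s) 'C(nth 0 s k, 2).

Lemma sum_col : \sum_(i : 'I_n) col i = potential l.
Proof.
rewrite (sum_rows (fun i => col i)); apply: eq_bigr => k _.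
by rewrite (row_sum k id) -bin2_sum big_mkord.
Qed.

(** Column [j] meets exactly the rows longer than [j]. These numbers form the conjugate partition,
    the invariant by which shapes are compared. *)
Lemma col_count j : #|[set i : 'I_n | col i == j]| = count (fun c => j < c)%N l.
Proof.
rewrite -sum1_card (eq_bigl (fun i : 'I_n => col i == j)); last by move=> i; rewrite inE.
rewrite big_mkcond sum_rows -sum1_count [RHS](big_nth 0%N) big_mkord [RHS]big_mkcond.
apply: eq_bigr => k _; rewrite (row_sum k (fun c => if c == j then 1 else 0)%N).
case: ltnP => [lt|ge].
  by rewrite (bigD1 (Ordinal lt)) //= eqxx big1 // => i /negPf e; rewrite -val_eqE /= in e; rewrite e.
by rewrite big1 // => i _; case: eqP => // e; have := ltn_ord i; rewrite e ltnNge ge.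
Qed.

End Rows.

(** * Fillings that never put two cells of a row into one column *)

Section Match.
Variables (n : nat) (l m : seq nat) (g : 'S_n).
Hypotheses (ln : sumn l = n) (mn : sumn m = n).
Local Notation row l i := (reshape_index l i).
Local Notation col l i := (reshape_offset l i).
Hypothesis le_lm : (potential m <= potential l)%N.
Hypothesis inj_g : forall i j : 'I_n,
  row l i = row l j -> col m (g i) = col m (g j) -> i = j.

(** The new column indices are distinct along each row of [l], so row k sums to at least C(l_k, 2).
    The total is the potential of [m], at most that of [l]; hence every row sum is minimal and its
    indices stay below l_k. *)
Lemma col_bound (i : 'I_n) : (col m (g i) < nth 0 l (row l i))%N.
Proof.
pose f (i : 'I_n) := col m (g i); pose A k := [set i : 'I_n | row l i == k].
have fi k : {in A k &, injective f}.
  by move=> a b; rewrite !inE => /eqP ra /eqP rb; apply: inj_g; rewrite ra rb.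
have cA k : #|A k| = nth 0 l k by apply: card_row.
have sA k : \sum_(i in A k) f i = \sum_(i : 'I_n | row l i == k) f i.
  by apply: eq_bigl => a; rewrite inE.
have tot : (\sum_(k < size l) \sum_(i in A k) f i <= \sum_(k < size l) 'C(#|A k|, 2))%N.
  under eq_bigr => k _ do rewrite sA.
  rewrite -sum_rows // -(@reindex_inj _ _ _ _ g xpredT (fun i : 'I_n => col m i)) /=; last exact: perm_inj.
  rewrite sum_col //; apply: leq_trans le_lm _.
  by apply: leq_sum => k _; rewrite cA.
have key (k : 'I_(size l)) : (\sum_(i in A k) f i <= 'C(#|A k|, 2))%N.
  move: tot; rewrite (bigD1 k) //= [X in (_ <= X)%N](bigD1 k) //= => tot.
  have ge : (\sum_(i < size l | i != k) 'C(#|A i|, 2) <=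
             \sum_(i < size l | i != k) \sum_(i0 in A i) f i0)%N.
    by apply: leq_sum => k' _; have [] := inj_sum_ge (@fi k').
  rewrite -(leq_add2r (\sum_(i < size l | i != k) \sum_(i0 in A i) f i0)).
  by apply: leq_trans tot _; rewrite leq_add2l.
have [_ /(_ (key (Ordinal (row_lt ln i))))] := inj_sum_ge (@fi (row l i)).
by rewrite cA; apply; rewrite inE.
Qed.

(** Move each cell within its row of [l] to the column of its image under [g]; [col_bound] provides
    the target cell and [inj_g] the injectivity. *)
Lemma match_perm : exists p : 'S_n, (forall i, row l (p i) = row l i) /\
  (forall i, col l (p i) = col m (g i)).
Proof.
have [p pP] := choice (fun i => cellP ln (col_bound i)).
have pinj : injective p.
  move=> i j e; apply: inj_g; first by rewrite -(pP i).1 -(pP j).1 e.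
  by rewrite -(pP i).2 -(pP j).2 e.
by exists (perm pinj); split=> i; rewrite permE; case: (pP i).
Qed.

(** The cells in column [j] of [l] and those in column [j] of [m] are both in bijection, by [p] and
    by [g], with the cells that [g] sends to column [j] of [m]. *)
Lemma match_count j : count (fun c => j < c)%N l = count (fun c => j < c)%N m.
Proof.
have [p [_ pc]] := match_perm.
rewrite -(col_count ln) -(col_count mn).
rewrite -(card_imset _ (@perm_inj _ p^-1%g)) -[RHS](card_imset _ (@perm_inj _ g^-1%g)).
apply: eq_card => i; apply/imsetP/imsetP=> -[x]; rewrite inE => /eqP xj ->.
  exists (g (p^-1%g x)); last by rewrite permK.
  by rewrite inE -pc permKV xj.
exists (p (g^-1%g x)); last by rewrite permK.
by rewrite inE pc permKV xj.
Qed.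

End Match.

(** The multiplicity of k + 1 is the difference of the counts at k and k + 1, the part 0 is
    excluded, and a sorted list is determined by its multiplicities. *)
Lemma part_count (l m : part) :
  (forall j, count (fun c => j < c)%N l = count (fun c => j < c)%N m) -> l = m.
Proof.
move=> h; apply: val_inj.
case: l m h => l /andP[sl l0] [m /andP[sm m0]] /= h.
apply: (sorted_eq (leT := geq)) => //.
- by move=> a b c /= ab bc; apply: leq_trans bc ab.
- by move=> a b; rewrite /geq /= andbC -eqn_leq => /eqP.
have cnt (s : seq nat) k : count_mem k.+1 s = (count (fun c => k < c) s - count (fun c => k.+1 < c) s)%N.
  elim: s => //= x s ->.
  have : (count (fun c => k.+1 < c) s <= count (fun c => k < c) s)%N.
    by apply: sub_count => c /= /ltnW.
  by case: (ltngtP x k.+1) => _ le /=; rewrite ?add0n ?add1n ?subnDl ?subSS ?subSn.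
rewrite /perm_eq; apply/allP=> -[|k] _ /=; apply/eqP.
  by rewrite (count_memPn l0) (count_memPn m0).
by rewrite !cnt !h.
Qed.

(** * Young symmetrizers *)

Section YoungSymmetrizer.
Variables (F : fieldType) (n : nat).
Hypothesis charF : [pchar F] =i pred0.
Local Notation Sn := [set: 'S_n]%G.
Local Notation aG := (regular_repr F Sn).
Local Notation R_G := (group_ring F Sn).
Implicit Types (s g p q : 'S_n) (l m : seq nat).

(** Row and column stabilisers at once, inside ['S_n] for any [n], so that two shapes of the same
    size share one group. *)
Definition level_stab (h : nat -> nat) : {set 'S_n} :=
  [set s : 'S_n | [forall i : 'I_n, h (s i) == h i]].

Lemma level_stabP (h : nat -> nat) s : reflect (forall i : 'I_n, h (s i) = h i) (s \in level_stab h).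
Proof. by rewrite inE; apply: (iffP forallP) => e i; apply/eqP. Qed.

Fact level_stab_group_set (h : nat -> nat) : group_set (level_stab h).
Proof.
apply/group_setP; split=> [|s t /level_stabP sh /level_stabP th].
  by apply/level_stabP=> i; rewrite perm1.
by apply/level_stabP=> i; rewrite permM th sh.
Qed.
Canonical level_stab_group (h : nat -> nat) := Group (level_stab_group_set h).

Local Notation rst l := (level_stab (reshape_index l)).
Local Notation cst l := (level_stab (reshape_offset l)).

Definition rowsym l : 'M[F]_(gcard Sn) := \sum_(p in rst l) aG p.
Definition colsym l : 'M[F]_(gcard Sn) := \sum_(q in cst l) (-1) ^+ q *: aG q.
Definition young l : 'M[F]_(gcard Sn) := rowsym l *m colsym l.

Lemma aGM s t : aG (s * t)%g = aG s *m aG t.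
Proof. by rewrite repr_mxM ?inE. Qed.

Lemma aG_ring s : (aG s \in R_G)%MS.
Proof. by rewrite envelop_mx_id ?inE. Qed.

Lemma rowsym_ring l : (rowsym l \in R_G)%MS.
Proof. by rewrite /rowsym linear_sum summx_sub // => p _; apply: aG_ring. Qed.

Lemma colsym_ring l : (colsym l \in R_G)%MS.
Proof.
rewrite /colsym linear_sum summx_sub // => p _.
by rewrite linearZ scalemx_sub //; apply: aG_ring.
Qed.

Lemma young_ring l : (young l \in R_G)%MS.
Proof. exact: envelop_mxM (rowsym_ring l) (colsym_ring l). Qed.

Lemma rowsymM l p : p \in rst l -> rowsym l *m aG p = rowsym l.
Proof.
move=> pl; rewrite /rowsym mulmx_suml [RHS](reindex_inj (mulIg p)) /=.
by apply: eq_big => s; rewrite ?groupMr // aGM.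
Qed.

Lemma colsymM l q : q \in cst l -> aG q *m colsym l = (-1) ^+ q *: colsym l.
Proof.
move=> ql; rewrite /colsym mulmx_sumr (reindex_inj (mulgI q^-1%g)) /= scaler_sumr.
apply: eq_big => s; rewrite ?groupMl ?groupV // => _.
rewrite -scalemxAr -aGM mulKVg scalerA; congr (_ *: _).
by rewrite odd_permM odd_permV signr_addb.
Qed.

(** Von Neumann's alternative: if [g] sends two cells of a row of [l] into one column of [m], the
    product equals its own negative; if there is no such pair, [match_count] and [match_perm]
    apply. *)
Lemma matchP l m g : sumn l = n -> sumn m = n ->
  (potential m <= potential l)%N ->
  rowsym l *m aG g *m colsym m = 0 \/
  (forall j, count (fun c => j < c)%N l = count (fun c => j < c)%N m) /\
  exists p : 'S_n, (forall i : 'I_n, reshape_index l (p i) = reshape_index l i) /\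
    (forall i : 'I_n, reshape_offset l (p i) = reshape_offset m (g i)).
Proof.
move=> ln mn lm.
have [[[i j] /= [ne rij cij]]|no] := pselect (exists ij : 'I_n * 'I_n,
    [/\ ij.1 != ij.2, reshape_index l ij.1 = reshape_index l ij.2 &
        reshape_offset m (g ij.1) = reshape_offset m (g ij.2)]).
  (* t is a row permutation, t ^ g an odd column permutation. *)
  left; pose t := tperm i j.
  have tl : t \in rst l by apply/level_stabP=> k; rewrite /t; case: tpermP => [->|->|].
  have tg : (t ^ g)%g \in cst m.
    by apply/level_stabP=> k; rewrite tpermJ; case: tpermP => [->|->|].
  have e : rowsym l *m aG g *m colsym m = - (rowsym l *m aG g *m colsym m).
    rewrite -{1}(rowsymM tl) -(mulmxA (rowsym l)) -aGM conjgC aGM.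
    rewrite (mulmxA (rowsym l)) -(mulmxA _ (aG (t ^ g)%g)) colsymM //.
    by rewrite odd_permJ odd_tperm ne expr1 scaleN1r mulmxN.
  apply/eqP; move/eqP: e; rewrite -addr_eq0 -mulr2n -scaler_nat scaler_eq0.
  by rewrite ((pcharf0P _).1 charF) => /orP[].
right; have inj_g (i j : 'I_n) : reshape_index l i = reshape_index l j ->
    reshape_offset m (g i) = reshape_offset m (g j) -> i = j.
  move=> rij cij; apply/eqP/negPn/negP=> ne; apply: no.
  by exists (i, j).
split; first exact: (match_count ln mn lm inj_g).
exact: (match_perm ln mn lm inj_g).
Qed.

(** Matching [l] with itself splits g as p (p^-1 g): a row permutation absorbed by [rowsym] and a
    column permutation absorbed by [colsym] up to sign. *)
Lemma young_factor l g : sumn l = n ->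
  exists k, rowsym l *m aG g *m colsym l = k *: young l.
Proof.
move=> ln; have [->|[_ [p [pr pc]]]] := matchP g ln ln (leqnn _).
  by exists 0; rewrite scale0r.
have pl : p \in rst l by apply/level_stabP.
have ql : (p^-1 * g)%g \in cst l.
  by apply/level_stabP=> i; rewrite permM -pc permKV.
exists ((-1) ^+ (p^-1 * g)%g).
rewrite -{1}(mulKVg p g) aGM mulmxA rowsymM // -mulmxA colsymM //.
by rewrite -scalemxAr.
Qed.

Lemma gring_span (P : 'M[F]_(gcard Sn) -> Prop) : P 0 ->
  (forall A B, P A -> P B -> P (A + B)) ->
  (forall c g, P (c *: aG g)) -> forall A, (A \in R_G)%MS -> P A.
Proof. by move=> P0 PD PG A /envelop_mxP[c ->]; elim/big_ind: _. Qed.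

(** After regrouping, the middle factor colsym X rowsym lies in the group ring, and linearity
    reduces it to a single [g]. *)
Lemma youngXyoung l X : sumn l = n -> (X \in R_G)%MS ->
  exists k, young l *m X *m young l = k *: young l.
Proof.
move=> ln RX.
have -> : young l *m X *m young l =
    rowsym l *m (colsym l *m X *m rowsym l) *m colsym l by rewrite !mulmxA.
have RY : (colsym l *m X *m rowsym l \in R_G)%MS.
  by rewrite envelop_mxM ?envelop_mxM ?colsym_ring ?rowsym_ring.
move: RY; move: (_ *m rowsym l); apply: gring_span.
- by exists 0; rewrite mulmx0 mul0mx scale0r.
- move=> A B [a ea] [b eb]; exists (a + b).
  by rewrite mulmxDr mulmxDl ea eb scalerDl.
- move=> c g; have [k ek] := young_factor g ln; exists (c * k).
  by rewrite -scalemxAr -scalemxAl ek scalerA.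
Qed.

Lemma youngX0 l m X : sumn l = n -> sumn m = n ->
  (potential m <= potential l)%N ->
  ~ (forall j, count (fun c => j < c)%N l = count (fun c => j < c)%N m) ->
  (X \in R_G)%MS -> young l *m X *m young m = 0.
Proof.
move=> ln mn lm ne RX.
have -> : young l *m X *m young m =
    rowsym l *m (colsym l *m X *m rowsym m) *m colsym m by rewrite !mulmxA.
have RY : (colsym l *m X *m rowsym m \in R_G)%MS.
  by rewrite envelop_mxM ?envelop_mxM ?colsym_ring ?rowsym_ring.
move: RY; move: (_ *m rowsym m); apply: gring_span.
- by rewrite mulmx0 mul0mx.
- by move=> A B ea eb; rewrite mulmxDr mulmxDl ea eb addr0.
- move=> c g; rewrite -scalemxAr -scalemxAl.
  by have [->|[]] := matchP g ln mn lm; rewrite ?scaler0.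
Qed.

Lemma youngE l :
  young l = \sum_(p in rst l) \sum_(q in cst l) (-1) ^+ q *: aG (p * q)%g.
Proof.
rewrite /young /rowsym mulmx_suml; apply: eq_bigr => p _.
by rewrite /colsym mulmx_sumr; apply: eq_bigr => q _; rewrite aGM scalemxAr.
Qed.

Lemma row_col_stab l p : sumn l = n -> p \in rst l -> p \in cst l -> p = 1%g.
Proof.
move=> ln /level_stabP pr /level_stabP pc; apply/permP=> i; rewrite perm1.
exact: (rowcol_inj (pr i) (pc i)).
Qed.

(** The coefficient at 1 is 1: a product of a row and a column permutation is trivial only if both
    are. *)
Lemma young_neq0 l : sumn l = n -> young l != 0.
Proof.
move=> ln; apply/eqP => /(congr1 (fun A => gring_row A 0 (gring_index Sn 1%g))).
have -> : gring_row (young l) 0 (gring_index Sn 1%g) =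
   \sum_(p in rst l) \sum_(q in cst l) (-1) ^+ q * (1%g == (p * q)%g)%:R.
  rewrite youngE linear_sum summxE; apply: eq_bigr => p _.
  rewrite linear_sum summxE; apply: eq_bigr => q _.
  by rewrite linearZ mxE gring_row_aG.
rewrite linear0 mxE (bigD1 1%g) ?group1 //= (bigD1 1%g) ?group1 //=.
rewrite mulg1 eqxx odd_perm1 expr0 mulr1 big1; last first.
  by move=> q /andP[_ nq]; rewrite mul1g eq_sym (negPf nq) mulr0.
rewrite big1 ?addr0; first by move/eqP; rewrite oner_eq0.
move=> p /andP[pr np]; apply: big1 => q qc; case: eqP => [e|_]; rewrite ?mulr0 //.
case/eqP: np; apply: (row_col_stab ln pr); rewrite -groupV.
by rewrite -[p^-1%g]mulg1 e mulKg.
Qed.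

(** Kept in the shape of [polytabloid], so that [gspecht] becomes convertible to [specht] once [n]
    is [sumn l]. *)
Definition ptab l : 'rV[F]_(gcard Sn) :=
  gring_row (\sum_(p in rst l) \sum_(q in cst l) (-1) ^+ q *: aG (p * q)%g).

Lemma ptabE l : ptab l = gring_row (young l).
Proof. by rewrite youngE. Qed.

Definition gspecht l : rep F 'S_n :=
  Rep (submod_repr (cyclic_mx_module aG (ptab l))).

Lemma gspecht_irr l : sumn l = n -> mx_irreducible (gspecht l).
Proof.
move=> ln; apply/submod_mx_irr; rewrite ptabE.
apply: mxsimple_cyclic_crit; [exact: char'G|exact: young_ring|exact: young_neq0|].
by move=> X; apply: youngXyoung.
Qed.

Lemma gspecht_rsim l m : sumn l = n -> sumn m = n ->
  mx_rsim (gspecht l) (gspecht m) ->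
  forall j, count (fun c => j < c)%N l = count (fun c => j < c)%N m.
Proof.
(* Similarity is symmetric, so the order of the potentials required by [youngX0] may be assumed. *)
move=> ln mn; wlog lm : l m ln mn / (potential m <= potential l)%N.
  move=> W rs; have [le|/ltnW le] := leqP (potential m) (potential l).
    exact: W.
  by move=> j; symmetry; apply: W => //; apply: mx_rsim_sym.
move=> /mx_rsim_iso; rewrite !ptabE => iso.
apply: contrapT => ne.
apply: (cyclic_not_iso (char'G charF _) (young_ring l) (young_ring m) (young_neq0 mn)) iso.
by move=> X; apply: youngX0.
Qed.

End YoungSymmetrizer.

(** * Specht modules exhaust the irreducible representations *)

Section SpechtComplete.
Variables (F : fieldType) (n : nat).
Hypothesis charF : [pchar F] =i pred0.
Local Notation Sn := [set: 'S_n]%G.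
Hypothesis splitG : group_splitting_field F Sn.
Variable sG : irrType F Sn.

Lemma sumn_cycle_type_Sn (s : 'S_n) : sumn (cycle_type s) = n.
Proof. by rewrite sumn_cycle_type card_ord. Qed.

Lemma gspecht_inj (l m : part) : sumn l = n -> sumn m = n ->
  irr_of sG (gspecht F n l) = irr_of sG (gspecht F n m) -> l = m.
Proof.
move=> ln mn e; apply: part_count; apply: (gspecht_rsim charF ln mn).
by apply: (rsim_irr_of charF _ _ e); apply: gspecht_irr.
Qed.

(** Taking as shapes the cycle types of class representatives gives an injection from conjugacy
    classes to irreducibles, two sets of the same size, so partitions never have to be counted. *)
Lemma gspecht_complete (V : rep F 'S_n) : mx_irreducible V ->
  exists2 l : part, sumn l = n & mx_rsim V (gspecht F n l).
Proof.
move=> irrV; pose f (C : {set 'S_n}) : sG :=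
  irr_of sG (gspecht F n (cycle_type (fingroup.repr C))).
have finj : {in classes Sn &, injective f}.
  have clE (C : {set 'S_n}) : C \in classes Sn -> (fingroup.repr C ^: Sn)%g = C.
    by case/imsetP=> s _ ->; apply/class_eqP/mem_repr/class_refl.
  move=> C D /clE eC /clE eD /gspecht_inj.
  rewrite !sumn_cycle_type_Sn => /(_ erefl erefl) /cycle_type_conj[w e].
  by rewrite -eC -eD e classGidl ?inE.
have : irr_of sG V \in f @: classes Sn.
  suff -> : f @: classes Sn = [set: sG] by rewrite inE.
  apply/eqP; rewrite eqEcard subsetT cardsT card_in_imset //=.
  by rewrite -(card_sG charF splitG sG).
case/imsetP=> C _ e; exists (cycle_type (fingroup.repr C)); first exact: sumn_cycle_type_Sn.
by apply: (rsim_irr_of charF irrV _ e); apply: gspecht_irr => //; apply: sumn_cycle_type_Sn.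
Qed.

End SpechtComplete.

(** * Maps out of the Grothendieck group *)

Section GrothLift.
Variables (K : fieldType) (gT : finGroupType).

(* Well-definedness of a map out of the Grothendieck group may be tested after
   maps Psi that detect zero and depend only on characters. *)
Lemma groth_rel_lift (M N : lmodType int) (I : Type) (f : rep K gT -> M)
    (Psi : I -> M -> N) (theta : I -> (gT -> K) -> N) :
    (forall i, linear (Psi i)) -> (forall u, (forall i, Psi i u = 0) -> u = 0) ->
    (forall i g h, theta i (fun x => g x + h x) = theta i g + theta i h) ->
    (forall i V, Psi i (f V) = theta i (chi V)) ->
  forall r, groth_rel r -> plin f r = 0.
Proof.
move=> Pl P0 tD Pf r gr; apply: P0 => i.
case: gr => [V W VW|V U modU]; rewrite !raddfB /= !plinU !(linB _ _ (Pl i)) !Pf.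
  have -> : chi V = chi W by apply/functional_extensionality_dep/chi_rsim.
  by rewrite subrr.
have -> : chi V = (fun x => chi (Rep (submod_repr modU)) x +
                             chi (Rep (factmod_repr modU)) x).
  apply/functional_extensionality_dep => x.
  by rewrite /chi /= -(mxtrace_sub_fact_mod modU).
by rewrite tD -addrA -opprD subrr.
Qed.

Lemma additive_linear_zmodule (M : lmodType int) (N : zmodType) (f : M -> N) :
  (forall x y, f (x + y) = f x + f y) -> linear (f : M -> ssrint.zmodule N).
Proof. by move=> fD; apply: (@additive_linear_int M (ssrint.zmodule N) f). Qed.

End GrothLift.

(** * External tensor products of representations *)

Section ExternalProduct.
Variables (K : fieldType) (gT hT : finGroupType).
Hypothesis charK : [pchar K] =i pred0.
Hypothesis splitG : group_splitting_field K [set: gT]%G.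
Hypothesis splitH : group_splitting_field K [set: hT]%G.
Hypothesis splitGH : group_splitting_field K [set: gT * hT]%G.
Variables (sG : irrType K [set: gT]%G) (sH : irrType K [set: hT]%G).
Variable sGH : irrType K [set: gT * hT]%G.

Lemma chi_extprod (V : rep K gT) (W : rep K hT) x :
  chi (extprod V W) x = chi V x.1 * chi W x.2.
Proof. by rewrite /chi /= character.mxtrace_prod. Qed.

Definition ext_prod (u : groth K gT) (v : groth K hT) : groth K (gT * hT)%type :=
  plift (fun V => plift (fun W => gcls (extprod V W)) v) u.

(** The detecting maps are the evaluations of characters, so compatibility with exact sequences
    reduces to distributivity in [K]. *)
Lemma ext_inner_rel (V : rep K gT) r :
  groth_rel r -> plin (fun W : rep K hT => gcls (extprod V W)) r = 0.
Proof.
apply: (@groth_rel_lift _ _ _ (ssrint.zmodule K) (gT * hT)%type _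
  (fun x (u : groth K (gT * hT)%type) => gchar u x) (fun x g => chi V x.1 * g x.2)).
- by move=> x; apply: gchar_lin.
- by move=> u; apply: (gchar_eq0 charK splitGH sGH).
- by move=> x g h; apply: mulrDr.
- by move=> x W; rewrite gchar_gcls chi_extprod.
Qed.

Lemma gchar_ext_inner (V : rep K gT) (v : groth K hT) x :
  gchar (plift (fun W => gcls (extprod V W)) v) x = chi V x.1 * gchar v x.2.
Proof.
move: v; apply: (@pmod_ext _ _ _ (ssrint.zmodule K)).
- by apply: lin_comp (gchar_lin x) (plift_lin (@ext_inner_rel V)).
- apply: additive_linear_zmodule => a b; rewrite gcharD; exact: mulrDr.
- move=> W; rewrite (plift_gen (@ext_inner_rel V)) -/(gcls W) !gchar_gcls.
  exact: chi_extprod.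
Qed.

Lemma ext_outer_rel (v : groth K hT) r : groth_rel r ->
  plin (fun V : rep K gT => plift (fun W : rep K hT => gcls (extprod V W)) v) r = 0.
Proof.
apply: (@groth_rel_lift _ _ _ (ssrint.zmodule K) (gT * hT)%type _
  (fun x (u : groth K (gT * hT)%type) => gchar u x) (fun x g => g x.1 * gchar v x.2)).
- by move=> x; apply: gchar_lin.
- by move=> u; apply: (gchar_eq0 charK splitGH sGH).
- by move=> x g h; apply: mulrDl.
- by move=> x W; rewrite gchar_ext_inner.
Qed.

Lemma ext_bilin : bilin ext_prod.
Proof.
split=> [v|u]; first exact: plift_lin (@ext_outer_rel v).
by apply: plift_linl => V; apply: plift_lin (@ext_inner_rel V).
Qed.

Lemma extmap_lin : linear (@extmap K gT hT).
Proof. exact: tlift_lin ext_bilin. Qed.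

Lemma extmap_gcls (V : rep K gT) (W : rep K hT) :
  extmap (gcls V ⊗ gcls W) = gcls (extprod V W).
Proof.
rewrite [LHS](tlift_tmul ext_bilin) /ext_prod.
by rewrite (plift_gen (@ext_outer_rel _)) (plift_gen (@ext_inner_rel V)).
Qed.

Lemma cdot_extprod (V V' : rep K gT) (W W' : rep K hT) :
  cdot (chi (extprod V W)) (chi (extprod V' W')) =
  cdot (chi V) (chi V') * cdot (chi W) (chi W').
Proof.
rewrite /cdot mulrACA !cardsT card_prod natrM invfM; congr (_ * _).
rewrite mulr_suml; under [RHS]eq_bigr => x _ do rewrite mulr_sumr.
rewrite pair_bigA /=; apply: eq_bigr => -[x y] _.
by rewrite !chi_extprod /= mulrACA.
Qed.

(** It suffices to reach the irreducibles. One that pairs nontrivially with an external product of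
    irreducibles is isomorphic to it; one orthogonal to all of them would have zero character, yet
    its value at 1 is its degree. *)
Lemma extmap_surj (w : groth K (gT * hT)%type) : exists t, extmap t = w.
Proof.
suff h (i : sGH) : exists t, extmap t = gcls (irr i).
  have [c ->] := groth_span charK sGH w; have [t tP] := choice h.
  exists (\sum_i c i *: t i); rewrite (lin_sum _ _ extmap_lin).
  by apply: eq_bigr => i _; rewrite (linZ _ _ extmap_lin) tP.
have [[a [b ab]]|no] := pselect (exists (a : sG) (b : sH),
    cdot (chi (irr i)) (chi (extprod (irr a) (irr b))) != 0).
  exists (gcls (irr a) ⊗ gcls (irr b)); rewrite extmap_gcls.
  have irrab : mx_irreducible (extprod (irr a) (irr b)).
    apply: (norm1_irreducible charK splitGH sGH).
    by rewrite cdot_extprod !irr_orthonormal // !eqxx mulr1.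
  symmetry; apply: gcls_rsim; apply: (rsim_irr_of charK (irr_irr i) irrab).
  move: ab; rewrite (@irr_cdot _ charK _ splitGH sGH _ _ (irr_irr i) irrab).
  case: (irr_of sGH (irr i) =P _) => [e _|_]; first exact: e.
  by rewrite eqxx.
have h (a : sG) (b : sH) : cdot (chi (irr i)) (chi (extprod (irr a) (irr b))) = 0.
  by apply/eqP/negPn/negP=> ne; apply: no; exists a, b.
have sum0 (a : sG) (b : sH) : \sum_x \sum_y chi (irr i) (x^-1, y^-1)%g * chi (irr a) x * chi (irr b) y = 0.
  have := h a b; rewrite /cdot => /eqP.
  rewrite mulf_eq0 invr_eq0 (negPf (cardG_neq0 charK _)) /= => /eqP e; rewrite -[RHS]e.
  rewrite pair_bigA /=; apply: eq_bigr => -[x y] _ /=.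
  by rewrite chi_extprod /= mulrA.
(* Orthogonality is undone one factor at a time: for fixed [b] the sum over y is a class function of
   x, and [z2] then treats y. *)
have z1 (b : sH) x : \sum_y chi (irr i) (x, y^-1)%g * chi (irr b) y = 0.
  pose f x := \sum_y chi (irr i) (x, y^-1)%g * chi (irr b) y.
  apply: (@class_fun_eq0 _ charK _ splitG sG f) => [{}x z|a].
    apply: eq_bigr => y _; apply: (congr1 (fun c : K => c * _)).
    rewrite -{1}(conjg1 y^-1%g); exact: (chiJ (irr i) (x, y^-1)%g (z, 1%g)).
  rewrite -[RHS](sum0 a b); apply: eq_bigr => y _.
  rewrite /f mulr_suml; apply: eq_bigr => z _; exact: mulrAC.
have z2 x y : chi (irr i) (x, y) = 0.
  pose f y := chi (irr i) (x, y).
  apply: (@class_fun_eq0 _ charK _ splitH sH f) => [{}y z|b].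
    by rewrite /f -{1}(conjg1 x); apply: (chiJ (irr i) (x, y) (1%g, z)).
  exact: z1.
have := z2 1%g 1%g; rewrite -[(1, 1)%g]/(1%g : gT * hT) chi1 => /eqP.
by rewrite (negPf (irr_degree_neq0 charK _)).
Qed.

End ExternalProduct.

(** * Characters of induced representations *)

Section InducedChar.
Variables (K : fieldType) (hT gT : finGroupType) (h : hT -> gT).
Hypothesis charK : [pchar K] =i pred0.
Hypothesis hM : {morph h : x y / (x * y)%g}.
Hypothesis h_inj : injective h.

(** Only diagonal blocks contribute: a coset with representative r counts through the at most one x
    with h x = r g r^-1. *)
Lemma chi_induced (V : rep K hT) g : chi (induced hM h_inj V) g =
  \sum_(C : hcoset h)
    \sum_(x | (h x * fingroup.repr (val C) == fingroup.repr (val C) * g)%g) chi V x.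
Proof.
rewrite /chi /mxtrace /=.
under eq_bigr => i _ do rewrite mxE.
rewrite -(reindex (@enum_val _ {: ind_index h V}) (P := predT) (F := fun p : ind_index h V => \sum_(x | (h x * fingroup.repr (val p.1) == fingroup.repr (val p.1) * g)%g) V x p.2 p.2)) /=.
  rewrite -(pair_bigA _ (fun (C : hcoset h) k => \sum_(x | (h x * fingroup.repr (val C) == fingroup.repr (val C) * g)%g) V x k k)) /=.
  by apply: eq_bigr => C _; rewrite exchange_big.
exact/onW_bij/enum_val_bij.
Qed.

Lemma card_hcoset : (#|{: hcoset h}| * #|[set: hT]|)%N = #|[set: gT]|.
Proof.
rewrite card_sig; have := LagrangeI [set: gT]%G (Group (himage_group hM)).
rewrite setTI /= card_imset // mulnC => <-; congr (_ * _)%N.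
Qed.

(** A form of Frobenius reciprocity. Every coset contributes the same sum, since f(r^-1 h(x) r) =
    f(h x), and the number of cosets turns one group order into the other. *)
Lemma induced_sum (M : lmodType K) (V : rep K hT) (f : gT -> M) :
    (forall x y, f (x ^ y)%g = f x) ->
  #|[set: gT]|%:R^-1 *: \sum_g chi (induced hM h_inj V) g^-1%g *: f g =
  #|[set: hT]|%:R^-1 *: \sum_x chi V x^-1%g *: f (h x).
Proof.
move=> fJ.
have hV x : h x^-1%g = (h x)^-1%g.
  apply: (mulgI (h x)); rewrite -hM !mulgV.
  by apply: (mulgI (h 1%g)); rewrite -hM !mulg1.
have -> : \sum_g chi (induced hM h_inj V) g^-1%g *: f g =
    \sum_(C : hcoset h) \sum_x chi V x^-1%g *: f (h x).
  under eq_bigr => g _ do rewrite chi_induced scaler_suml.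
  rewrite exchange_big /=; apply: eq_bigr => C _.
  set r := fingroup.repr (val C).
  under eq_bigr => g _ do rewrite scaler_suml big_mkcond.
  rewrite exchange_big /= (reindex_inj invg_inj) /=; apply: eq_bigr => x _.
  rewrite -big_mkcond (big_pred1 (r^-1 * (h x * r))%g); first by rewrite -conjgE fJ.
  move=> g /=; rewrite hV; apply/eqP/eqP=> [e|->].
    by apply: invg_inj; rewrite !invMg invgK -mulgA e mulKg.
  by rewrite !invMg invgK !mulgA mulgV mul1g.
rewrite sumr_const -scaler_nat scalerA -card_hcoset natrM invfM mulrAC.
rewrite mulVf ?mul1r //.
rewrite natK_eq0 // -lt0n; have := cardG_gt0 [set: gT]%G.
by rewrite -card_hcoset muln_gt0 => /andP[].
Qed.

End InducedChar.

(** * Bilinearity of the form on K[X] *)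

Section FormX.
Variable K : fieldType.
Local Notation KX := (KX K).

Let W n (s t : 'S_n) : K^o :=
  if t \in (s ^: [set: 'S_n])%g then #|'C[s]%g|%:R else 0.

Let Wr n (s t u : 'S_n) : W s (t ^ u)%g = W s t.
Proof.
congr (if _ then _ else _); apply/idP/idP=> /imsetP[v _ e].
  by rewrite -(conjgK u t) e -conjgM imset_f ?inE.
by rewrite e -conjgM imset_f ?inE.
Qed.

Let Wl n (s t u : 'S_n) : W (s ^ u)%g t = W s t.
Proof. by rewrite /W classGidl ?inE // cent1J cardJg. Qed.

Let Wr_rel n (s : 'S_n) r : coinv_rel r -> plin (W s) r = 0.
Proof. by case=> u w; rewrite raddfB /= !plinU Wr subrr. Qed.

Let Wl_rel n (v : KXn K n) r :
  coinv_rel r -> plin (fun s => plift (W s) v) r = 0.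
Proof.
case=> u w; rewrite raddfB /= !plinU /plift /plin -sumrB big1 // => z _.
by rewrite -scalerBr Wl subrr scaler0.
Qed.

Lemma formX_bilin : bilin (@formX K : KX -> KX -> K^o).
Proof.
split=> [y|x].
- apply: dlift_lin => n; exact: plift_lin (@Wl_rel n _).
- apply: (@dlift_linl _ _ KX K^o (fun y n u => plift (fun s => plift (W s) (y n)) u)).
  move=> n u; apply: (@plift_linl K _ _ KX K^o (fun y s => plift (W s) (y n))) => s.
  exact: (@lin_comp _ _ _ _ (plift (W s)) (fun y : KX => y n) (plift_lin (@Wr_rel n s))).
Qed.

Lemma formX_cls_neq m n (s : 'S_m) (t : 'S_n) : m != n -> formX (cls K s) (cls K t) = 0.
Proof.
move=> mn; rewrite /formX /cls.
rewrite dlift_din; last by move=> k; apply: plift0 (@Wl_rel k _).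
rewrite (plift_gen (@Wl_rel m _)) din_neq 1?eq_sym //.
exact: plift0 (@Wr_rel m s).
Qed.

End FormX.

Section Collect.
Variables (R : nzRingType) (V : lmodType R) (I : eqType) (b : I -> V).

(** Spanning lists may repeat an index, while reading off coefficients needs a sum without
    repetitions. *)
Lemma collect (s : seq (R * I)) : exists c : I -> R,
  \sum_(p <- s) p.1 *: b p.2 = \sum_(i <- undup (unzip2 s)) c i *: b i.
Proof.
exists (fun i => \sum_(p <- s | p.2 == i) p.1).
under [RHS]eq_bigr => i _ do rewrite scaler_suml big_mkcond.
rewrite exchange_big /=; apply: eq_big_seq => p ps.
rewrite (bigD1_seq p.2) ?undup_uniq //=; last by rewrite mem_undup map_f.
by rewrite eqxx big1 ?addr0 // => i /negPf; rewrite eq_sym => ->.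
Qed.

End Collect.

(** * The Frobenius characteristic *)

Section Frobenius.
Variable K : fieldType.
Hypothesis charK : [pchar K] =i pred0.
Hypothesis splitK : forall gT : finGroupType, group_splitting_field K [set: gT]%G.
Variable sG : forall gT : finGroupType, irrType K [set: gT]%G.
Local Notation KX := (KX K).
Local Notation RS := (RS K).
Local Notation TX := (TX K).
Local Notation TR := (tens RS RS).
Local Notation cls := (@cls K).
Local Notation zmod := ssrint.zmodule.

(** The difference of [f] and its projection is orthogonal to all irreducible characters, hence
    0. *)
Lemma class_fun_span (gT : finGroupType) (f : gT -> K) :
  (forall x y, f (x ^ y)%g = f x) ->
  exists c : sG gT -> K, forall x, f x = \sum_i c i * chi (irr i) x.
Proof.
move=> fJ; pose c (i : sG gT) := cdot f (chi (irr i)); exists c => x.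
apply/eqP; rewrite -subr_eq0; apply/eqP; move: x.
apply: (@class_fun_eq0 _ charK _ (@splitK _) (sG gT)
  (fun x => f x - \sum_i c i * chi (irr i) x)) => [x y|j].
  by rewrite fJ; congr (_ - _); apply: eq_bigr => i _; rewrite chiJ.
apply: (mulfI (invr_neq0 (cardG_neq0 charK gT))); rewrite mulr0.
transitivity (cdot (fun x => f x - \sum_i c i * chi (irr i) x) (chi (irr j))).
  by [].
rewrite (@eq_cdot _ _ _ (fun x => f x + \sum_i - c i * chi (irr i) x) _ (chi (irr j))) //; last first.
  by move=> x; rewrite -sumrN; congr (_ + _); apply: eq_bigr => i _; rewrite mulNr.
rewrite cdotDl cdot_suml (bigD1 j) //= irr_orthonormal // eqxx mulr1.
rewrite big1 ?addr0 ?subrr // => i ne.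
by rewrite irr_orthonormal // (negPf ne) mulr0.
Qed.

Lemma RS_ext (P : lmodType int) (f g : RS -> P) : linear f -> linear g ->
  (forall n (V : rep K 'S_n), f (rcls V) = g (rcls V)) -> f =1 g.
Proof.
move=> fl gl fg; apply: dsum_ext => // n v.
by apply: (@pmod_ext _ _ _ _ (f \o @din _ _ n) (g \o @din _ _ n));
  first exact: lin_comp fl (@din_lin _ _ n);
  first exact: lin_comp gl (@din_lin _ _ n); move=> s; apply: fg.
Qed.

(** The inverse fits the coefficients of the central idempotents; as s and s^-1 are conjugate,
    dropping it would give the same element. *)
Definition chf n (g : 'S_n -> K) : KX :=
  #|[set: 'S_n]|%:R^-1 *: \sum_s g s^-1%g *: cls s.

Lemma chfD n (g h : 'S_n -> K) : chf (fun x => g x + h x) = chf g + chf h.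
Proof.
rewrite /chf -scalerDr -big_split; congr (_ *: _).
by apply: eq_bigr => s _; rewrite scalerDl.
Qed.

Lemma eq_chf n (g h : 'S_n -> K) : g =1 h -> chf g = chf h.
Proof. by move=> gh; congr (_ *: _); apply: eq_bigr => s _; rewrite gh. Qed.

Definition ch (x : RS) : KX :=
  dlift (V := RSn K) (fun n u => chf (gchar u) : zmod KX) x.

Lemma chf_gchar_lin n : linear (fun u : RSn K n => chf (gchar u) : zmod KX).
Proof.
apply: additive_linear_zmodule => u v; rewrite -chfD; apply: eq_chf => x; exact: gcharD.
Qed.

Lemma ch_lin : linear (ch : RS -> zmod KX).
Proof. by apply: dlift_lin => n; apply: chf_gchar_lin. Qed.

Lemma ch_din n (u : RSn K n) : ch (din u) = chf (gchar u).
Proof.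
rewrite /ch dlift_din //; move=> m; exact: lin0 (@chf_gchar_lin m).
Qed.

Lemma ch_rcls n (V : rep K 'S_n) : ch (rcls V) = chf (chi V).
Proof. by rewrite /rcls ch_din; apply: eq_chf => x; apply: gchar_gcls. Qed.

Lemma chD x y : ch (x + y) = ch x + ch y.
Proof. exact: linD ch_lin. Qed.

Lemma chZ (c : int) x : ch (c *: x) = ch x *~ c.
Proof. exact: (linZ _ _ ch_lin). Qed.

Let fl y := (@formX_bilin K).1 y.
Let fr x := (@formX_bilin K).2 x.

(** For fixed s only its n! / |C(s)| conjugates contribute, each with h(s) |C(s)|; the resulting n!
    cancels one of the two normalising factors. *)
Lemma formX_chf n (g h : 'S_n -> K) : (forall x y, h (x ^ y)%g = h x) ->
  formX (chf g) (chf h) = cdot g h.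
Proof.
move=> hJ; rewrite /chf (linZ _ _ (fl _)) (lin_sum _ _ (fl _)) /cdot.
congr (_ * _); apply: eq_bigr => s _; rewrite (linZ _ _ (fl _)).
rewrite (linZ _ _ (fr _)) (lin_sum _ _ (fr _)); congr (_ * _).
have hV t : h t^-1%g = h t by have [w ->] := conjgV t; rewrite hJ.
have -> : \sum_t formX (cls s) (h t^-1%g *: cls t) =
   \sum_(t in (s ^: [set: 'S_n])%g) h s * #|'C[s]%g|%:R.
  rewrite [RHS]big_mkcond; apply: eq_bigr => t _.
  rewrite (linZ _ _ (fr _)) formX_cls hV [LHS]/GRing.scale /=.
  case: ifP => [/imsetP[w _ ->]|_]; by [rewrite hJ|rewrite mulr0].
have e : h s * #|'C[s]%g|%:R *+ #|(s ^: [set: 'S_n])%g| =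
    h s * #|[set: 'S_n]|%:R :> K.
  rewrite -[LHS]mulr_natr -mulrA -natrM; congr (_ * _%:R).
  by rewrite -index_cent1 -(Lagrange (subsetIl [set: 'S_n]%G 'C[s]%g)) /= setTI.
rewrite sumr_const [X in _ *: X]e [LHS]mulrCA mulVf ?mulr1 //.
exact: cardG_neq0.
Qed.

Lemma formX_chf_neq m n (g : 'S_m -> K) (h : 'S_n -> K) : m != n ->
  formX (chf g) (chf h) = 0.
Proof.
move=> mn; rewrite /chf (linZ _ _ (fl _)) (lin_sum _ _ (fl _)).
rewrite big1 ?scaler0 // => s _; rewrite (linZ _ _ (fl _)).
rewrite (linZ _ _ (fr _)) (lin_sum _ _ (fr _)) big1 ?scaler0 // => t _.
by rewrite (linZ _ _ (fr _)) formX_cls_neq ?scaler0.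
Qed.

(** With [V] irreducible this recovers a coefficient of the n-th component of [x] from [ch x], which
    makes [ch] injective. *)
Lemma formX_ch n (x : RS) (V : rep K 'S_n) :
  formX (ch x) (ch (rcls V)) = cdot (gchar (x n)) (chi V).
Proof.
move: x; apply: (@RS_ext (zmod K)).
- apply: additive_linear_zmodule => a b; rewrite chD; exact: linD (fl _).
- apply: additive_linear_zmodule => a b; rewrite -cdotDl; apply: eq_cdot => // x /=.
  by rewrite -gcharD.
move=> m W; rewrite !ch_rcls; have [emn|mn] := eqVneq m n.
  case: n / emn V => V; rewrite formX_chf; last by move=> x y; rewrite chiJ.
  apply: eq_cdot => // x; rewrite /rcls din_id; apply/esym/gchar_gcls.
rewrite formX_chf_neq // /cdot big1 ?mulr0 // => x _; rewrite /rcls din_neq //.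
by rewrite [gchar 0 _](lin0 (gchar_lin _)) mul0r.
Qed.

Lemma ch_eq0 x : ch x = 0 -> x = 0.
Proof.
move=> x0; apply: dsumP => n; apply: (gchar_eq0 charK (@splitK _) (sG _)).
have [c xc] := groth_span charK (sG _) (x n).
suff c0 i : c i = 0.
  move=> s; rewrite [dval x n]xc big1 ?[gchar 0 _](lin0 (gchar_lin _)) // => i _.
  by rewrite c0; apply: scale0r.
apply: (intK_inj charK); rewrite mulr0z.
have := formX_ch x (irr i); rewrite x0 (lin0 (fl _)) => /esym.
rewrite (@eq_cdot _ _ _ (fun s => \sum_j (c j)%:~R * chi (irr j) s) _ (chi (irr i))) //; last first.
  by move=> s; rewrite xc gchar_sum; apply: eq_bigr => j _; rewrite gcharZ gchar_gcls.
rewrite cdot_suml (bigD1 i) //= irr_orthonormal // eqxx mulr1 big1 ?addr0 // => j ne.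
by rewrite irr_orthonormal // (negPf ne) mulr0.
Qed.

Lemma ch_inj : injective ch.
Proof.
move=> x y e; apply/eqP; rewrite -subr_eq0; apply/eqP/ch_eq0.
by rewrite [ch (x - y)](linB _ _ ch_lin) e; apply: subrr.
Qed.

Definition specht_class (l : part) : RS := rcls (specht K l).

Lemma rcls_gspecht n (l : part) : sumn l = n -> rcls (gspecht K n l) = specht_class l.
Proof. by move=> ln; case: n / ln. Qed.

Lemma specht_irr (l : part) : mx_irreducible (specht K l).
Proof. exact: (gspecht_irr charK (erefl (sumn l))). Qed.

Lemma irr_specht n (V : rep K 'S_n) : mx_irreducible V ->
  exists l : part, rcls V = specht_class l.
Proof.
move=> iV; have [l ln Vl] := gspecht_complete charK (@splitK _) (sG _) iV.
by exists l; rewrite -(rcls_gspecht ln) /rcls (gcls_rsim Vl).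
Qed.

Lemma RS_span x : exists s : seq (int * part), x = \sum_(p <- s) p.1 *: specht_class p.2.
Proof.
have [t ->] := dsum_span x; elim: t => [|[n u] t [s IHs]].
  by exists [::]; rewrite !big_nil.
rewrite big_cons IHs /=; have [c ->] := groth_span charK (sG _) u.
have [l lE] := choice (fun i : sG 'S_n => irr_specht (@irr_irr _ _ (sG _) i)).
exists ([seq (c i, l i) | i <- index_enum (sG 'S_n)] ++ s).
rewrite big_cat big_map /=; congr (_ + _).
rewrite (lin_sum _ _ (@din_lin _ _ n)); apply: eq_bigr => i _.
by rewrite (linZ _ _ (@din_lin _ _ n)) -lE.
Qed.

(** Shapes of equal size still live in the different types ['S_(sumn l)] and ['S_(sumn m)];
    [gspecht] places both in one group. *)
Lemma formX_specht_class l m : formX (ch (specht_class l)) (ch (specht_class m)) = (l == m)%:R.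
Proof.
have [elm|nlm] := eqVneq (sumn l) (sumn m); last first.
  rewrite /specht_class !ch_rcls formX_chf_neq //; case: eqP => // e.
  by rewrite e eqxx in nlm.
rewrite -(rcls_gspecht (erefl (sumn l))) -(rcls_gspecht (esym elm)).
have il := gspecht_irr charK (erefl (sumn l)).
have im := gspecht_irr charK (esym elm).
rewrite !ch_rcls formX_chf; last by move=> x y; rewrite chiJ.
rewrite (@irr_cdot _ charK _ (@splitK _) (sG _) _ _ il im).
suff -> : (irr_of (sG _) (gspecht K (sumn l) l) ==
  irr_of (sG _) (gspecht K (sumn l) m)) = (l == m) by [].
apply/eqP/eqP => [|->]; last by [].
exact: (gspecht_inj charK (erefl (sumn l)) (esym elm)).
Qed.

Lemma cls_span n (t : 'S_n) : exists s : seq (K * part),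
  cls t = \sum_(p <- s) p.1 *: ch (specht_class p.2).
Proof.
(* The weight |C(t)| makes the normalised sum over the conjugacy class of [t] equal to [cls t]. *)
pose d (s : 'S_n) : K := if s \in (t ^: [set: 'S_n])%g then #|'C[t]%g|%:R else 0.
have dJ x y : d (x ^ y)%g = d x.
  congr (if _ then _ else _); apply/idP/idP=> /imsetP[v _ e].
    by rewrite -(conjgK y x) e -conjgM imset_f ?inE.
  by rewrite e -conjgM imset_f ?inE.
have dV x : d x^-1%g = d x by have [w ->] := conjgV x; rewrite dJ.
have [c dc] := class_fun_span dJ.
have [l lE] := choice (fun i : sG 'S_n => irr_specht (@irr_irr _ _ (sG _) i)).
exists [seq (c i, l i) | i <- index_enum (sG 'S_n)]; rewrite big_map /=.
have -> : cls t = chf d.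
  rewrite /chf (eq_bigr (fun s => d s *: cls s)) => [|s _]; last by rewrite dV.
  have -> : \sum_s d s *: cls s = \sum_(s in (t ^: [set: 'S_n])%g) #|'C[t]%g|%:R *: cls t.
    rewrite [RHS]big_mkcond; apply: eq_bigr => s _; rewrite /d.
    by case: ifP => [/imsetP[w _ ->]|_]; [rewrite clsJ|rewrite scale0r].
  rewrite sumr_const -scaler_nat !scalerA -natrM.
  have -> : (#|(t ^: [set: 'S_n])%g| * #|'C[t]%g|)%N = #|[set: 'S_n]|.
    by rewrite mulnC -index_cent1 -(Lagrange (subsetIl [set: 'S_n]%G 'C[t]%g)) /= setTI.
  by rewrite mulVf ?scale1r // cardG_neq0.
under [RHS]eq_bigr => i _ do rewrite -lE ch_rcls.
rewrite (eq_chf dc) /chf; under [RHS]eq_bigr => i _ do rewrite scalerA mulrC -scalerA scaler_sumr.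
rewrite -scaler_sumr exchange_big /=; congr (_ *: _); apply: eq_bigr => s _.
by rewrite scaler_suml; apply: eq_bigr => i _; rewrite scalerA.
Qed.

Lemma KX_span (x : KX) : exists s : seq (K * part),
  x = \sum_(p <- s) p.1 *: ch (specht_class p.2).
Proof.
have [t ->] := dsum_span x; elim: t => [|[n u] t [s IHs]].
  by exists [::]; rewrite !big_nil.
rewrite big_cons IHs /=; have [r ->] := pmod_span u.
have [r' ->] : exists r' : seq (K * part),
    din (\sum_(p <- r) p.1 *: pgen (@coinv_rel K n) p.2) =
    \sum_(p <- r') p.1 *: ch (specht_class p.2).
  rewrite (lin_sum _ _ (@din_lin _ _ n)).
  elim: r => [|p r [r' rE]]; first by exists [::]; rewrite !big_nil.
  have [q qE] := cls_span p.2.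
  exists ([seq (p.1 * z.1, z.2) | z <- q] ++ r').
  rewrite big_cons rE big_cat big_map /=; congr (_ + _).
  rewrite (linZ _ _ (@din_lin _ _ n)) -/(cls p.2) qE scaler_sumr.
  by apply: eq_bigr => z _; rewrite scalerA.
by exists (r' ++ s); rewrite big_cat.
Qed.

Lemma specht_class_coef (s : seq part) (c : part -> K) l : uniq s ->
  formX (\sum_(i <- s) c i *: ch (specht_class i)) (ch (specht_class l)) = if l \in s then c l else 0.
Proof.
move=> us; rewrite (lin_sum _ _ (fl _)).
under eq_bigr => i _ do rewrite (linZ _ _ (fl _)) formX_specht_class.
case: ifP => [ls|ls].
  rewrite (bigD1_seq l) //= eqxx [X in X + _]mulr1 big1 ?addr0 // => i /negPf ->.
  exact: mulr0.
rewrite big_seq big1 // => i si; case: eqP => [e|_]; last exact: mulr0.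
by rewrite -e si in ls.
Qed.

Lemma specht_class_basis : is_basis (fun l => ch (specht_class l)).
Proof.
split=> [s c us e l ls|x].
  have := specht_class_coef c l us; rewrite ls e => <-; exact: lin0 (fl _).
have [s ->] := KX_span x; have [c ->] := collect (fun l => ch (specht_class l)) s.
by exists (undup (unzip2 s)), c.
Qed.

Definition chT : TR -> zmod TX := tlift (fun x y => ch x ⊗ ch y : zmod TX).

Lemma chT_bilin : bilin (fun x y : RS => ch x ⊗ ch y : zmod TX).
Proof.
split=> [y|x]; apply: additive_linear_zmodule => a b; first by rewrite chD tmulDl.
by rewrite chD tmulDr.
Qed.

Lemma chT_lin : linear chT.
Proof. exact: tlift_lin chT_bilin. Qed.

Lemma chT_tmul x y : chT (x ⊗ y) = ch x ⊗ ch y.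
Proof. exact: tlift_tmul chT_bilin x y. Qed.

(** The functional dual to the pair (l, m); it reads coefficients off a tensor product known only by
    its presentation. *)
Definition coefT (l m : part) : TX -> K^o :=
  tlift (fun x y : KX => formX x (ch (specht_class l)) * formX y (ch (specht_class m)) : K^o).

Lemma coefT_bilin (l m : part) : bilin (fun x y : KX =>
  formX x (ch (specht_class l)) * formX y (ch (specht_class m)) : K^o).
Proof.
split=> z a x y; rewrite (linD _ _ (fl _)) (linZ _ _ (fl _)).
  by rewrite mulrDl; congr (_ + _); apply/esym/mulrA.
by rewrite mulrDr; congr (_ + _); apply: mulrCA.
Qed.

(** The source is a tensor product over the integers, the target one over [K]. Each element of the
    source is an integral combination of pairs of Specht classes, and [coefT] recovers its
    coefficients inside [K]. *)
Lemma chT_eq0 t : chT t = 0 -> t = 0.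
Proof.
have [s ts] : exists s : seq (int * (part * part)),
    t = \sum_(p <- s) p.1 *: (specht_class p.2.1 ⊗ specht_class p.2.2).
  have [r ->] := tens_span t; elim: r => [|[x y] r [s sE]].
    by exists [::]; rewrite !big_nil.
  have [[u ->] [v ->]] := (RS_span x, RS_span y).
  exists ([seq (p.1 * q.1, (p.2, q.2)) | p <- u, q <- v] ++ s).
  rewrite big_cons sE big_cat /= big_allpairs_dep /=; congr (_ + _).
  rewrite (lin_sum _ _ ((@tmul_bilin _ _ _).1 _)); apply: eq_bigr => p _.
  rewrite (lin_sum _ _ ((@tmul_bilin _ _ _).2 _)); apply: eq_bigr => q _.
  by rewrite tmulZl tmulZr scalerA.
have [c] := collect (fun lm : part * part => specht_class lm.1 ⊗ specht_class lm.2) s.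
rewrite -ts => tc t0; rewrite tc big_seq big1 // => lm lms.
suff -> : c lm = 0 by apply: scale0r.
apply: (intK_inj charK); rewrite mulr0z.
have cl : linear (coefT lm.1 lm.2) := tlift_lin (coefT_bilin lm.1 lm.2).
have := congr1 (coefT lm.1 lm.2) t0; rewrite [RHS](lin0 cl) => <-.
have -> : chT t = \sum_(i <- undup (unzip2 s))
    ((c i)%:~R : K) *: (ch (specht_class i.1) ⊗ ch (specht_class i.2) : TX).
  rewrite tc (lin_sum _ _ chT_lin); apply: eq_bigr => i _.
  by rewrite (linZ _ _ chT_lin) chT_tmul scaler_int.
rewrite (lin_sum _ _ cl) (bigD1_seq lm) ?undup_uniq //= big1 => [|i /negPf ne].
  rewrite (linZ _ _ cl) [coefT _ _ _](tlift_tmul (coefT_bilin _ _)).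
  by rewrite !formX_specht_class !eqxx mulr1 addr0 [RHS]mulr1.
rewrite (linZ _ _ cl) [coefT _ _ _](tlift_tmul (coefT_bilin _ _)).
rewrite !formX_specht_class -natrM mulnb -[_ && _]/(i == (lm.1, lm.2)) -surjective_pairing.
by rewrite ne; apply: mulr0.
Qed.

Lemma chT_inj : injective chT.
Proof.
move=> x y e; apply/eqP; rewrite -subr_eq0; apply/eqP/chT_eq0.
by rewrite (linB _ _ chT_lin) e subrr.
Qed.

Lemma din_tmul_bilin a b : bilin (fun (u : RSn K a) (v : RSn K b) =>
  (din u : RS) ⊗ (din v : RS)).
Proof.
split=> z; first exact: (lin_comp ((@tmul_bilin _ _ _).1 _) (@din_lin _ _ a)).
exact: (lin_comp ((@tmul_bilin _ _ _).2 _) (@din_lin _ _ b)).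
Qed.

(** The characteristic for the group S_a x S_b; it makes sense before a restriction has been written
    as a sum of tensors. *)
Definition chf2 a b (g : 'S_a * 'S_b -> K) : TX :=
  (a`! * b`!)%:R^-1 *:
    \sum_(p : 'S_a * 'S_b) g p^-1%g *: (cls p.1 ⊗ cls p.2 : TX).

Lemma chf2D a b (g h : 'S_a * 'S_b -> K) :
  chf2 (fun x => g x + h x) = chf2 g + chf2 h.
Proof.
rewrite /chf2 -scalerDr -big_split; congr (_ *: _).
by apply: eq_bigr => s _; rewrite scalerDl.
Qed.

Lemma eq_chf2 a b (g h : 'S_a * 'S_b -> K) : g =1 h -> chf2 g = chf2 h.
Proof. by move=> gh; congr (_ *: _); apply: eq_bigr => s _; rewrite gh. Qed.

Lemma card_Sym n : #|[set: 'S_n]| = n`!.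
Proof. by rewrite cardsT card_Sn. Qed.

Lemma chf2_tmul a b (g : 'S_a -> K) (h : 'S_b -> K) :
  chf2 (fun p => g p.1 * h p.2) = chf g ⊗ chf h.
Proof.
rewrite /chf2 /chf !card_Sym tmulZl tmulZr scalerA natrM invfM; congr (_ *: _).
rewrite (lin_sum _ _ ((@tmul_bilin _ _ _).1 _)).
under [RHS]eq_bigr => s _ do rewrite (lin_sum _ _ ((@tmul_bilin _ _ _).2 _)).
rewrite pair_bigA; apply: eq_bigr => -[s t] _ /=.
by rewrite tmulZl tmulZr scalerA.
Qed.

Let extl a b := extmap_lin charK (@splitK _) (sG ('S_a * 'S_b)%type).

Lemma chf2_gchar_lin a b :
  linear (fun w : groth K ('S_a * 'S_b)%type => chf2 (gchar w) : zmod TX).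
Proof.
apply: additive_linear_zmodule => u v; rewrite -chf2D; apply: eq_chf2 => x; exact: gcharD.
Qed.

(** The value depends on [t] only through a character of the product group, so every preimage of a
    restriction under [extmap] gives the same result. *)
Lemma chT_extmap a b (t : tens (RSn K a) (RSn K b)) :
  chT (tlift (fun u v => (din u : RS) ⊗ (din v : RS)) t) = chf2 (gchar (extmap t)).
Proof.
have dl := tlift_lin (@din_tmul_bilin a b).
move: t; apply: (@tens_ext _ _ _ (zmod TX)).
- exact: lin_comp chT_lin dl.
- exact: lin_comp (@chf2_gchar_lin a b) (@extl a b).
move=> u v; move: u; apply: (@pmod_ext _ _ _ (zmod TX)).
- apply: lin_comp chT_lin _; apply: lin_comp dl _.
  exact: ((@tmul_bilin _ _ _).1 _).
- apply: (lin_comp (@chf2_gchar_lin a b)); apply: (lin_comp (@extl a b)).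
  exact: ((@tmul_bilin _ _ _).1 _).
move=> V; move: v; apply: (@pmod_ext _ _ _ (zmod TX)).
- apply: lin_comp chT_lin _; apply: lin_comp dl _.
  exact: ((@tmul_bilin _ _ _).2 _).
- apply: (lin_comp (@chf2_gchar_lin a b)); apply: (lin_comp (@extl a b)).
  exact: ((@tmul_bilin _ _ _).2 _).
move=> W; rewrite (tlift_tmul (@din_tmul_bilin a b)) -/(gcls V) -/(gcls W).
rewrite (extmap_gcls charK (@splitK _) (sG _)) chT_tmul !ch_din.
rewrite -chf2_tmul; apply: eq_chf2 => p.
by rewrite !gchar_gcls chi_extprod.
Qed.

Lemma comulX_chf n (g : 'S_n -> K) :
  comulX (chf g) = n`!%:R^-1 *: \sum_s g s^-1%g *: comulX (cls s).
Proof.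
rewrite /chf card_Sym (linZ _ _ (@comulX_lin K)) (lin_sum _ _ (@comulX_lin K)).
by congr (_ *: _); apply: eq_bigr => s _; rewrite (linZ _ _ (@comulX_lin K)).
Qed.

Lemma comulX_ch n (V : rep K 'S_n) (t : forall a : 'I_n.+1, tens (RSn K a) (RSn K (n - a))) :
  (forall a, extmap (t a) = gcls (pull (join_inM (subnKC (leq_ord a))) V)) ->
  chT (\sum_a tlift (fun u v => (din u : RS) ⊗ (din v : RS)) (t a)) =
  comulX (ch (rcls V)).
Proof.
move=> tP; rewrite (lin_sum _ _ chT_lin) ch_rcls comulX_chf.
rewrite (comulX_sum (f := fun s => chi V s^-1%g) charK); last first.
  by move=> s w; rewrite -conjVg chiJ.
apply: eq_bigr => a _; rewrite chT_extmap tP.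
have e : chf2 (gchar (gcls (pull (join_inM (subnKC (leq_ord a))) V))) =
    (a`! * (n - a)`!)%:R^-1 *: \sum_(p : 'S_a * 'S_(n - a))
      chi V (join_in (subnKC (leq_ord a)) p)^-1%g *: (cls p.1 ⊗ cls p.2 : TX).
  rewrite /chf2; congr (_ *: _).
  apply: eq_bigr => p _; rewrite gchar_gcls /chi /=.
  congr (\tr (V _) *: _); apply: (mulgI (join_in (subnKC (leq_ord a)) p)).
  rewrite -join_inM !mulgV; apply: (mulgI (join_in (subnKC (leq_ord a)) 1%g)).
  by rewrite -join_inM !mulg1.
exact: e.
Qed.

Lemma comulR_ch (D : RS -> TR) : is_comulR D -> forall x, chT (D x) = comulX (ch x).
Proof.
move=> [Dl DP]; apply: (@RS_ext (zmod TX)).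
- exact: lin_comp chT_lin Dl.
- apply: additive_linear_zmodule => x y; rewrite chD; exact: linD (@comulX_lin K).
move=> n V; have [t [tP ->]] := DP n V; exact: comulX_ch.
Qed.

Lemma ext_lifts n (V : rep K 'S_n) :
  exists t : forall a : 'I_n.+1, tens (RSn K a) (RSn K (n - a)),
    forall a, extmap (t a) = gcls (pull (join_inM (subnKC (leq_ord a))) V).
Proof.
have h (a : 'I_n.+1) : exists t : tens (RSn K a) (RSn K (n - a)),
    extmap t = gcls (pull (join_inM (subnKC (leq_ord a))) V).
  exact: (extmap_surj charK (@splitK _) (@splitK _) (@splitK _) (sG _) (sG _) (sG _)).
exists (fun a => sval (cid (h a))) => a; exact: svalP (cid (h a)).
Qed.

(** Integrality of the comultiplication: restrictions of Specht modules lift along [extmap], and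
    [chT] maps these lifts to the comultiplication of K[X]. *)
Lemma comulX_lift x : exists t, chT t = comulX (ch x).
Proof.
have [s ->] := RS_span x; elim: s => [|p s [t' t'E]].
  exists 0; rewrite (lin0 chT_lin) big_nil [ch 0](lin0 ch_lin).
  by rewrite [comulX _](lin0 (@comulX_lin K)).
have [t tP] := ext_lifts (specht K p.2).
exists (p.1 *: (\sum_a tlift (fun u v => (din u : RS) ⊗ (din v : RS)) (t a)) + t').
rewrite (linD _ _ chT_lin) t'E big_cons chD chZ (linZ _ _ chT_lin) (comulX_ch tP).
rewrite [RHS](linD _ _ (@comulX_lin K)); congr (_ + _).
by rewrite -scaler_int (linZ _ _ (@comulX_lin K)) scaler_int.
Qed.

(** The map is the unique lift of the comultiplication of K[X] through the injective [chT], after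
    which linearity and the restriction formula are checked. *)
Lemma exists_uniq_comulR : exists! D, @is_comulR K D.
Proof.
pose D x := sval (cid (comulX_lift x)).
have DE x : chT (D x) = comulX (ch x) := svalP (cid (comulX_lift x)).
exists D; split; last first.
  move=> D' /comulR_ch D'E; apply/functional_extensionality_dep => x.
  by apply: chT_inj; rewrite DE D'E.
split.
  apply: additive_linear_int => x y; apply: chT_inj.
  by rewrite (linD _ _ chT_lin) !DE chD; apply: linD (@comulX_lin K).
move=> n V; have [t tP] := ext_lifts V; exists t; split=> //.
by apply: chT_inj; rewrite DE (comulX_ch tP).
Qed.

(** By [clsJ] the class map is a class function, so [induced_sum] reduces the sum to pairs (s, t),
    where the class of the join is a product. *)
Lemma ch_induced a b (V : rep K 'S_a) (W : rep K 'S_b) :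
  ch (rcls (induced (@joinM a b) (@join_inj a b) (extprod V W))) =
  chf (chi V) * chf (chi W).
Proof.
rewrite ch_rcls /chf (induced_sum charK _ _ _ (fun x y => clsJ K x y)).
rewrite mulXZl mulXZr scalerA cardsT card_prod -!cardsT natrM invfM.
congr (_ *: _); rewrite mulr_suml.
under [RHS]eq_bigr => s _ do rewrite mulr_sumr.
rewrite pair_bigA; apply: eq_bigr => -[s t] _ /=.
have e : cls s * cls t = cls (join (s, t)) := mulX_cls K s t.
by rewrite chi_extprod /= mulXZl mulXZr scalerA e.
Qed.

Definition indprod a b (u : RSn K a) (v : RSn K b) : RS :=
  plift (fun V => plift (fun W =>
      rcls (induced (@joinM a b) (@join_inj a b) (extprod V W))) v) u.

(** Compatibility of induction with isomorphisms and exact sequences is tested after the injective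
    [ch], where it becomes additivity of characters. *)
Lemma indprod_inner_rel a b (V : rep K 'S_a) r : groth_rel r ->
  plin (fun W : rep K 'S_b =>
    rcls (induced (@joinM a b) (@join_inj a b) (extprod V W))) r = 0.
Proof.
apply: (@groth_rel_lift _ _ _ (zmod KX) unit _ (fun _ x => ch x)
  (fun _ g => chf (chi V) * chf g)).
- by move=> _; apply: ch_lin.
- by move=> u /(_ tt); apply: ch_eq0.
- by move=> _ g h; rewrite chfD; apply: mulrDr.
- by move=> _ W; apply: ch_induced.
Qed.

Lemma ch_indprod_inner a b (V : rep K 'S_a) (v : RSn K b) :
  ch (plift (fun W : rep K 'S_b =>
    rcls (induced (@joinM a b) (@join_inj a b) (extprod V W))) v) =
  chf (chi V) * chf (gchar v).
Proof.
move: v; apply: (@pmod_ext _ _ _ (zmod KX)).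
- exact: lin_comp ch_lin (plift_lin (@indprod_inner_rel a b V)).
- apply: additive_linear_zmodule => u v; rewrite (linD _ _ (@chf_gchar_lin b)); exact: mulrDr.
move=> W; rewrite (plift_gen (@indprod_inner_rel a b V)) ch_induced.
by congr (_ * _); apply/eq_chf/fsym/gchar_gcls.
Qed.

Lemma indprod_outer_rel a b (v : RSn K b) r : groth_rel r ->
  plin (fun V : rep K 'S_a => plift (fun W : rep K 'S_b =>
    rcls (induced (@joinM a b) (@join_inj a b) (extprod V W))) v) r = 0.
Proof.
apply: (@groth_rel_lift _ _ _ (zmod KX) unit _ (fun _ x => ch x)
  (fun _ g => chf g * chf (gchar v))).
- by move=> _; apply: ch_lin.
- by move=> u /(_ tt); apply: ch_eq0.
- by move=> _ g h; rewrite chfD; apply: mulrDl.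
- by move=> _ W; apply: ch_indprod_inner.
Qed.

Lemma indprod_lin a b (u : RSn K a) : linear (fun v : RSn K b => indprod u v).
Proof. by apply: plift_linl => V; apply: plift_lin (@indprod_inner_rel a b V). Qed.

Lemma mulR_lin_l y : linear (fun x => @mulR K x y).
Proof.
apply: dlift_lin => a; apply: dlift_linl => b v.
exact: plift_lin (@indprod_outer_rel a b v).
Qed.

Lemma mulR_lin_r x : linear (@mulR K x).
Proof.
apply: (@dlift_linl _ _ RS RS (fun y a u => dlift (fun b v => indprod u v) y)).
by move=> a u; apply: dlift_lin => b; apply: indprod_lin.
Qed.

Lemma mulR_rcls a b (V : rep K 'S_a) (W : rep K 'S_b) :
  mulR (rcls V) (rcls W) =
  rcls (induced (@joinM a b) (@join_inj a b) (extprod V W)).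
Proof.
rewrite /mulR {1}/rcls dlift_din; last first.
  move=> m; rewrite /dlift big1 // => i _; exact: plift0 (@indprod_outer_rel m i _).
rewrite {1}/rcls dlift_din; last first.
  by move=> m; apply: (lin0 (@indprod_lin a m _)).
rewrite (plift_gen (@indprod_outer_rel a b _)).
exact: (plift_gen (@indprod_inner_rel a b V)).
Qed.

Lemma ch_mulR x y : ch (mulR x y) = ch x * ch y.
Proof.
move: x; apply: (@RS_ext (zmod KX)).
- exact: lin_comp ch_lin (@mulR_lin_l y).
- by apply: additive_linear_zmodule => u v; rewrite chD; apply: mulrDl.
move=> a V; move: y; apply: (@RS_ext (zmod KX)).
- exact: lin_comp ch_lin (@mulR_lin_r _).
- by apply: additive_linear_zmodule => u v; rewrite chD; apply: mulrDr.
by move=> b W; rewrite mulR_rcls ch_induced !ch_rcls.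
Qed.

Lemma RS_ext_specht (P : lmodType int) (f g : RS -> P) : linear f -> linear g ->
  (forall l, f (specht_class l) = g (specht_class l)) -> f =1 g.
Proof.
move=> f_lin g_lin fg x; have [s ->] := RS_span x.
rewrite (lin_sum _ _ f_lin) (lin_sum _ _ g_lin); apply: eq_bigr => p _.
by rewrite (linZ _ _ f_lin) (linZ _ _ g_lin) fg.
Qed.

Lemma formX_int x y : exists z : int, formX (ch x) (ch y) = z%:~R.
Proof.
have [s ->] := RS_span x; elim: s => [|p s [z zE]].
  by exists 0; rewrite big_nil [ch 0](lin0 ch_lin) (lin0 (fl _)).
have [w wE] : exists w : int, formX (ch (specht_class p.2)) (ch y) = w%:~R.
  have [t ->] := RS_span y; elim: t => [|q t [w wE]].
    by exists 0; rewrite big_nil [ch 0](lin0 ch_lin) (lin0 (fr _)).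
  exists (q.1 * (p.2 == q.2)%:R + w).
  rewrite big_cons chD (linD _ _ (fr _)) wE chZ -scaler_int (linZ _ _ (fr _)).
  rewrite formX_specht_class intrD intrM; congr (_ * _ + _); by case: eqP.
exists (p.1 * w + z).
rewrite big_cons chD (linD _ _ (fl _)) zE chZ -scaler_int (linZ _ _ (fl _)).
by rewrite wE intrD intrM.
Qed.

(** The axioms fix [f] on Specht classes, where it agrees with the form of K[X]; bilinearity does
    the rest. *)
Lemma is_formR_ch f : @is_formR K f ->
  forall x y, formX (ch x) (ch y) = (f x y)%:~R.
Proof.
move=> [[fl' fr'] firr fneq].
have fspc l m : f (specht_class l) (specht_class m) = (l == m)%:R.
  have [elm|nlm] := eqVneq (sumn l) (sumn m); last first.
    rewrite /specht_class fneq //; case: eqP => // e; by rewrite e eqxx in nlm.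
  have [f1 f0] := firr _ _ _ (gspecht_irr charK (erefl (sumn l))) (gspecht_irr charK (esym elm)).
  rewrite (rcls_gspecht (erefl (sumn l))) (rcls_gspecht (esym elm)) in f1 f0.
  have [e|ne] := eqVneq l m; first by rewrite f1 // e; apply: mx_rsim_refl.
  rewrite f0 // => rs; case/eqP: ne; apply: part_count.
  exact: (gspecht_rsim charK (erefl (sumn l)) (esym elm) rs).
move=> x y; move: x; apply: (@RS_ext_specht (zmod K)).
- by apply: additive_linear_zmodule => u v; rewrite chD (linD _ _ (fl _)).
- by apply: additive_linear_zmodule => u v; rewrite (linD _ _ (fl' _)) intrD.
move=> l; move: y; apply: (@RS_ext_specht (zmod K)).
- by apply: additive_linear_zmodule => u v; rewrite chD (linD _ _ (fr _)).
- by apply: additive_linear_zmodule => u v; rewrite (linD _ _ (fr' _)) intrD.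
by move=> m; rewrite formX_specht_class fspc; case: eqP.
Qed.

Lemma exists_uniq_formR : exists! f, @is_formR K f.
Proof.
pose f x y := sval (cid (formX_int x y)).
have fE x y : formX (ch x) (ch y) = (f x y)%:~R := svalP (cid (formX_int x y)).
exists f; split; last first.
  move=> g /is_formR_ch gE; apply/functional_extensionality_dep => x.
  apply/functional_extensionality_dep => y; apply: (intK_inj charK).
  by rewrite -fE -gE.
split.
- split=> [y|x]; apply: additive_linear_int => u v; apply: (intK_inj charK).
    by rewrite intrD -!fE chD (linD _ _ (fl _)).
  by rewrite intrD -!fE chD (linD _ _ (fr _)).
- move=> n V W iV iW.
  have e : (f (rcls V) (rcls W))%:~R = (irr_of (sG _) V == irr_of (sG _) W)%:R :> K.
    rewrite -fE !ch_rcls formX_chf; last by move=> x y; rewrite chiJ.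
    exact: (@irr_cdot _ charK _ (@splitK _) (sG _) _ _ iV iW).
  split=> rs; apply: (intK_inj charK); rewrite e.
    by rewrite (irr_of_rsim charK (sG _) rs) eqxx.
  by case: eqP => // /(rsim_irr_of charK iV iW).
- move=> m n V W mn; apply: (intK_inj charK).
  by rewrite -fE !ch_rcls formX_chf_neq // mulr0z.
Qed.

End Frobenius.

(** * The elements {l} and the lattice they span *)

Section Brace.
Variable K : closedFieldType.
Hypothesis charK : [pchar K] =i pred0.

Lemma split_closed (gT : finGroupType) : group_splitting_field K [set: gT]%G.
Proof. exact: group_closure_closed_field. Qed.

Definition dec_irr (gT : finGroupType) : irrType K [set: gT]%G :=
  DecSocleType (regular_repr K [set: gT]%G).

Lemma brace_ch l : brace K l = ch (specht_class K l).
Proof.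
have irrl := specht_irr charK l.
rewrite /specht_class ch_rcls /brace /chf /central_idem_elt linear_sum.
rewrite (lin_sum _ _ (@din_lin _ _ _)) !scaler_sumr; apply: eq_bigr => s _.
have din_clsZ (c : K) : din (pclass (@coinv_rel K _) (c *: << s >>)) = c *: cls K s.
  by rewrite linearZ; apply: (linZ _ _ (@din_lin _ _ _)).
rewrite din_clsZ [LHS]scalerA [RHS]scalerA.
apply: (congr1 (fun c : K => c *: cls K s)).
have := Wedderburn_coef charK (@split_closed _) (irr_of (dec_irr _) (specht K l) : dec_irr _) s.
move=> e; rewrite [X in _^-1 * X]e.
(* The idempotent belongs to the copy of the Specht module inside the regular representation; degree
   and character are carried over by isomorphism, and the degree then cancels. *)
have rs := irr_ofP charK (dec_irr _) irrl.
rewrite -(mxrank_rsim rs) -(chi_rsim rs) mulrCA mulKf //.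
by rewrite natK_eq0 // -lt0n; apply: rep_dim_gt0.
Qed.

Lemma lattice_ch (x : KX K) : reflect (exists y, ch y = x) (x \in @lattice K).
Proof.
have bz (s : seq (int * part)) :
    ch (\sum_(p <- s) p.1 *: specht_class K p.2) = \sum_(p <- s) brace K p.2 *~ p.1.
  rewrite (lin_sum _ _ (@ch_lin K)); apply: eq_bigr => p _.
  by rewrite brace_ch chZ.
apply: (iffP (asboolP _)) => [[s ->]|[y <-]].
  by exists (\sum_(p <- s) p.1 *: specht_class K p.2).
have [s ->] := RS_span charK split_closed dec_irr y.
by exists s.
Qed.

End Brace.

Theorem mainTheorem6 (K : closedFieldType) (charK : [pchar K] =i pred0) :
  (* the structure maps given by characterising properties are well defined *)
  [/\ exists! DX : KX K -> tens (KX K) (KX K), is_comulX DX,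
      exists! DR : RS K -> tens (RS K) (RS K), is_comulR DR
    & exists! fR : RS K -> RS K -> int, is_formR fR] /\
  forall (DX : KX K -> tens (KX K) (KX K))
         (DR : RS K -> tens (RS K) (RS K))
         (fR : RS K -> RS K -> int),
    is_comulX DX -> is_comulR DR -> is_formR fR ->
    [/\ is_basis (@brace K),
        forall l m : part, formX (brace K l) (brace K m) = (l == m)%:R
      & exists Phi : {additive latA K -> RS K},
          [/\ bijective Phi,
              forall l : part, Phi (braceA K l) = rcls (specht K l),
              forall x y : latA K,
                exists2 z : latA K, latval z = mulX (latval x) (latval y)
                                  & Phi z = mulR (Phi x) (Phi y),
              forall x : latA K,
                (exists s : seq (latA K * latA K),
                   DX (latval x) = \sum_(p <- s) latval p.1 ⊗ latval p.2) /\
                (forall s : seq (latA K * latA K),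
                   DX (latval x) = \sum_(p <- s) latval p.1 ⊗ latval p.2 <->
                   DR (Phi x) = \sum_(p <- s) Phi p.1 ⊗ Phi p.2)
            & forall x y : latA K,
                formX (latval x) (latval y) = (fR (Phi x) (Phi y))%:~R]].
Proof.
have split := @split_closed K; pose sG := @dec_irr K.
split; first split.
- exact: exists_uniq_comulX.
- exact: (exists_uniq_comulR charK split sG).
- exact: (exists_uniq_formR charK split sG).
move=> DX DR fR DXP DRP fRP; split.
- have -> : @brace K = fun l => ch (specht_class K l).
    by apply/functional_extensionality_dep => l; apply: brace_ch.
  exact: (specht_class_basis charK split sG).
- by move=> l m; rewrite !brace_ch //; apply: (formX_specht_class charK split sG).
(* [Phi] is the inverse of [ch] on the lattice, so its properties are checked after applying
   [ch]. *)
have phiP (x : latA K) : exists y, ch y = latval x.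
  by apply/(lattice_ch charK)/(valP x).
have [phi phiE] := choice phiP.
have chI : injective (@ch K) := ch_inj charK split sG.
have phiB : zmod_morphism phi.
  move=> x y; apply: chI; rewrite (linB _ _ (@ch_lin K)) !phiE.
  exact: (raddfB (\val : latA K -> KX K) x y).
pose Phi : {additive latA K -> RS K} :=
  HB.pack phi (GRing.isZmodMorphism.Build _ _ phi phiB).
have PhiE x : ch (Phi x) = latval x := phiE x.
have gP (y : RS K) : ch y \in @lattice K by apply/(lattice_ch charK); exists y.
pose g y := LatA (gP y).
have gK : cancel g Phi by move=> y; apply: chI; rewrite PhiE.
have Phi_inj : injective Phi.
  by move=> x y e; apply: val_inj; rewrite /= -!PhiE e.
have Phig : cancel Phi g by move=> x; apply: Phi_inj; rewrite gK.
have DXE : DX = @comulX K := is_comulX_uniq DXP (comulXP K).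
(* Both comultiplications are compared in the tensor square of K[X], where injectivity of [chT]
   turns an expansion on one side into one on the other. *)
have TE (s : seq (latA K * latA K)) :
    chT (\sum_(p <- s) Phi p.1 ⊗ Phi p.2) =
    \sum_(p <- s) latval p.1 ⊗ latval p.2.
  rewrite (lin_sum _ _ (@chT_lin K)); apply: eq_bigr => p _.
  by rewrite chT_tmul !PhiE.
have DE x : DX (latval x) = chT (DR (Phi x)).
  by rewrite DXE -PhiE (comulR_ch charK split sG DRP).
exists Phi; split.
- by exists g.
- by move=> l; apply: chI; rewrite PhiE /= brace_ch.
- move=> x y; exists (g (mulR (Phi x) (Phi y))); last by rewrite gK.
  by rewrite /= (ch_mulR charK split sG) !PhiE.
- move=> x; split.
    have [s sE] := tens_span (DR (Phi x)).
    exists [seq (g p.1, g p.2) | p <- s].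
    rewrite -TE DE big_map sE; congr chT; apply: eq_bigr => p _.
    by rewrite !gK.
  move=> s; rewrite DE -TE; split=> [|->] //.
  exact: (chT_inj charK split sG).
- by move=> x y; rewrite -!PhiE; apply: (is_formR_ch charK split sG fRP).
Qed.
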